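(* Let $D$ be a two-dimensional regular local ring with fixed regular system of parameters $x,y$, let $0<a<b$ be real numbers, and let $I=[a,b]$. Let $X$ be the set of external rank $2$ valuation overrings of the interval ring $T_I$. Then $X$ is a defining family for $T_I$, every defining family for $T_I$ contains $X$ (so $X$ is the unique minimal defining family), and $T_I$ is a vacant domain.
   Context: $D$ is a two-dimensional regular local ring with maximal ideal $\mathfrak m=(x,y)$ and quotient field $K$. An overring of a domain is a ring between it and its quotient field. Every nonzero element of $D$ can be written as $u_1\tau_1+\cdots+u_n\tau_n$ with $u_i$ units of $D$ and $\tau_i$ distinct monomials $x^py^q$ ($p,q\ge 0$ integers), none of which divides another in $D$; the set of monomials $\tau_i$ is uniquely determined by the element (and $x,y$). For real $r>0$, the monomial valuation $v_r$ on $K$ is defined by $v_r(0)=\infty$, $v_r(x^py^q)=p+qr$, $v_r(u_1\tau_1+\cdots+u_n\tau_n)=\min_i v_r(\tau_i)$ for such a representation, and $v_r(f/g)=v_r(f)-v_r(g)$ for $f,g\in D$, $g\neq 0$. Its valuation ring is $V_r=\{f\in K: v_r(f)\ge 0\}$. For $I=[a,b]$ the interval ring $T_I$ is the intersection of all valuation rings $V$ such that $D\subseteq V\subseteq V_r$ for some $r\in I$. For rational $r>0$ let ${W_r}^+=\{f\in K: \exists\,\delta>0 \text{ such that } v_s(f)\ge 0 \text{ for all } s\in(r,r+\delta)\}$ and ${W_r}^-=\{f\in K: \exists\,\delta>0 \text{ such that } v_s(f)\ge 0 \text{ for all } s\in(r-\delta,r)\}$; these are rank $2$ valuation rings with $D\subseteq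 {W_r}^{\pm}\subseteq V_r$. The internal rank $2$ valuation rings of $I$ are ${W_r}^+$ and ${W_r}^-$ for rational $r\in(a,b)$, together with ${W_a}^+$ if $a$ is rational and ${W_b}^-$ if $b$ is rational. All other rank $2$ valuation rings $V$ with $D\subseteq V\subseteq V_r$ for some $r\in I$ are called external. A defining family for an integrally closed domain $T$ is a collection $Y$ of valuation overrings of $T$ with $T=\bigcap_{V\in Y}V$. The patch topology on a set of valuation overrings has as a basis the sets $\{V: F\subseteq V,\ G\subseteq\mathfrak m_V\}$ with $F,G$ finite subsets of $K$, where $\mathfrak m_V$ is the maximal ideal of $V$. $T$ is vacant if it has a unique defining family up to inverse closure; that is, for every defining family $Y$ of $T$, every valuation overring of $T$ is either in $Y$, or is a limit point of $Y$ in the patch topology, or is an overring of a valuation ring in one of these two classes. *)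

(* Defs.v *)
From HB Require Import structures.
From mathcomp Require Import all_boot all_order all_algebra finmap.
From mathcomp Require Import all_classical all_reals topology.

Set Implicit Arguments.
Unset Strict Implicit.
Unset Printing Implicit Defensive.

Import Order.TTheory GRing.Theory Num.Theory.

Local Open Scope classical_set_scope.
Local Open Scope ring_scope.

(* All rings under consideration are subrings of one fixed field K, given as  *)
(* subsets A : set K; ideals of A are subsets of K as well.                   *)

Definition subring (K : fieldType) (A : set K) : Prop :=
  GRing.subring_closed [in A].

Definition quotient_field_of (K : fieldType) (A : set K) : Prop :=
  forall z, exists f g, [/\ A f, A g, g != 0 & z = f / g].

Definition unit_of (K : fieldType) (A : set K) (z : K) : Prop :=
  [/\ A z, z != 0 & A z^-1].

Definition divides_in (K : fieldType) (A : set K) (c d : K) : Prop :=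
  exists2 e, A e & d = e * c.

Definition ideal (K : fieldType) (A J : set K) : Prop :=
  [/\ J `<=` A, J 0, forall c d, J c -> J d -> J (c + d)
    & forall e c, A e -> J c -> J (e * c)].

Definition prime_ideal (K : fieldType) (A P : set K) : Prop :=
  [/\ ideal A P, ~ P 1
    & forall c d, A c -> A d -> P (c * d) -> P c \/ P d].

Definition maximal_ideal (K : fieldType) (A M : set K) : Prop :=
  [/\ ideal A M, ~ M 1
    & forall J, ideal A J -> ~ J 1 -> M `<=` J -> J = M].

Definition ideal_span (K : fieldType) (A : set K) (s : seq K) : set K :=
  [set z | exists2 c : nat -> K, (forall i, A (c i))
                             & z = \sum_(i < size s) c i * s`_i].

Definition noetherian (K : fieldType) (A : set K) : Prop :=
  forall J, ideal A J ->
    exists2 s : seq K, (forall t, t \in s -> A t) & J = ideal_span A s.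

Definition local_ring (K : fieldType) (A M : set K) : Prop :=
  maximal_ideal A M /\ forall N, maximal_ideal A N -> N = M.

Definition has_prime_chain (K : fieldType) (A : set K) (n : nat) : Prop :=
  exists P : nat -> set K,
    (forall i, (i <= n)%N -> prime_ideal A (P i)) /\
    (forall i, (i < n)%N -> P i `<` P i.+1).

Definition krull_dim (K : fieldType) (A : set K) (n : nat) : Prop :=
  has_prime_chain A n /\ ~ has_prime_chain A n.+1.

(* A is a Noetherian local ring whose maximal ideal is generated by s, where  *)
(* the number of generators is the dimension of A: a regular local ring with  *)
(* regular system of parameters s.                                            *)
Definition regular_local_with_parameters (K : fieldType) (A : set K)
    (s : seq K) : Prop :=
  [/\ subring A, noetherian A, local_ring A (ideal_span A s)
    & krull_dim A (size s)].

Definition integrally_closed (K : fieldType) (A : set K) : Prop :=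
  forall z, (exists p : {poly K}, [/\ p \is monic, forall i, A p`_i & root p z])
    -> A z.

Definition is_valuation_ring (K : fieldType) (V : set K) : Prop :=
  subring V /\ forall z : K, z != 0 -> V z \/ V z^-1.

Record valRing (K : fieldType) := ValRing {
  carrier : set K ;
  carrierP : is_valuation_ring carrier
}.

(* The non-units; max_ideal_ofP shows that this is the unique maximal ideal.  *)
Definition max_ideal_of (K : fieldType) (V : valRing K) : set K :=
  [set z | carrier V z /\ ~ unit_of (carrier V) z].

Lemma subringE (K : fieldType) (A : set K) :
  subring A <-> [/\ A 1, forall c d, A c -> A d -> A (c - d)
                       & forall c d, A c -> A d -> A (c * d)].
Proof.
split=> -[A1 AB AM]; split.
- by move: A1; rewrite inE.
- by move=> c d; move: (AB c d); rewrite !inE; apply.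
- by move=> c d; move: (AM c d); rewrite !inE; apply.
- by rewrite inE.
- by move=> c d; rewrite !inE; exact: AB.
- by move=> c d; rewrite !inE; exact: AM.
Qed.

Lemma max_ideal_ofP (K : fieldType) (V : valRing K) :
  local_ring (carrier V) (max_ideal_of V).
Proof.
have [/subringE [V1 VB VM] VV] := carrierP V.
have V0 : carrier V 0 by rewrite -(subrr 1); exact: VB.
have VN c : carrier V c -> carrier V (- c).
  by move=> Vc; rewrite -[- c]add0r; exact: VB.
have VD c d : carrier V c -> carrier V d -> carrier V (c + d).
  by move=> Vc Vd; rewrite -[d]opprK; apply: VB => //; exact: VN.
have mM e c : carrier V e -> max_ideal_of V c -> max_ideal_of V (e * c).
  move=> Ve [Vc nuc]; split; first exact: VM.
  case=> _; rewrite mulf_eq0 negb_or => /andP[e0 c0] Vec; apply: nuc.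
  split=> //; rewrite (_ : c^-1 = e * (e * c)^-1); first exact: VM.
  by rewrite invfM mulrA mulfV// mul1r.
have mD1 c d : max_ideal_of V c -> max_ideal_of V d -> c != 0 ->
    carrier V (d / c) -> max_ideal_of V (c + d).
  move=> mc md c0 Vdc; rewrite (_ : c + d = (1 + d / c) * c).
    by apply: mM => //; exact: VD.
  by rewrite mulrDl mul1r divfK.
have m_ideal : ideal (carrier V) (max_ideal_of V).
  split=> //; first by move=> z [].
    by split=> // -[_ /eqP].
  move=> c d mc md; have [->|c0] := eqVneq c 0; first by rewrite add0r.
  have [->|d0] := eqVneq d 0; first by rewrite addr0.
  case: (VV (d / c)); first by rewrite mulf_neq0 ?invr_eq0.
    exact: mD1.
  by rewrite invfM invrK mulrC addrC; exact: mD1.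
have proper_sub J : ideal (carrier V) J -> ~ J 1 -> J `<=` max_ideal_of V.
  move=> [JV _ _ JM] J1 z Jz; split; first exact: JV.
  by case=> _ z0 Vz; apply: J1; rewrite -(mulVf z0); exact: JM.
have m1 : ~ max_ideal_of V 1.
  by case=> _; apply; split; rewrite ?oner_neq0 ?invr1.
split.
  split=> // J idJ J1 mJ; apply/seteqP; split=> //; exact: proper_sub.
move=> N [idN N1 maxN]; apply/esym/maxN => //; exact: proper_sub.
Qed.

HB.instance Definition _ (K : fieldType) := gen_eqMixin (valRing K).
HB.instance Definition _ (K : fieldType) := gen_choiceMixin (valRing K).

(* The patch topology is put on all valuation rings of K. The set of          *)
(* valuation overrings of a ring T carries the subspace topology, and it is   *)
(* closed in valRing K, so a family of valuation overrings of T has the same  *)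
(* limit points in both spaces.                                               *)
Definition patch_basic (K : fieldType) (FG : {fset K} * {fset K}) :
    set (valRing K) :=
  [set V | (forall z, z \in FG.1 -> carrier V z) /\
           (forall z, z \in FG.2 -> max_ideal_of V z)].

Lemma patch_basic_cover (K : fieldType) :
  \bigcup_(FG in [set: {fset K} * {fset K}]) patch_basic FG = [set: valRing K].
Proof. by apply/seteqP; split=> // V _; exists (fset0, fset0). Qed.

Lemma patch_basic_join (K : fieldType) (i j : {fset K} * {fset K}) (V : valRing K) :
  [set: {fset K} * {fset K}] i -> [set: {fset K} * {fset K}] j ->
  patch_basic i V -> patch_basic j V ->
  exists k, [/\ [set: {fset K} * {fset K}] k, patch_basic k V
              & patch_basic k `<=` patch_basic i `&` patch_basic j].
Proof.
move=> _ _ [iV1 iV2] [jV1 jV2]; exists (i.1 `|` j.1, i.2 `|` j.2)%fset; split => //.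
  split=> z /=; rewrite in_fsetU => /orP[] zin.
  - exact: iV1.
  - exact: jV1.
  - exact: iV2.
  - exact: jV2.
by move=> W [W1 W2]; split; split=> z zin; [apply: W1|apply: W2|apply: W1|
  apply: W2]; rewrite in_fsetU zin ?orbT.
Qed.

HB.instance Definition _ (K : fieldType) :=
  isBaseTopological.Build (valRing K) (@patch_basic_cover K)
    (@patch_basic_join K).

Definition valuation_overring (K : fieldType) (T : set K) (V : valRing K) :
  Prop := T `<=` carrier V.

Definition defining_family (K : fieldType) (T : set K) (Y : set (valRing K)) :
    Prop :=
  Y `<=` valuation_overring T /\ T = \bigcap_(V in Y) carrier V.

Definition minimal_defining_family (K : fieldType) (T : set K)
    (Y : set (valRing K)) : Prop :=
  defining_family T Y /\
  forall Z, defining_family T Z -> Z `<=` Y -> Z = Y.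

(* Here, as in integrally_closed, T is meant to have quotient field K.        *)
Definition vacant (K : fieldType) (T : set K) : Prop :=
  [/\ subring T, integrally_closed T
    & forall Y, defining_family T Y ->
      forall V, valuation_overring T V ->
        [\/ Y V, limit_point Y V
          | exists2 W, Y W \/ limit_point Y W & carrier W `<=` carrier V]].

Definition monomial (K : fieldType) (x y : K) (t : nat * nat) : K :=
  x ^+ t.1 * y ^+ t.2.

(* The monomials x^p y^q are given by their exponents (p, q). Two distinct    *)
(* pairs in s never yield the same element of K, because equal elements       *)
(* divide each other.                                                         *)
Definition monomial_rep (K : fieldType) (D : set K) (x y f : K)
    (s : seq (nat * nat)) : Prop :=
  [/\ uniq s,
      forall t t', t \in s -> t' \in s -> t != t' ->
        ~ divides_in D (monomial x y t) (monomial x y t')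
    & exists2 u : nat * nat -> K, (forall t, t \in s -> unit_of D (u t))
        & f = \sum_(t <- s) u t * monomial x y t].

(* When D is regular local with parameters x, y and f in D is nonzero, the    *)
(* chosen list is determined up to order.                                     *)
Definition monomials_of (K : fieldType) (D : set K) (x y f : K) :
  seq (nat * nat) := xget [::] [set s | monomial_rep D x y f s].

(* v_r on D *)
Definition monomial_val_ring (R : realType) (K : fieldType) (D : set K)
    (x y : K) (r : R) (f : K) : \bar R :=
  if f == 0 then +oo%E
  else \big[mine/+oo%E]_(t <- monomials_of D x y f) (t.1%:R + t.2%:R * r)%:E.

(* v_r on the quotient field K of D; the value does not depend on the chosen  *)
(* fraction.                                                                  *)
Definition monomial_val (R : realType) (K : fieldType) (D : set K)
    (x y : K) (r : R) (h : K) : \bar R :=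
  let fg := xget (0, 1)
    [set fg | [/\ D fg.1, D fg.2, fg.2 != 0 & h = fg.1 / fg.2]] in
  (monomial_val_ring D x y r fg.1 - monomial_val_ring D x y r fg.2)%E.

Definition monomial_val_set (R : realType) (K : fieldType) (D : set K)
    (x y : K) (r : R) : set K :=
  [set h | (0 <= monomial_val D x y r h)%E].

Definition interval_ring (R : realType) (K : fieldType) (D : set K)
    (x y : K) (I : set R) : set K :=
  \bigcap_(V in [set V : valRing K | exists2 r, I r &
      D `<=` carrier V /\ carrier V `<=` monomial_val_set D x y r]) carrier V.

Definition W_plus (R : realType) (K : fieldType) (D : set K) (x y : K) (r : R) :
    set K :=
  [set h | exists2 d : R, 0 < d &
    forall s, r < s < r + d -> (0 <= monomial_val D x y s h)%E].

(* For r > 0 only small d matter, so negative values of s never intervene.    *)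
Definition W_minus (R : realType) (K : fieldType) (D : set K) (x y : K)
    (r : R) : set K :=
  [set h | exists2 d : R, 0 < d &
    forall s, r - d < s < r -> (0 <= monomial_val D x y s h)%E].

Definition rank2 (K : fieldType) (V : valRing K) : Prop :=
  krull_dim (carrier V) 2.

Definition internal_rank2 (R : realType) (K : fieldType) (D : set K)
    (x y : K) (a b : R) : set (valRing K) :=
  [set V | exists r : rat,
    [\/ a < ratr r < b /\ (carrier V = W_plus D x y (ratr r : R) \/
                           carrier V = W_minus D x y (ratr r : R)),
        ratr r = a /\ carrier V = W_plus D x y a
      | ratr r = b /\ carrier V = W_minus D x y b]].

Definition external_rank2 (R : realType) (K : fieldType) (D : set K)
    (x y : K) (a b : R) : set (valRing K) :=
  [set V | [/\ rank2 V,
      exists2 r : R, a <= r <= b &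
        D `<=` carrier V /\ carrier V `<=` monomial_val_set D x y r
    & ~ internal_rank2 D x y a b V]].

(* Main.v *)
Require Import Defs.
From HB Require Import structures.
From mathcomp Require Import all_boot all_order all_algebra finmap.
From mathcomp Require Import all_classical all_reals topology.
From mathcomp Require Import ring lra zify.

Set Implicit Arguments.
Unset Strict Implicit.
Unset Printing Implicit Defensive.

Import Order.TTheory GRing.Theory Num.Theory.

Local Open Scope classical_set_scope.
Local Open Scope ring_scope.

(** Write I for the interval [a, b] and T for its interval ring. An element of
positive value at all weights of I lies in T, because the maximal ideal of V_r
is contained in every valuation ring below V_r. This makes T large enough to
determine its valuation overrings: apart from K, each of them lies below V_r
for some r in I (overring_below). Indeed x^n z is in T for large n, so T[1/x]
is K; if 1/x is not in V, the cut of the rationals i / j such that y^j / x^i is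
in V defines r. If v_r(f) > v_r(g), choose a monomial t of g with v_r(t) =
v_r(g). Then v_s(t) >= v_s(g) for all s, so x t^n / g^n is in T, and (f / t)^n / x
is in V for large n by comparison of monomials; hence f / g is in V.

For irrational r the only valuation ring between D and V_r is V_r. For r = i / j
in lowest terms the residue field of V_r is k(t), where k is the residue field
of D and t the residue of theta = x^i / y^j, and the rings properly below V_r
have rank two and correspond to the monic irreducible polynomials and to the
place at infinity of k(t). Residues are not used explicitly: polynomials in
theta with coefficients in D replace the elements of k[t], and a polynomial q of
least degree with q(theta) in the maximal ideal of V and not in that of V_r
replaces the irreducible polynomial. By division with remainder every unit of V_r
is a power of q(theta) times an element that is a unit in all rings over q
(residue_structure), so q determines V (lies_over_unique), and V has rank two
(rank2_below).

An element of K is, for all weights s close to r on one side of r, or on both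
sides if r is irrational, a unit of D times a quotient of two monomials, up to a
factor 1 + e with v_s(e) > 0 (mval_trichotomy). So the internal rings and the
V_r with r irrational are limits of external rings below V_s with s rational
close to r (near_ring_limit), while V_r with r rational contains an external
ring, the one of the place t = 1 (val_at1). Hence every valuation overring of T
contains an external ring or a limit of external rings, which shows that the
external rings form a defining family and that T is vacant once every defining
family contains them.

For the latter, each external V below V_r is separated from all other valuation
overrings of T by one element z outside V. If theta and 1 / theta are in V, then
z = theta^d / q(theta)^2 with d the degree of q: the residue of z has its only
pole at V, and at a weight s other than r the value of q(theta) is that of one
of its extreme terms, so v_s(z) > 0 (separating_unit). If theta or 1 / theta is
in the maximal ideal of V, then V is a W_r^- or W_r^+, so r is an endpoint of I
because V is not internal, and z is the inverse of that element
(separating_max).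

The monomial valuations rest on the fact that x, y is a regular sequence
(regular_seq). It gives the expansions into monomials (expansion_exists), and
x^p y^q times a unit is never in the ideal generated by the monomials that do
not divide x^p y^q (mono_ideal_key), whence the value of a sum of
monomials with unit coefficients is the least weight and values are
multiplicative (has_valueM). *)

(** * Subrings and valuation rings of a field *)

Section Subring.
Variables (K : fieldType) (A : set K).
Hypothesis subA : subring A.

Lemma sub1 : A 1. Proof. by have /subringE[] := subA. Qed.
Lemma subB c d : A c -> A d -> A (c - d).
Proof. by have /subringE[_ + _] := subA; apply. Qed.
Lemma subM c d : A c -> A d -> A (c * d).
Proof. by have /subringE[_ _] := subA; apply. Qed.
Lemma sub0 : A 0. Proof. by rewrite -(subrr 1); apply/subB; exact: sub1. Qed.
Lemma subN c : A c -> A (- c).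
Proof. by rewrite -[- c]add0r; apply: subB; exact: sub0. Qed.
Lemma subD c d : A c -> A d -> A (c + d).
Proof. by move=> Ac Ad; rewrite -[d]opprK; apply/subB => //; exact: subN. Qed.
Lemma subX c n : A c -> A (c ^+ n).
Proof.
by move=> Ac; elim: n => [|n IH]; rewrite ?expr0 ?exprS; [exact: sub1|exact: subM].
Qed.
Lemma sub_sum (I : eqType) (s : seq I) (F : I -> K) :
  (forall i, i \in s -> A (F i)) -> A (\sum_(i <- s) F i).
Proof.
elim: s => [|i s IH] AF; first by rewrite big_nil; exact: sub0.
rewrite big_cons; apply: subD; first by apply: AF; rewrite mem_head.
by apply: IH => j js; apply: AF; rewrite inE js orbT.
Qed.

Lemma unit_ofM c d : unit_of A c -> unit_of A d -> unit_of A (c * d).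
Proof.
move=> [Ac c0 Acv] [Ad d0 Adv]; split; [exact: subM|exact: mulf_neq0|].
by rewrite invfM; exact: subM.
Qed.
Lemma unit_ofV c : unit_of A c -> unit_of A c^-1.
Proof. by move=> [Ac c0 Acv]; split; rewrite ?invr_eq0 ?invrK. Qed.
Lemma unit_of1 : unit_of A 1.
Proof. by split; rewrite ?oner_eq0 ?invr1//; exact: sub1. Qed.
Lemma unit_of_mull c d : A c -> A d -> unit_of A (c * d) -> unit_of A c.
Proof.
move=> Ac Ad [_]; rewrite mulf_eq0 negb_or => /andP[c0 d0]; rewrite invfM => Acd.
by split=> //; rewrite -(mulfK d0 c^-1) mulrAC; exact: subM.
Qed.

End Subring.

Ltac inring H :=
  repeat first [assumption | apply: (sub0 H) | apply: (sub1 H) | apply: (subD H)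
    | apply: (subN H) | apply: (subM H) | apply: (subX H)].

Section Valuation.
Variables (K : fieldType) (V : valRing K).
Let sV : subring (carrier V) := (carrierP V).1.
Let m := max_ideal_of V.

Lemma val_total z : carrier V z \/ carrier V z^-1.
Proof.
have [->|z0] := eqVneq z 0; first by left; exact: sub0.
exact: (carrierP V).2.
Qed.

Lemma max_idealE z : m z <-> z = 0 \/ ~ carrier V z^-1.
Proof.
split=> [[Vz nu]|].
  have [z0|z0] := eqVneq z 0; [by left|right => Vzi; exact: nu].
case=> [->|nV]; first by split; [exact: sub0|case=> _ /eqP].
by split; [case: (val_total z)|case].
Qed.

Lemma max_ideal_inv z : ~ carrier V z -> m z^-1.
Proof. by move=> nV; apply/max_idealE; right; rewrite invrK. Qed.

Lemma max_ideal_ideal : ideal (carrier V) m.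
Proof. by case: (max_ideal_ofP V) => -[]. Qed.

Lemma max_ideal_sub z : m z -> carrier V z.
Proof. by case. Qed.
Lemma max_ideal1 : ~ m 1.
Proof. by case: (max_ideal_ofP V) => -[]. Qed.
Lemma max_idealD c d : m c -> m d -> m (c + d).
Proof. by case: max_ideal_ideal => _ _ + _; apply. Qed.
Lemma max_idealM c d : carrier V c -> m d -> m (c * d).
Proof. by case: max_ideal_ideal => _ _ _; apply. Qed.
Lemma max_idealN c : m c -> m (- c).
Proof. by rewrite -mulN1r; apply: max_idealM; inring sV. Qed.
Lemma max_idealB c d : m c -> m d -> m (c - d).
Proof. by move=> mc md; apply: max_idealD => //; exact: max_idealN. Qed.
Lemma max_idealX c n : m c -> m (c ^+ n.+1).
Proof.
move=> mc; rewrite exprSr; apply: max_idealM => //; apply: (subX sV).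
exact: max_ideal_sub.
Qed.

Lemma val_unit z : carrier V z -> ~ m z -> unit_of (carrier V) z.
Proof. by move=> Vz nm; apply: contrapT => nu; exact: nm. Qed.
Lemma unit_not_max z : unit_of (carrier V) z -> ~ m z.
Proof. by move=> u []. Qed.
Lemma unitDmax z e : unit_of (carrier V) z -> m e -> unit_of (carrier V) (z + e).
Proof.
move=> uz me; apply: val_unit; first by have [Vz _ _] := uz; have [Ve _] := me; inring sV.
by move=> mze; case: (unit_not_max uz); rewrite -(addrK e z); exact: max_idealB.
Qed.
Lemma max_prime c d : carrier V c -> carrier V d -> m (c * d) -> m c \/ m d.
Proof.
move=> Vc Vd mcd; apply: contrapT => /not_orP[nc nd].
by apply: unit_not_max mcd; apply: unit_ofM => //; exact: val_unit.
Qed.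
Lemma max_pow c n : carrier V c -> m (c ^+ n) -> m c.
Proof.
move=> Vc; elim: n => [|n IH]; first by rewrite expr0 => /max_ideal1.
by rewrite exprS => /max_prime[]//; inring sV.
Qed.

Lemma val_integrally_closed : integrally_closed (carrier V).
Proof.
move=> z [p [pm pV rz]]; apply: contrapT => nV.
have z0 : z != 0 by apply/eqP => z0; apply: nV; rewrite z0; inring sV.
have mz := max_ideal_inv nV.
have sp : (0 < size p)%N by rewrite size_poly_gt0 monic_neq0.
have : p.[z] * z^-1 ^+ (size p).-1 = 0 by rewrite (rootP rz) mul0r.
rewrite horner_coef -(prednK sp) big_ord_recr/= mulrDl => /eqP.
have -> : p`_(size p).-1 = 1 by apply/eqP.
rewrite mul1r -exprMn mulfV// expr1n addr_eq0 => /eqP e1.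
apply: max_ideal1; rewrite -(opprK 1) -e1; apply: max_idealN.
rewrite mulr_suml; apply: (big_ind m) => [||i _].
- by apply/max_idealE; left.
- exact: max_idealD.
case: i => i /=; move: (size p).-1 => n lt; have -> : p`_i * z ^+ i * z^-1 ^+ n = p`_i * z^-1 ^+ (n - i.+1).+1.
  rewrite -{1}(subnK (ltnW lt)) -[(n - i)%N]subnSK//.
  by rewrite exprD mulrACA -exprMn mulfV// expr1n mulr1.
by apply: max_idealM => //; exact: max_idealX.
Qed.

Lemma val_pow z n : carrier V (z ^+ n.+1) -> carrier V z.
Proof.
move=> Vzn; apply: val_integrally_closed.
exists ('X^(n.+1) - (z ^+ n.+1)%:P); split.
- exact: monicXnsubC.
- move=> i; rewrite coefB coefXn coefC; case: eqP; case: eqP => *; inring sV.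
- by rewrite /root !hornerE subrr.
Qed.

End Valuation.

Lemma valRing_eq (K : fieldType) (V W : valRing K) :
  carrier V = carrier W -> V = W.
Proof.
case: V W => [A PA] [B PB] /= AB; case: _ / AB in PB *.
by rewrite (Prop_irrelevance PA PB).
Qed.

(** * Two-dimensional regular local rings *)

Section RegularLocal.
Variables (K : fieldType) (D : set K) (x y : K).
Hypothesis hD : regular_local_with_parameters D [:: x; y].

Lemma rlr_subring : subring D. Proof. by case: hD. Qed.
Let sD := rlr_subring.

Let M := ideal_span D [:: x; y].

Lemma span2P z : M z <-> exists e f, [/\ D e, D f & z = e * x + f * y].
Proof.
split=> [[c Dc ->]|[e [f [De Df ->]]]].
  by exists (c 0%N), (c 1%N); split=> //; rewrite !big_ord_recl big_ord0 /= addr0.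
exists (fun i => if i == 0%N then e else f); first by move=> i; case: ifP.
by rewrite !big_ord_recl big_ord0 /= addr0.
Qed.

Lemma rlr_maximal : maximal_ideal D M.
Proof. by case: hD => _ _ []. Qed.

Lemma rlr_x : D x.
Proof.
case: rlr_maximal => -[+ _ _ _] _ _; apply; apply/span2P.
by exists 1, 0; split; [inring sD|inring sD|rewrite mul1r mul0r addr0].
Qed.
Lemma rlr_y : D y.
Proof.
case: rlr_maximal => -[+ _ _ _] _ _; apply; apply/span2P.
by exists 0, 1; split; [inring sD|inring sD|rewrite mul1r mul0r add0r].
Qed.
Let Dx := rlr_x.
Let Dy := rlr_y.

Lemma rlr_swap : regular_local_with_parameters D [:: y; x].
Proof.
suff e : ideal_span D [:: y; x] = ideal_span D [:: x; y].
  by case: hD => *; split=> //; rewrite e.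
apply/seteqP; split=> z [c Dc ->].
  apply/span2P; exists (c 1%N), (c 0%N); split=> //.
  by rewrite !big_ord_recl big_ord0 /= addr0 addrC.
exists (fun i => if i == 0%N then c 1%N else c 0%N); first by move=> i; case: ifP.
by rewrite !big_ord_recl !big_ord0 /= !addr0 addrC.
Qed.

Lemma ideal_unit J u : ideal D J -> unit_of D u -> J u -> J 1.
Proof. by move=> [_ _ _ JM] [_ u0 Dv] Ju; rewrite -(mulVf u0); exact: JM. Qed.

Lemma unit_notin_span u : unit_of D u -> ~ M u.
Proof.
by move=> uu Mu; case: rlr_maximal => iM M1 _; exact: M1 (ideal_unit iM uu Mu).
Qed.

(** By Zorn's lemma a non-unit lies in a maximal ideal, and there is only one. *)
Lemma nonunit_in_span z : D z -> ~ unit_of D z -> M z.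
Proof.
move=> Dz nz.
pose P A := A = set0 \/ [/\ ideal D A, A z & ~ A 1].
have idz : ideal D [set w | exists2 e, D e & w = e * z].
  split=> [_ [e De ->]||_ _ [e De ->] [f Df ->]|e _ De [f Df ->]]; first by inring sD.
  - by exists 0; rewrite ?mul0r//; inring sD.
  - by exists (e + f); rewrite ?mulrDl//; inring sD.
  - by exists (e * f); rewrite ?mulrA//; inring sD.
have Pz : P [set w | exists2 e, D e & w = e * z].
  right; split=> //; first by exists 1; rewrite ?mul1r//; inring sD.
  move=> [e De e1]; apply: nz; split=> //.
    by apply: contra_eq_neq e1 => ->; rewrite mulr0 oner_neq0.
  rewrite (_ : z^-1 = e)//; apply: (mulIf (x := z)); last first.
    by rewrite -e1 mulVf//; apply: contra_eq_neq e1 => ->; rewrite mulr0 oner_neq0.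
  by apply: contra_eq_neq e1 => ->; rewrite mulr0 oner_neq0.
have [F FP totF|A [PA maxA]] := @Zorn_bigcup K P.
  have [F0|nF0] := pselect (exists2 A, F A & A !=set0); last first.
    left; rewrite -subset0 => w [A FA Aw]; apply: nF0; exists A => //; by exists w.
  have [A0 FA0 A0n] := F0.
  have good A w : F A -> A w -> [/\ ideal D A, A z & ~ A 1].
    by move=> FA Aw; case: (FP _ FA) => // e; move: Aw; rewrite e.
  have [w0 A0w0] := A0n; have [[_ A00 _ _] A0z _] := good _ _ FA0 A0w0.
  right; split.
  - split.
    + by move=> w [A FA Aw]; have [[AD _ _ _] _ _] := good _ _ FA Aw; exact: AD.
    + by exists A0.
    + move=> c d [A FA Ac] [B FB Bd].
      case: (totF _ _ FA FB) => AB.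
        by exists B => //; have [[_ _ BD _] _ _] := good _ _ FB Bd; apply: BD => //; exact: AB.
      by exists A => //; have [[_ _ AD _] _ _] := good _ _ FA Ac; apply: AD => //; exact: AB.
    + move=> e c De [A FA Ac]; exists A => //.
      by have [[_ _ _ AM] _ _] := good _ _ FA Ac; exact: AM.
  - by exists A0.
  - by move=> [A FA A1]; have [_ _] := good _ _ FA A1.
case: PA => [A0|[iA Az A1]].
  case: (maxA _ _ Pz); rewrite A0; split=> //.
  by move=> s; have /s : [set w | exists2 e, D e & w = e * z] 0; case: idz.
suff -> : M = A by [].
have [_ _ [_ uniqM] _] := hD; symmetry; apply: uniqM; split=> // J iJ J1 AJ.
apply/seteqP; split=> //; apply: contrapT => nJA.
by apply: (maxA J); [split|right; split=> //; exact: AJ].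
Qed.

Lemma unit_sub1 t c : M t -> D c -> unit_of D (1 - t * c).
Proof.
have [[MD M0 MA MM] M1 _] := rlr_maximal.
move=> Mt Dc; apply: contrapT => /nonunit_in_span Mn; apply: M1.
have Dt := MD _ Mt.
rewrite -(subrK (t * c) 1); apply: MA; first by apply: Mn; inring sD.
by rewrite mulrC; exact: MM.
Qed.

(** Nakayama's lemma for Q over J and multiplication by one element t of the
maximal ideal: a generator of Q modulo J can be expressed by the others,
because 1 - t c is a unit. *)
Lemma nakayama t J Q : M t -> ideal D J -> ideal D Q ->
  (forall q, Q q -> exists j q', [/\ J j, Q q' & q = j + t * q']) -> Q `<=` J.
Proof.
move=> Mt iJ iQ QJ; have [JD J0 JA JM] := iJ; have [QD Q0 QA QM] := iQ.
have Dt : D t by have [[MD _ _ _] _ _] := rlr_maximal; exact: MD.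
pose fix gen s : set K := if s is a :: s' then
  [set q | exists2 d, D d & gen s' (q - d * a)] else J.
have gen0 s : gen s 0.
  by elim: s => //= a s IH; exists 0; rewrite ?mul0r ?subr0//; inring sD.
have genD s q q' : gen s q -> gen s q' -> gen s (q + q').
  elim: s q q' => [|a s IH] q q' /=; first exact: JA.
  move=> [d Dd gd] [d' Dd' gd']; exists (d + d'); first by inring sD.
  by rewrite mulrDl opprD addrACA; exact: IH.
have genM s e q : D e -> gen s q -> gen s (e * q).
  move=> De; elim: s q => [|a s IH] q /=; first exact: JM.
  move=> [d Dd gd]; exists (e * d); first by inring sD.
  by rewrite -mulrA -mulrBr; exact: IH.
have genJ s q : J q -> gen s q.
  move=> Jq; elim: s => //= a s IH; exists 0; first by inring sD.
  by rewrite mul0r subr0.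
have main s : {in s, forall a, Q a} -> Q `<=` gen s -> Q `<=` J.
  elim: s => [|a s IH] // Qs Qgen; apply: IH.
    by move=> b bs; apply: Qs; rewrite inE bs orbT.
  have Qa : Q a by apply: Qs; rewrite mem_head.
  have [j [q' [Jj Qq' ea]]] := QJ _ Qa.
  have [c Dc gc] := Qgen _ Qq'.
  have [_ u0 Du] := unit_sub1 Mt Dc.
  have ga : gen s a.
    rewrite -(mulKf u0 a); apply/genM => //.
    rewrite (_ : (1 - t * c) * a = j + t * (q' - c * a)).
      by apply: genD; [exact: genJ|exact: genM].
    by rewrite mulrBl mul1r mulrBr {1}ea addrA mulrA.
  move=> q /Qgen [d Dd gd]; rewrite -(subrK (d * a) q); apply: genD => //.
  exact: genM.
have [_ noeth _ _] := hD; have [s Ds Qs] := noeth _ iQ.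
have Qsp (c : nat -> K) : (forall i, D (c i)) -> Q (\sum_(i < size s) c i * s`_i).
  by move=> Dc; rewrite Qs; exists c.
apply: (main s) => [a as_|q].
  rewrite -(nth_index 0 as_) (_ : _`_ _ =
      \sum_(i < size s) (if (i == index a s :> nat) then 1 else 0) * s`_i).
    by apply: (Qsp (fun i => if i == index a s then 1 else 0)) => i; case: ifP => _; inring sD.
  rewrite -index_mem in as_; rewrite (bigD1 (Ordinal as_))//= eqxx mul1r big1 ?addr0//.
  by move=> i; rewrite -val_eqE/= => /negbTE ->; rewrite mul0r.
rewrite Qs => -[c Dc ->]; elim: s c Dc {Ds Qs Qsp} => [|a s IH] c Dc.
  by rewrite big_ord0.
rewrite big_ord_recl/=; exists (c 0%N) => //; rewrite addrC addKr.
exact: (IH (fun i => c i.+1)).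
Qed.

Lemma span_x : M x.
Proof. by apply/span2P; exists 1, 0; split; [inring sD|inring sD|rewrite mul1r mul0r addr0]. Qed.
Lemma span_y : M y.
Proof. by apply/span2P; exists 0, 1; split; [inring sD|inring sD|rewrite mul1r mul0r add0r]. Qed.

(** Modulo x the maximal ideal is generated by y. *)
Lemma rlr_expand_y n z : D z ->
  (exists u i d, [/\ unit_of D u, (i < n)%N, D d & z = u * y ^+ i + x * d]) \/
  (exists e d, [/\ D e, D d & z = y ^+ n * e + x * d]).
Proof.
elim: n z => [|n IH] z Dz.
  by right; exists z, 0; split; rewrite ?mulr0 ?addr0 ?mul1r//; inring sD.
have [uz|nz] := pselect (unit_of D z).
  left; exists z, 0%N, 0; split=> //; first by inring sD.
  by rewrite mulr1 mulr0 addr0.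
have /span2P[e [f [De Df ->]]] := nonunit_in_span Dz nz.
have [[u [i [d [uu lt Dd ->]]]]|[e' [d [De' Dd ->]]]] := IH _ Df.
  left; exists u, i.+1, (e + d * y); split=> //; first by inring sD.
  by rewrite exprS; ring.
right; exists e', (e + d * y); split=> //; first by inring sD.
by rewrite exprS; ring.
Qed.

(** The case of Krull's principal ideal theorem that is needed: if a power of y
were in xD, the ideals of D that contain x would be generated by x and a power of
y. Let P be the middle prime of a chain of length two, so that x is not in P, and
let c be a nonzero element of P. The intersections Q_n of D with c^n D_P are then
stationary modulo x, so they are stationary by Nakayama's lemma, although c^n is
not in Q_(n+1). *)
Lemma pow_y_notin_x n e : D e -> y ^+ n <> x * e.
Proof.
move=> De ye; have [_ _ _ [[Pc [Pp Plt]] _]] := hD.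
have {Plt} [lt01 lt12] := (Plt 0%N isT, Plt 1%N isT).
have [[_ P00 _ _] _ _] := Pp 0%N isT.
have [iP P1 Pprime] := Pp 1%N isT; have [iP2 P21 _] := Pp 2%N isT.
set P := Pc 1%N in lt01 lt12 iP P1 Pprime; set P2 := Pc 2%N in lt12 iP2 P21.
have [PD Pz PA PM] := iP.
have nP2 : ~ P2 `<=` P by move: lt12 => [].
have xP : ~ P x.
  move=> Px; have Py : P y.
    have : P (y ^+ n) by rewrite ye mulrC; exact: PM.
    elim: n {ye} => [|n IH]; first by rewrite expr0 => /P1.
    by rewrite exprS => /Pprime[]//; inring sD.
  apply: nP2 => z P2z; have [P2D _ _ _] := iP2.
  have /span2P[f [g [Df Dg ->]]] : M z.
    by apply: nonunit_in_span; [exact: P2D|move=> uz; exact: P21 (ideal_unit iP2 uz P2z)].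
  by apply: PA; exact: PM.
have [c Pc' c0] : exists2 c, P c & c != 0.
  apply: contrapT => nc; case: lt01 => _; apply=> c Pc'.
  by have [->//|c0] := eqVneq c 0; case: nc; exists c.
have Dc := PD _ Pc'.
pose Q n := [set z | D z /\ exists s d, [/\ D s, ~ P s, D d & s * z = c ^+ n * d]].
have iQ k : ideal D (Q k).
  split=> [z []//|||].
  - split; [by inring sD|exists 1, 0; split; rewrite ?mulr0//; inring sD].
  - move=> z z' [Dz [s [d [Ds Ps Dd e1]]]] [Dz' [s' [d' [Ds' Ps' Dd' e2]]]].
    split; first by inring sD.
    exists (s * s'), (s' * d + s * d'); split; [by inring sD| |by inring sD|].
      by move=> /Pprime[].
    have -> : s * s' * (z + z') = s' * (s * z) + s * (s' * z') by ring.
    by rewrite e1 e2; ring.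
  - move=> f z Df [Dz [s [d [Ds Ps Dd e1]]]]; split; first by inring sD.
    exists s, (f * d); split=> //; first by inring sD.
    by rewrite mulrCA e1 mulrCA.
have QS k : Q k.+1 `<=` Q k.
  move=> z [Dz [s [d [Ds Ps Dd e1]]]]; split=> //; exists s, (c * d).
  by split=> //; [inring sD|rewrite e1 exprSr mulrA].
pose J n := [set z | exists w d, [/\ Q n w, D d & z = w + x * d]].
have JM k f z : D f -> J k z -> J k (f * z).
  move=> Df [w [d [Qw Dd ->]]]; exists (f * w), (f * d); split.
  - by case: (iQ k) => _ _ _; apply.
  - by inring sD.
  - by rewrite mulrDr mulrCA.
have JD k z d : D d -> J k z -> J k (z + x * d).
  move=> Dd [w [d' [Qw Dd' ->]]]; exists w, (d' + d); split=> //; first by inring sD.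
  by rewrite -addrA -mulrDr.
have [k Jk] : exists k, forall i, J k (y ^+ i) -> J k.+1 (y ^+ i).
  apply: contrapT => nk; have {}nk k : exists i, J k (y ^+ i) /\ ~ J k.+1 (y ^+ i).
    apply: contrapT => nki; apply: nk; exists k => i Ji; apply: contrapT => nJi.
    by apply: nki; exists i.
  have Jle k i : J k (y ^+ i) -> (k <= i)%N.
    elim: k i => // k IH i Ji; have [i0 [/IH le nJ]] := nk k.
    rewrite (leq_ltn_trans le)// ltnNge; apply/negP => lei; apply: nJ.
    by rewrite -(subnK lei) exprD; apply: JM => //; inring sD.
  have : J n.+1 (y ^+ n).
    by exists 0, e; split; rewrite ?add0r//; case: (iQ n.+1).
  by move/Jle; rewrite ltnn.
have Qk : Q k `<=` Q k.+1.
  apply: (@nakayama x) => //; [exact: span_x|] => z Qz.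
  have [w [d [Qw Dd zE]]] : J k.+1 z.
    have [[u [i [d [uu _ Dd zE]]]]|[f [d [Df Dd ->]]]] := @rlr_expand_y n z Qz.1.
      have [Du u0 Dv] := uu; rewrite zE; apply/JD => //; apply/JM => //; apply: Jk.
      rewrite (_ : y ^+ i = u^-1 * (z + x * - d)); last by rewrite zE mulrN addrK mulKf.
      apply: JM => //; apply: JD; first by inring sD.
      by exists z, 0; split; rewrite ?mulr0 ?addr0//; inring sD.
    apply: JD => //; exists 0, (e * f); split; [by case: (iQ k.+1)|by inring sD|].
    by rewrite ye add0r mulrA.
  exists w, d; split=> //; split=> //.
  have [_ [s [f [Ds Ps Df e1]]]] : Q k (x * d).
    rewrite (_ : x * d = z + (- 1) * w); last by rewrite zE mulN1r addrC addKr.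
    case: (iQ k) => _ _ QA QM; apply/QA => //; apply/QM; first by inring sD.
    exact: QS.
  exists (s * x), f; split=> //; [by inring sD|by case/Pprime|by rewrite -mulrA].
have [_ [s [d [Ds Ps Dd]]]] : Q k.+1 (c ^+ k).
  apply: Qk; split; first by inring sD.
  by exists 1, 1; split; rewrite ?mulr1 ?mul1r//; inring sD.
rewrite exprSr mulrC -mulrA => /mulfI => /(_ (expf_neq0 _ c0)) sE.
by apply: Ps; rewrite sE mulrC; exact: PM.
Qed.

(** The elements c such that c y^k is in xD for some k form an ideal. None of
them is congruent modulo x to a unit, so each is congruent to y times another
one, and Nakayama's lemma applies. *)
Lemma regular_seq c e : D c -> D e -> c * y = x * e -> exists2 d, D d & c = x * d.
Proof.
move=> Dc De ce.
pose J := [set z | exists2 d, D d & z = x * d].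
pose Q := [set z | D z /\ exists k f, D f /\ z * y ^+ k = x * f].
have iJ : ideal D J.
  split=> [_ [d Dd ->]||_ _ [d Dd ->] [d' Dd' ->]|f _ Df [d Dd ->]].
  - by inring sD.
  - by exists 0; rewrite ?mulr0//; inring sD.
  - by exists (d + d'); rewrite ?mulrDr//; inring sD.
  - by exists (f * d); rewrite 1?mulrCA//; inring sD.
have iQ : ideal D Q.
  split=> [z []//|||].
  - by split; [inring sD|exists 0%N, 0; split; rewrite ?mulr0 ?mul0r//; inring sD].
  - move=> z z' [Dz [k [f [Df e1]]]] [Dz' [k' [f' [Df' e2]]]]; split; first by inring sD.
    exists (k + k')%N, (f * y ^+ k' + f' * y ^+ k); split; first by inring sD.
    have -> : (z + z') * y ^+ (k + k') = (z * y ^+ k) * y ^+ k' + (z' * y ^+ k') * y ^+ k.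
      by rewrite exprD; ring.
    by rewrite e1 e2; ring.
  - move=> g z Dg [Dz [k [f [Df e1]]]]; split; first by inring sD.
    by exists k, (g * f); split; [inring sD|rewrite -mulrA e1 mulrCA].
apply: (@nakayama y J Q) => //; first exact: span_y.
  move=> z [Dz [k [f [Df e1]]]].
  have [[u [i [d [uu _ Dd zE]]]]|[g [d [Dg Dd zE]]]] := @rlr_expand_y 1 z Dz.
    exfalso; have [Du u0 Dv] := uu.
    apply: (@pow_y_notin_x (i + k)%N (u^-1 * (f - d * y ^+ k))); first by inring sD.
    have : u * y ^+ (i + k) = x * (f - d * y ^+ k).
      by rewrite mulrBr -e1 zE exprD; ring.
    by move=> e2; rewrite mulrCA -e2 mulKf.
  exists (x * d), g; split; [by exists d| |by rewrite zE addrC].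
  split=> //; exists k.+1, (f - d * y ^+ k); split; first by inring sD.
  by rewrite mulrBr -e1 zE !exprS; ring.
by split=> //; exists 1%N, e; split.
Qed.

Lemma rlr_y_neq0 : y != 0.
Proof.
by apply/eqP => y0; apply: (@pow_y_notin_x 1 0); [inring sD|rewrite mulr0 expr1].
Qed.

Lemma regular_pow_y w q e : D w -> D e -> w * y ^+ q = x * e ->
  exists2 d, D d & w = x * d.
Proof.
move=> Dw; elim: q e => [|q IH] e De we; first by exists e; rewrite // -we mulr1.
have [|||d Dd wE] := @regular_seq (w * y ^+ q) e; [by inring sD|by []| |].
  by rewrite -mulrA -exprSr.
exact: IH wE.
Qed.

End RegularLocal.

Section Krull.
Variables (K : fieldType) (D : set K) (x y : K).
Hypothesis hD : regular_local_with_parameters D [:: x; y].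
Let sD := rlr_subring hD.
Let Dx := rlr_x hD.
Let Dy := rlr_y hD.

Lemma rlr_x_neq0 : x != 0. Proof. exact: rlr_y_neq0 (rlr_swap hD). Qed.
Let x0 := rlr_x_neq0.

(** Krull's intersection theorem for the powers of x modulo y^j. *)
Lemma krull_xy j d : D d ->
  (forall k, exists a b, [/\ D a, D b & d = x ^+ k * a + y ^+ j * b]) ->
  exists2 b, D b & d = y ^+ j * b.
Proof.
move=> Dd hd.
pose J := [set z | exists2 b, D b & z = y ^+ j * b].
pose Q := [set z | D z /\ forall k, exists a b, [/\ D a, D b & z = x ^+ k * a + y ^+ j * b]].
apply: (@nakayama _ _ _ _ hD x J Q) => //; first exact: span_x.
- split=> [_ [b Db ->]||_ _ [b Db ->] [b' Db' ->]|e _ De [b Db ->]].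
  + by inring sD.
  + by exists 0; rewrite ?mulr0//; inring sD.
  + by exists (b + b'); rewrite ?mulrDr//; inring sD.
  + by exists (e * b); rewrite 1?mulrCA//; inring sD.
- split=> [z []//|||].
  + split=> [|k]; first by inring sD.
    by exists 0, 0; split; rewrite ?mulr0 ?addr0//; inring sD.
  + move=> z z' [Dz hz] [Dz' hz']; split=> [|k]; first by inring sD.
    have [a [b [Da Db ->]]] := hz k; have [a' [b' [Da' Db' ->]]] := hz' k.
    by exists (a + a'), (b + b'); split; [inring sD|inring sD|ring].
  + move=> e z De [Dz hz]; split=> [|k]; first by inring sD.
    have [a [b [Da Db ->]]] := hz k.
    by exists (e * a), (e * b); split; [inring sD|inring sD|ring].
move=> q [Dq hq]; have [a [b [Da Db qE]]] := hq 1%N.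
exists (y ^+ j * b), a; split; [by exists b| |by rewrite qE addrC].
split=> // k; have [a' [b' [Da' Db' qE']]] := hq k.+1.
have [|||c Dc cE] := @regular_pow_y _ _ _ _ hD (b' - b) j (a - x ^+ k * a').
- by inring sD.
- by inring sD.
- rewrite mulrBr mulrA -exprS mulrC mulrBr.
  apply/eqP; rewrite subr_eq addrAC eq_sym subr_eq; apply/eqP.
  by rewrite -[X in X * a]expr1 -qE qE' addrC.
exists a', c; split=> //; apply: (mulfI x0).
rewrite mulrDr mulrA -exprS mulrCA -cE mulrBr addrA -qE' qE expr1.
by rewrite addrK.
Qed.

End Krull.

(** * Monomials and expansions *)

Definition le_exp (t t' : nat * nat) : bool := (t.1 <= t'.1)%N && (t.2 <= t'.2)%N.

Definition add_exp (t t' : nat * nat) : nat * nat := (t.1 + t'.1, t.2 + t'.2)%N.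

(** The ideal generated by the monomials with exponents in S, generated term by
term so that its properties follow by induction. *)
Inductive mono_ideal (K : fieldType) (D : set K) (x y : K)
    (S : nat * nat -> Prop) : K -> Prop :=
| mono_ideal0 : mono_ideal D x y S 0
| mono_ideal_cons t c f : S t -> D c -> mono_ideal D x y S f ->
    mono_ideal D x y S (c * monomial x y t + f).

Section Monomials.
Variables (K : fieldType) (D : set K) (x y : K).
Hypothesis hD : regular_local_with_parameters D [:: x; y].
Let sD := rlr_subring hD.
Let Dx := rlr_x hD.
Let Dy := rlr_y hD.
Let x0 : x != 0 := rlr_y_neq0 (rlr_swap hD).
Let y0 : y != 0 := rlr_y_neq0 hD.
Let mon := monomial x y.
Let mid := mono_ideal D x y.

Lemma monomial_in t : D (mon t). Proof. by rewrite /mon /monomial; inring sD. Qed.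
Lemma monomial_neq0 t : mon t != 0.
Proof. by rewrite mulf_neq0// expf_neq0. Qed.
Lemma monomialM t t' : mon (add_exp t t') = mon t * mon t'.
Proof. by rewrite /mon /monomial /= !exprD mulrACA. Qed.

Lemma mono_idealS S S' f : (forall t, S t -> S' t) -> mid S f -> mid S' f.
Proof.
move=> SS; elim=> [|t c g St Dc _ IH]; first exact: mono_ideal0.
by apply: mono_ideal_cons => //; exact: SS.
Qed.
Lemma mono_ideal1 (S : nat * nat -> Prop) c t : D c -> S t -> mid S (c * mon t).
Proof. by move=> Dc St; rewrite -[_ * _]addr0; apply: mono_ideal_cons => //; exact: mono_ideal0. Qed.
Lemma mono_idealD S f g : mid S f -> mid S g -> mid S (f + g).
Proof.
move=> Sf Sg; elim: Sf => [|t c h St Dc _ IH]; first by rewrite add0r.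
by rewrite -addrA; exact: mono_ideal_cons.
Qed.
Lemma mono_idealZ S c f : D c -> mid S f -> mid S (c * f).
Proof.
move=> Dc; elim=> [|t e h St De _ IH]; first by rewrite mulr0; exact: mono_ideal0.
by rewrite mulrDr mulrA; apply: mono_ideal_cons => //; inring sD.
Qed.
Lemma mono_idealN S f : mid S f -> mid S (- f).
Proof. by rewrite -mulN1r; apply: mono_idealZ; inring sD. Qed.
Lemma mono_ideal_in S f : mid S f -> D f.
Proof.
elim=> [|t c g _ Dc _ IH]; first by inring sD.
by have Dt := monomial_in t; inring sD.
Qed.
Lemma mono_ideal_sum (S : nat * nat -> Prop) (s : seq (nat * nat)) (c : nat * nat -> K) (P : pred (nat * nat)) :
  (forall t, t \in s -> P t -> D (c t) /\ S t) ->
  mid S (\sum_(t <- s | P t) c t * mon t).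
Proof.
elim: s => [|t s IH] h; first by rewrite big_nil; exact: mono_ideal0.
have IHs : mid S (\sum_(t <- s | P t) c t * mon t).
  by apply: IH => t' t's; apply: h; rewrite inE t's orbT.
rewrite big_cons; case: ifP => // Pt.
by have [||Dc St] := h t => //; [rewrite mem_head|exact: mono_ideal_cons].
Qed.
Lemma mono_idealM (S S' S'' : nat * nat -> Prop) f g :
  (forall t t', S t -> S' t' -> S'' (add_exp t t')) ->
  mid S f -> mid S' g -> mid S'' (f * g).
Proof.
move=> SS + Sg; elim=> [|t c h St Dc _ IH]; first by rewrite mul0r; exact: mono_ideal0.
rewrite mulrDl; apply: mono_idealD => //.
elim: Sg => [|t' c' h' St' Dc' _ IH']; first by rewrite mulr0; exact: mono_ideal0.
rewrite mulrDr mulrACA -[mon _ * mon _]monomialM; apply: mono_ideal_cons => //; first exact: SS.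
by inring sD.
Qed.

Lemma regular_pow w p q e : D w -> D e -> w * y ^+ q = x ^+ p * e ->
  exists2 d, D d & w = x ^+ p * d.
Proof.
move=> + De; elim: p w => [|p IH] w Dw we.
  by exists w; rewrite // mul1r.
have [|||d Dd wE] := @regular_pow_y _ _ _ _ hD w q (x ^+ p * e) => //; first by inring sD.
  by rewrite we exprS mulrA.
have [|d' Dd' dE] := IH d Dd.
  by apply: (mulfI x0); rewrite mulrA -wE we exprS mulrA.
by exists d' => //; rewrite wE dE exprS mulrA.
Qed.

(** The ideal generated by the monomials that do not divide x^p y^q lies in the
ideal generated by x^(p+1) and y^(q+1), modulo which the annihilator of x^p y^q
is the maximal ideal, because x, y is a regular sequence. *)
Lemma mono_ideal_key t0 c :
  mid (fun t => ~~ le_exp t t0) (c * mon t0) -> ~ unit_of D c.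
Proof.
move=> h uc; have [Dc _ _] := uc.
have [a [b [Da Db e]]] : exists a b, [/\ D a, D b &
    c * mon t0 = x ^+ t0.1.+1 * a + y ^+ t0.2.+1 * b].
  elim: h => [|t e g]; first by exists 0, 0; split; rewrite ?mulr0 ?addr0//; inring sD.
  rewrite /le_exp negb_and -!ltnNge => lt De _ [a [b [Da Db ->]]].
  case/orP: lt => lt.
    exists (a + e * x ^+ (t.1 - t0.1.+1) * y ^+ t.2), b; split=> //; first by inring sD.
    have -> : monomial x y t = x ^+ t0.1.+1 * x ^+ (t.1 - t0.1.+1) * y ^+ t.2.
      by rewrite -exprD subnKC.
    by move: (x ^+ (_ - _)) (x ^+ _.+1) => X X'; ring.
  exists a, (b + e * y ^+ (t.2 - t0.2.+1) * x ^+ t.1); split=> //; first by inring sD.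
  have -> : monomial x y t = x ^+ t.1 * (y ^+ t0.2.+1 * y ^+ (t.2 - t0.2.+1)).
    by rewrite -exprD subnKC.
  by move: (y ^+ (_ - _)) (y ^+ _.+1) => Y Y'; ring.
have [||d Dd e1] := @regular_pow (c * x ^+ t0.1 - y * b) t0.1.+1 t0.2 a _ Da; first by inring sD.
  rewrite (_ : _ * _ = c * mon t0 - y ^+ t0.2.+1 * b); first by rewrite e addrK.
  by rewrite /mon /monomial exprS; ring.
have [|||d' Dd' e2] := @regular_pow_y _ _ _ _ (rlr_swap hD) (c - x * d) t0.1 b; [by inring sD|by []| |].
  have -> : (c - x * d) * x ^+ t0.1 = c * x ^+ t0.1 - x ^+ t0.1.+1 * d by rewrite exprSr; ring.
  by rewrite -e1; ring.
apply: (unit_notin_span hD uc); apply/span2P; exists d, d'; split=> //.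
by rewrite -(subrK (x * d) c) e2; ring.
Qed.

Lemma divides_le_exp t t' : divides_in D (mon t) (mon t') <-> le_exp t t'.
Proof.
split=> [[e De e1]|/andP[le1 le2]].
  apply: contrapT => /negP nle; apply: (@mono_ideal_key t' 1); last exact: unit_of1.
  by rewrite mul1r e1; apply: mono_ideal1.
exists (mon (t'.1 - t.1, t'.2 - t.2)%N); first exact: monomial_in.
by rewrite -monomialM /add_exp/= !subnK// -surjective_pairing.
Qed.

(** An expansion as in the definition of the monomial valuations, with
divisibility of monomials expressed by their exponents. *)
Definition expansion (s : seq (nat * nat)) (u : nat * nat -> K) : Prop :=
  [/\ uniq s,
      forall t t', t \in s -> t' \in s -> t != t' -> ~~ le_exp t t'
    & forall t, t \in s -> unit_of D (u t)].

Lemma expansionP s f : monomial_rep D x y f s <->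
  exists2 u, expansion s u & f = \sum_(t <- s) u t * mon t.
Proof.
split=> [[us anti [u uu fE]]|[u [us anti uu] fE]].
  exists u => //; split=> // t t' ts t's /(anti _ _ ts t's) nd.
  by apply/negP => /divides_le_exp.
split=> //; last by exists u.
by move=> t t' ts t's /(anti _ _ ts t's) /negP nd /divides_le_exp.
Qed.

(** The monomials x^(k+1) t, with the exponent of y in t smaller than i, form an
antichain together with x^k y^i. *)
Lemma expansion_extend s u i k v c : expansion s u ->
  (forall t, t \in s -> (t.2 < i)%N) -> unit_of D v -> D c ->
  exists s' u', [/\ expansion s' u', s' != [::], forall t, t \in s' -> (t.2 <= i)%N &
    x ^+ k * (v * y ^+ i + x * (\sum_(t <- s) u t * mon t + y ^+ i * c)) =
    \sum_(t <- s') u' t * mon t].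
Proof.
move=> [us anti uu] si uv Dc; have [Dv v0 Dvi] := uv.
pose shift (t : nat * nat) := (t.1 + k.+1, t.2)%N.
have shiftI : injective shift by move=> [a b] [a' b'] [/addIn -> ->].
have notin : (k, i) \notin map shift s.
  by apply/negP => /mapP[t /si lt [_ ti]]; rewrite ti ltnn in lt.
exists ((k, i) :: map shift s),
  (fun t => if t == (k, i) then v + x * c else u (t.1 - k.+1, t.2)%N); split=> //.
- split.
  + by rewrite /= notin map_inj_uniq.
  + move=> t t'; rewrite !inE => /orP[/eqP->|/mapP[t1 t1s ->]] /orP[/eqP->|/mapP[t2 t2s ->]].
    * by rewrite eqxx.
    * by move=> _; rewrite /le_exp/= negb_and -!ltnNge si// orbT.
    * by move=> _; rewrite /le_exp/= negb_and -!ltnNge addnS ltnS leq_addl.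
    * rewrite (inj_eq shiftI) => /(anti _ _ t1s t2s).
      by rewrite /le_exp/= leq_add2r.
  + move=> t; rewrite inE; case: eqP => [_ _|/eqP nt /= /mapP[t1 t1s ->]].
      rewrite (_ : v + x * c = v * (1 - x * (- c * v^-1))).
        apply: unit_ofM => //; apply: (unit_sub1 hD); first exact: span_x.
        by inring sD.
      by field.
    by rewrite /shift/= addnK -surjective_pairing; exact: uu.
- by move=> t; rewrite inE => /orP[/eqP->//|/mapP[t1 /si lt ->]]; exact: ltnW.
rewrite big_cons eqxx big_map.
rewrite [in RHS](eq_big_seq (fun t => x ^+ k.+1 * (u t * mon t))); last first.
  move=> t ts; rewrite ifF; last first.
    by apply: contraNF notin => /eqP <-; exact: map_f.
  by rewrite /shift/= addnK -surjective_pairing /mon /monomial/= exprD; ring.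
by rewrite -mulr_sumr /mon /monomial/= exprS; ring.
Qed.

Lemma krull_x d : D d -> d != 0 -> exists k e, [/\ D e, d = x ^+ k * e &
  ~ exists2 b, D b & e = x * b].
Proof.
move=> Dd d0; apply: contrapT => nk.
pose Q := [set z | D z /\ forall k, exists2 a, D a & z = x ^+ k * a].
have Qd : Q d.
  split=> //; elim=> [|k [a Da dE]]; first by exists d; rewrite ?mul1r.
  have [[b Db aE]|na] := pselect (exists2 b, D b & a = x * b).
    by exists b => //; rewrite dE aE exprSr mulrA.
  by case: nk; exists k, a.
suff /(_ _ Qd)/= e : Q `<=` [set 0] by rewrite e eqxx in d0.
apply: (@nakayama _ _ _ _ hD x) => //; first exact: span_x.
- split=> [_ ->||_ _ -> ->|e _ De ->] //=; rewrite ?addr0 ?mulr0//; inring sD.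
- split=> [z []//|||].
  + by split=> [|k]; [inring sD|exists 0; rewrite ?mulr0//; inring sD].
  + move=> z z' [Dz hz] [Dz' hz']; split=> [|k]; first by inring sD.
    have [a Da ->] := hz k; have [a' Da' ->] := hz' k.
    by exists (a + a'); rewrite ?mulrDr//; inring sD.
  + move=> e z De [Dz hz]; split=> [|k]; first by inring sD.
    by have [a Da ->] := hz k; exists (e * a); rewrite 1?mulrCA//; inring sD.
move=> q [Dq hq]; have [a Da qE] := hq 1%N.
exists 0, a; split; [by []| |by rewrite add0r qE expr1].
split=> // k; have [b Db qE'] := hq k.+1; exists b => //.
by apply: (mulfI x0); rewrite mulrA -exprS -qE' qE expr1.
Qed.

(** Expansion modulo y^j, by induction on j: if x^k is the highest power of x
that divides d modulo y^j, then d = x^k (u y^i + x d') modulo y^j with u a unit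
and i < j, and d' has to be expanded only modulo y^i. *)
Lemma expansion_mod j d : D d -> exists s u e,
  [/\ expansion s u, forall t, t \in s -> (t.2 < j)%N, D e
    & d = \sum_(t <- s) u t * mon t + y ^+ j * e].
Proof.
elim/ltn_ind: j d => j IH d Dd.
have [[b Db dE]|nb] := pselect (exists2 b, D b & d = y ^+ j * b).
  by exists [::], (fun=> 0), b; split=> //; rewrite big_nil add0r.
have [k [d1 [e [Dd1 De dE nd1]]]] : exists k d1 e, [/\ D d1, D e, d = x ^+ k * d1 + y ^+ j * e
    & ~ exists a b, [/\ D a, D b & d1 = x * a + y ^+ j * b]].
  apply: contrapT => nk; apply: nb; apply: (krull_xy hD) => //.
  elim=> [|k [a [b [Da Db dE]]]].
    by exists d, 0; split; rewrite ?mul1r ?mulr0 ?addr0//; inring sD.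
  have [[a' [b' [Da' Db' aE]]]|na] := pselect (exists a' b', [/\ D a', D b' & a = x * a' + y ^+ j * b']).
    exists a', (b + x ^+ k * b'); split=> //; first by inring sD.
    by rewrite dE aE exprSr; ring.
  by case: nk; exists k, a, b.
have [[v [i [d2 [uv ij Dd2 d1E]]]]|[a [b [Da Db d1E]]]] := rlr_expand_y hD j Dd1; last first.
  by case: nd1; exists b, a; split=> //; rewrite d1E addrC.
have [s [u [c [esu si Dc d2E]]]] := IH _ ij _ Dd2.
have [s' [u' [es' _ s'i e']]] := expansion_extend k esu si uv Dc.
exists s', u', e; split=> //; first by move=> t /s'i le; exact: leq_ltn_trans ij.
by rewrite dE d1E d2E e'.
Qed.

Lemma expansion_exists f : D f -> f != 0 -> exists s u,
  [/\ expansion s u, s != [::] & f = \sum_(t <- s) u t * mon t].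
Proof.
move=> Df f0; have [k [f1 [Df1 fE nf1]]] := krull_x Df f0.
have [v [i [d [uv Dd f1E]]]] : exists v i d, [/\ unit_of D v, D d & f1 = v * y ^+ i + x * d].
  apply: contrapT => nv; apply: nf1.
  have [|b Db f1E] := @krull_xy _ _ _ _ (rlr_swap hD) 1 f1 Df1; last by exists b; rewrite // -[x]expr1.
  move=> n; have [[v [i [d [uv _ Dd f1E]]]]|[a [b [Da Db f1E]]]] := rlr_expand_y hD n Df1.
    by case: nv; exists v, i, d.
  by exists a, b; split=> //; rewrite expr1.
have [s [u [c [esu si Dc dE]]]] := expansion_mod i Dd.
have [s' [u' [es' s'0 _ e']]] := expansion_extend k esu si uv Dc.
by exists s', u'; split=> //; rewrite fE f1E dE.
Qed.

End Monomials.

(** * The monomial valuations *)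

Definition weight (R : realType) (r : R) (t : nat * nat) : R := t.1%:R + t.2%:R * r.

Lemma weightD (R : realType) (r : R) t t' :
  weight r (add_exp t t') = weight r t + weight r t'.
Proof. by rewrite /weight /= !natrD; ring. Qed.

Lemma weight_ge0 (R : realType) (r : R) t : 0 < r -> 0 <= weight r t.
Proof. by move=> r0; rewrite /weight addr_ge0// mulr_ge0// ltW. Qed.

Lemma le_exp_weight (R : realType) (r : R) t t' : 0 < r -> le_exp t t' ->
  weight r t <= weight r t'.
Proof.
by move=> r0 /andP[l1 l2]; rewrite lerD ?ler_nat// ler_pM2r// ler_nat.
Qed.

Lemma seq_argmin (T : eqType) (d : Order.disp_t) (A : orderType d) (F : T -> A) (s : seq T) :
  s != [::] -> exists2 i, i \in s & forall j, j \in s -> (F i <= F j)%O.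
Proof.
elim: s => [|a s IH] // _; have [->|/IH[i is_ mi]] := eqVneq s [::].
  by exists a; [rewrite mem_head|move=> j; rewrite inE => /eqP ->].
case: (leP (F a) (F i)) => ai.
  exists a; first by rewrite mem_head.
  by move=> j; rewrite inE => /orP[/eqP ->//|/mi]; exact: le_trans.
exists i; first by rewrite inE is_ orbT.
by move=> j; rewrite inE => /orP[/eqP ->|/mi//]; exact: ltW.
Qed.

Lemma bigmine_eq (R : realType) (T : eqType) (F : T -> \bar R) (s : seq T) i :
  i \in s -> (forall j, j \in s -> (F i <= F j)%E) ->
  \big[mine/+oo%E]_(j <- s) F j = F i.
Proof.
move=> is_ mi; apply/le_anti/andP; split.
  elim: s is_ {mi} => // a s IH; rewrite inE big_cons => /orP[/eqP ->|/IH le].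
    by rewrite ge_min lexx.
  by rewrite ge_min le orbT.
elim: s mi {is_} => [|a s IH] mi; first by rewrite big_nil leey.
rewrite big_cons le_min mi ?mem_head// IH// => j js.
by apply: mi; rewrite inE js orbT.
Qed.

Section RingValuation.
Variables (R : realType) (K : fieldType) (D : set K) (x y : K).
Hypothesis hD : regular_local_with_parameters D [:: x; y].
Let sD := rlr_subring hD.
Let mon := monomial x y.
Let mid := mono_ideal D x y.

Definition weight_ge (r g : R) := mid (fun t => g <= weight r t).
Definition weight_gt (r g : R) := mid (fun t => g < weight r t).

(** This describes v_r(f) = g without a choice of an expansion. *)
Definition has_value (r : R) (f : K) (g : R) := weight_ge r g f /\ ~ weight_gt r g f.

(** A monomial of larger weight than t0 does not divide t0, so mono_ideal_key
applies. *)
Lemma leading_not_gt r t0 c f : 0 < r -> unit_of D c ->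
  mid (fun t => ~~ le_exp t t0) f -> ~ weight_gt r (weight r t0) (c * mon t0 + f).
Proof.
move=> r0 uc mf h; apply: (mono_ideal_key hD (t0 := t0) (c := c)) => //.
rewrite -(addrK f (c * _)); apply: (mono_idealD); last exact: mono_idealN.
apply: mono_idealS h => t; apply: contraTN => /(le_exp_weight r0).
by rewrite -leNgt.
Qed.

Lemma has_value_inj r f g g' : has_value r f g -> has_value r f g' -> g = g'.
Proof.
move=> [h1 n1] [h2 n2]; apply/eqP; rewrite eq_le; apply/andP; split; rewrite leNgt; apply/negP => lt.
  by apply: n2; apply: mono_idealS h1 => t; exact: lt_le_trans.
by apply: n1; apply: mono_idealS h2 => t; exact: lt_le_trans.
Qed.

Lemma has_value_leading r t0 c f : 0 < r -> unit_of D c ->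
  mid (fun t => weight r t0 <= weight r t /\ ~~ le_exp t t0) f ->
  has_value r (c * mon t0 + f) (weight r t0).
Proof.
move=> r0 uc mf; split.
  apply: mono_idealD; first by apply: mono_ideal1 => //; case: uc.
  by apply: mono_idealS mf => t [].
by apply: leading_not_gt => //; apply: mono_idealS mf => t [].
Qed.

Lemma has_value_expansion r s u t0 : 0 < r -> expansion D s u -> t0 \in s ->
  (forall t, t \in s -> weight r t0 <= weight r t) ->
  has_value r (\sum_(t <- s) u t * mon t) (weight r t0).
Proof.
move=> r0 [us anti uu] t0s mt; rewrite (bigD1_seq t0)//=.
apply: has_value_leading => //; first exact: uu.
apply: mono_ideal_sum => t ts tt0; split; first by case: (uu _ ts).
by split; [exact: mt|exact: anti].
Qed.

(** The monomials t after t0 in the order by weight and, for equal weight, by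
decreasing (strictly if b is true) exponent of x. *)
Definition after (r : R) (b : bool) (t0 t : nat * nat) : Prop :=
  weight r t0 <= weight r t /\ (weight r t <= weight r t0 -> (t.1 + b <= t0.1)%N).

Lemma after_add r t0 t0' t t' : after r true t0 t -> after r false t0' t' ->
  after r true (add_exp t0 t0') (add_exp t t').
Proof.
move=> [w1 l1] [w2 l2]; split; rewrite !weightD; first exact: lerD.
move=> le; have /l1 ? : weight r t <= weight r t0 by lra.
have /l2 ? : weight r t' <= weight r t0' by lra.
rewrite /=; lia.
Qed.

Lemma after_not_le r t0 t : 0 < r -> after r true t0 t ->
  weight r t0 <= weight r t /\ ~~ le_exp t t0.
Proof.
move=> r0 [w l]; split=> //; apply/negP => le.
have := l (le_exp_weight r0 le); rewrite addn1 => lt.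
move: w; rewrite leNgt => /negP; apply; move: le => /andP[_ le].
by rewrite /weight ltr_leD ?ltr_nat// ler_pM2r// ler_nat.
Qed.

(** The leading term for the order of after. In this order the sum of two leading
exponents comes strictly before all other sums of exponents. *)
Lemma has_value_top r f g : 0 < r -> D f -> has_value r f g -> exists t0 c f',
  [/\ weight r t0 = g, unit_of D c, f = c * mon t0 + f' & mid (after r true t0) f'].
Proof.
move=> r0 Df hf; have f0 : f != 0.
  by apply/eqP => f0; case: hf => _; apply; rewrite f0; exact: mono_ideal0.
have [s [u [esu s0 fE]]] := expansion_exists hD Df f0.
have [t1 t1s mt1] := seq_argmin (weight r) s0.
have gE : g = weight r t1.
  by apply: has_value_inj hf _; rewrite fE; exact: has_value_expansion.
pose s' := [seq t <- s | weight r t == g].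
have s'0 : s' != [::].
  by apply/eqP => e; have : t1 \in s'; [rewrite mem_filter gE eqxx|rewrite e].
have [t0] := seq_argmin (fun t => - (t.1%:R : R)) s'0.
rewrite mem_filter => /andP[/eqP t0g t0s] mt0.
have [us anti uu] := esu.
exists t0, (u t0), (\sum_(t <- s | t != t0) u t * mon t); split=> //; first exact: uu.
  by rewrite fE (bigD1_seq t0).
apply: mono_ideal_sum => t ts tt0; split; first by case: (uu _ ts).
split=> [|le]; first by rewrite t0g gE mt1.
have tg : weight r t = g by apply/eqP; rewrite eq_le -{1}t0g le gE mt1.
have /mt0 : t \in s' by rewrite mem_filter ts tg eqxx.
rewrite lerN2 ler_nat leq_eqVlt addn1 => /orP[/eqP e|//].
case/eqP: tt0; case: t t0 e t0g tg {ts le t0s mt0} => [a b] [a' b'] /= -> <- /eqP.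
rewrite /weight/= (inj_eq (addrI _)) => /eqP /(mulIf (lt0r_neq0 r0)) /eqP.
by rewrite eqr_nat => /eqP ->.
Qed.

Lemma has_valueM r f f' g g' : 0 < r -> D f -> D f' ->
  has_value r f g -> has_value r f' g' -> has_value r (f * f') (g + g').
Proof.
move=> r0 Df Df' hf hf'.
have [t0 [c [h [<- uc fE mh]]]] := has_value_top r0 Df hf.
have [t0' [c' [h' [<- uc' fE' mh']]]] := has_value_top r0 Df' hf'.
have [[Dc _ _] [Dc' _ _]] := (uc, uc').
have -> : f * f' = (c * c') * mon (add_exp t0 t0') + (h * (c' * mon t0') + h' * f).
  by rewrite {1}fE' mulrDr {1}fE /mon monomialM; ring.
rewrite -weightD; apply: has_value_leading => //; first exact: unit_ofM.
have weak t1 g1 : mid (after r true t1) g1 -> mid (after r false t1) g1.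
  apply: mono_idealS => t [w l]; split=> // /l; lia.
apply: mono_idealS (fun t => @after_not_le r _ t r0) _.
apply: mono_idealD.
  apply: (mono_idealM hD (S := after r true t0) (S' := after r false t0')) => //.
    by move=> t t'; exact: after_add.
  by apply: mono_ideal1 => //; split=> // _; rewrite addn0.
apply: (mono_idealM hD (S := after r true t0') (S' := after r false t0)) => //.
  have -> : add_exp t0 t0' = add_exp t0' t0 by rewrite /add_exp addnC [(t0.2 + _)%N]addnC.
  by move=> t t'; exact: after_add.
rewrite fE; apply: mono_idealD; last exact: weak.
by apply: mono_ideal1 => //; split=> // _; rewrite addn0.
Qed.

Lemma weight_ge_value r f g d : has_value r f g -> weight_ge r d f <-> d <= g.
Proof.
move=> [h n]; split=> [hd|le].
  rewrite leNgt; apply/negP => lt; apply: n; apply: mono_idealS hd => t.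
  exact: lt_le_trans.
by apply: mono_idealS h => t; exact: le_trans.
Qed.
Lemma weight_gt_value r f g d : has_value r f g -> weight_gt r d f <-> d < g.
Proof.
move=> hf; split=> [hd|lt]; last first.
  by apply: mono_idealS hf.1 => t; exact: lt_le_trans.
rewrite ltNge; apply/negP => le; apply: hf.2; apply: mono_idealS hd => t.
exact: le_lt_trans.
Qed.

Lemma monomial_val_ringE f : D f -> f != 0 -> exists s u,
  [/\ expansion D s u, s != [::], f = \sum_(t <- s) u t * mon t &
    forall r, 0 < r -> exists2 t0, t0 \in s &
     [/\ forall t, t \in s -> weight r t0 <= weight r t, has_value r f (weight r t0) &
     monomial_val_ring D x y r f = (weight r t0)%:E]].
Proof.
move=> Df f0; have [s1 [u1 [es1 s10 f1E]]] := expansion_exists hD Df f0.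
have /(expansionP hD)[u esu fE] : monomial_rep D x y f (monomials_of D x y f).
  by apply: xgetPex; exists s1; apply/(expansionP hD); exists u1.
exists (monomials_of D x y f), u.
have s0 : monomials_of D x y f != [::].
  by apply: contra_neq f0 => e; rewrite fE e big_nil.
split=> // r r0; have [t0 t0s mt0] := seq_argmin (weight r) s0; exists t0 => //.
split=> //; first by rewrite {1}fE; exact: has_value_expansion.
rewrite /monomial_val_ring (negbTE f0).
exact: (bigmine_eq (F := fun t => (weight r t)%:E)).
Qed.

End RingValuation.

Section Valuation.
Variables (R : realType) (K : fieldType) (D : set K) (x y : K).
Hypothesis hD : regular_local_with_parameters D [:: x; y].
Hypothesis hK : quotient_field_of D.
Let sD := rlr_subring hD.
Let mon := monomial x y.
Let v := @monomial_val R K D x y.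

(** The value as a real number. It is 0 instead of +oo at h = 0. *)
Definition mval (r : R) (h : K) : R := fine (monomial_val D x y r h).

(** The maximal ideal of V_r, see pos_max_ideal. *)
Definition pos (r : R) : set K := [set h | (0 < monomial_val D x y r h)%E].

Let nneg := @monomial_val_set R K D x y.

Lemma fractionP h : exists f g, [/\ D f, D g, g != 0 & h = f / g].
Proof. exact: hK. Qed.

Lemma has_value_exists (r : R) f : 0 < r -> D f -> f != 0 -> exists g, has_value D x y r f g.
Proof.
move=> r0 Df f0; have [s [u [_ _ _ /(_ _ r0)[t0 _ [_ hv _]]]]] := monomial_val_ringE R hD Df f0.
by exists (weight r t0).
Qed.

Lemma has_value_ring (r : R) f g : 0 < r -> D f -> f != 0 -> has_value D x y r f g ->
  monomial_val_ring D x y r f = g%:E.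
Proof.
move=> r0 Df f0 hf.
have [s [u [_ _ _ /(_ _ r0)[t0 _ [_ hv ->]]]]] := monomial_val_ringE R hD Df f0.
by rewrite (has_value_inj hf hv).
Qed.

Lemma has_value_frac (r : R) f g a b : 0 < r -> D f -> D g -> f != 0 -> g != 0 ->
  has_value D x y r f a -> has_value D x y r g b -> v r (f / g) = (a - b)%:E.
Proof.
move=> r0 Df Dg f0 g0 hf hg; rewrite /v /monomial_val; set fg := xget _ _.
have [Df' Dg' g'0 e] : [/\ D fg.1, D fg.2, fg.2 != 0 & f / g = fg.1 / fg.2].
  by apply: (@xgetPex _ (0, 1) [set fg | [/\ D fg.1, D fg.2, fg.2 != 0 & f / g = fg.1 / fg.2]]);
    exists (f, g).
have f'0 : fg.1 != 0.
  by apply: contra_neq f0 => e0; apply/eqP; rewrite -(divfK g0 f) e e0 mul0r mul0r.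
have [a' ha'] := has_value_exists r0 Df' f'0.
have [b' hb'] := has_value_exists r0 Dg' g'0.
rewrite !(has_value_ring r0 _ _ ha', has_value_ring r0 _ _ hb')// -EFinB; congr EFin.
have h1 := has_valueM hD r0 Df Dg' hf hb'.
have h2 := has_valueM hD r0 Df' Dg ha' hg.
have e' : f * fg.2 = fg.1 * g by rewrite -[f](divfK g0) e mulrAC divfK.
by rewrite e' in h1; have := has_value_inj h1 h2; lra.
Qed.

Lemma monomial_val0 r : 0 < r -> v r 0 = +oo%E.
Proof.
move=> r0; rewrite /v /monomial_val; set fg := xget _ _.
have [Df' Dg' g'0 e] : [/\ D fg.1, D fg.2, fg.2 != 0 & 0 = fg.1 / fg.2].
  apply: (@xgetPex _ (0, 1) [set fg | [/\ D fg.1, D fg.2, fg.2 != 0 & 0 = fg.1 / fg.2]]).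
  by exists (0, 1); split; rewrite ?mul0r ?oner_eq0//; inring sD.
have f0 : fg.1 = 0 by apply/eqP; move/eqP: e; rewrite eq_sym mulf_eq0 invr_eq0 (negbTE g'0) orbF.
have [b hb] := has_value_exists r0 Dg' g'0.
by rewrite f0 (has_value_ring r0 _ _ hb)// /monomial_val_ring eqxx.
Qed.

Section FixedWeight.
Variable r : R.
Hypothesis r0 : 0 < r.
Let w := mval r.

Lemma mval_frac f g a b : D f -> D g -> f != 0 -> g != 0 ->
  has_value D x y r f a -> has_value D x y r g b -> w (f / g) = a - b.
Proof.
move=> Df Dg f0 g0 ha hb; rewrite /w /mval.
by have := has_value_frac r0 Df Dg f0 g0 ha hb; rewrite /v => ->.
Qed.

Lemma has_value1 : has_value D x y r 1 0.
Proof.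
have := @has_value_leading _ _ _ _ _ hD r (0, 0)%N 1 0 r0 (unit_of1 sD) (mono_ideal0 _ _ _ _).
by rewrite /weight /monomial /= addr0 !mulr1 mul0r addr0.
Qed.

Lemma has_value_mval f : D f -> f != 0 -> has_value D x y r f (w f).
Proof.
move=> Df f0; have [a ha] := has_value_exists r0 Df f0.
rewrite (_ : w f = a)// -[f]divr1 (mval_frac _ _ _ _ ha has_value1) ?subr0 ?oner_eq0//.
exact: sub1.
Qed.

Lemma mval_fracE f g : D f -> D g -> f != 0 -> g != 0 -> w (f / g) = w f - w g.
Proof. by move=> Df Dg f0 g0; apply: mval_frac => //; exact: has_value_mval. Qed.

Lemma mval_fin h : h != 0 -> v r h = (w h)%:E.
Proof.
have [f [g [Df Dg g0 ->]]] := fractionP h.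
rewrite mulf_eq0 negb_or => /andP[f0 _]; rewrite mval_fracE//.
by apply: has_value_frac => //; exact: has_value_mval.
Qed.

Lemma nnegE h : h != 0 -> nneg r h <-> 0 <= w h.
Proof. by move=> h0; rewrite /nneg /monomial_val_set /= -/v (mval_fin h0) lee_fin. Qed.
Lemma posE h : h != 0 -> pos r h <-> 0 < w h.
Proof. by move=> h0; rewrite /pos /= -/v (mval_fin h0) lte_fin. Qed.
Lemma pos0 : pos r 0. Proof. by rewrite /pos /= -/v (monomial_val0 r0) ltry. Qed.
Lemma pos_nneg h : pos r h -> nneg r h.
Proof. by rewrite /pos /nneg /=; exact: ltW. Qed.
Lemma nneg0 : nneg r 0. Proof. exact: pos_nneg pos0. Qed.

Lemma mvalM h k : h != 0 -> k != 0 -> w (h * k) = w h + w k.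
Proof.
have [f [g [Df Dg g0 ->]]] := fractionP h; have [f' [g' [Df' Dg' g'0 ->]]] := fractionP k.
rewrite !mulf_eq0 !negb_or => /andP[f0 _] /andP[f'0 _].
have mulD a b : D a -> D b -> a != 0 -> b != 0 -> w (a * b) = w a + w b.
  move=> Da Db a0 b0.
  apply: has_value_inj (has_valueM hD r0 Da Db (has_value_mval Da a0) (has_value_mval Db b0)).
  by apply: has_value_mval; rewrite ?mulf_neq0//; inring sD.
rewrite mulf_div !mval_fracE ?mulf_neq0//; try by inring sD.
by rewrite !mulD//; ring.
Qed.
Lemma mval1 : w 1 = 0.
Proof. by have := @mvalM 1 1 (oner_neq0 _) (oner_neq0 _); rewrite mulr1; lra. Qed.
Lemma mvalV h : h != 0 -> w h^-1 = - w h.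
Proof.
move=> h0; have hi0 : h^-1 != 0 by rewrite invr_eq0.
by have := mvalM h0 hi0; rewrite mulfV// mval1; lra.
Qed.
Lemma mvalX h n : h != 0 -> w (h ^+ n) = n%:R * w h.
Proof.
move=> h0; elim: n => [|n IH]; first by rewrite expr0 mval1 mul0r.
by rewrite exprS mvalM ?expf_neq0// IH -natr1; ring.
Qed.
Lemma mval_monomial t : w (mon t) = weight r t.
Proof.
apply: has_value_inj (has_value_mval (monomial_in hD t) (monomial_neq0 hD t)) _.
have := @has_value_leading _ _ _ _ _ hD r t 1 0 r0 (unit_of1 sD) (mono_ideal0 _ _ _ _).
by rewrite mul1r addr0.
Qed.
Lemma mval_ge0 f : D f -> f != 0 -> 0 <= w f.
Proof.
move=> Df f0; have [h _] := has_value_mval Df f0.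
rewrite leNgt; apply/negP => lt.
have [_ []] := has_value_mval Df f0; apply: mono_idealS (_ : mono_ideal D x y (fun=> True) f).
  by move=> t _; apply: lt_le_trans lt _; exact: weight_ge0.
by apply: mono_idealS h.
Qed.
Lemma mval_unit u : unit_of D u -> w u = 0.
Proof.
move=> [Du u0 Dv]; apply/le_anti; rewrite mval_ge0//= andbT -oppr_ge0 -mvalV//.
by apply: mval_ge0; rewrite ?invr_eq0.
Qed.

Lemma weight_ge_mval d f : D f -> f != 0 -> weight_ge D x y r d f <-> d <= w f.
Proof. by move=> Df f0; apply: weight_ge_value; exact: has_value_mval. Qed.
Lemma weight_gt_mval d f : D f -> f != 0 -> weight_gt D x y r d f <-> d < w f.
Proof. by move=> Df f0; apply: weight_gt_value; exact: has_value_mval. Qed.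

Lemma mvalD_ge h k d : h != 0 -> k != 0 -> h + k != 0 ->
  d <= w h -> d <= w k -> d <= w (h + k).
Proof.
have [f [g [Df Dg g0 ->]]] := fractionP h; have [f' [g' [Df' Dg' g'0 ->]]] := fractionP k.
rewrite addf_div// !mulf_eq0 !negb_or => /andP[f0 _] /andP[f'0 _] /andP[s0 _].
rewrite !mval_fracE ?mulf_neq0//; try by inring sD.
rewrite (_ : w (g * g') = w g + w g') ?mvalM// => le1 le2.
suff : d + (w g + w g') <= w (f * g' + f' * g) by lra.
apply/weight_ge_mval => //; first by inring sD.
apply: mono_idealD.
  by apply/weight_ge_mval; rewrite ?mulf_neq0//; [by inring sD|rewrite mvalM//; lra].
by apply/weight_ge_mval; rewrite ?mulf_neq0//; [by inring sD|rewrite mvalM//; lra].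
Qed.

Lemma mvalN h : h != 0 -> w (- h) = w h.
Proof.
move=> h0; rewrite -mulN1r mvalM// ?oppr_eq0 ?oner_eq0// mval_unit ?add0r//.
by split; rewrite ?oppr_eq0 ?oner_eq0 ?invrN ?invr1//; inring sD.
Qed.

Lemma nneg_subring : subring (nneg r).
Proof.
apply/subringE; split.
- by apply/nnegE; rewrite ?oner_eq0 ?mval1.
- move=> c d; have [->|c0] := eqVneq c 0.
    rewrite add0r; have [->|d0] := eqVneq d 0; first by rewrite oppr0.
    by move=> _ /nnegE-/(_ d0) le; apply/nnegE; rewrite ?oppr_eq0// mvalN.
  have [->|d0] := eqVneq d 0; first by rewrite subr0.
  move=> /nnegE-/(_ c0) le1 /nnegE-/(_ d0) le2.
  have [->|cd0] := eqVneq (c - d) 0; first exact: nneg0.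
  by apply/nnegE => //; apply: mvalD_ge; rewrite ?oppr_eq0// mvalN.
- move=> c d; have [->|c0] := eqVneq c 0; first by rewrite mul0r.
  have [->|d0] := eqVneq d 0; first by rewrite mulr0.
  move=> /nnegE-/(_ c0) le1 /nnegE-/(_ d0) le2.
  by apply/nnegE; rewrite ?mulf_neq0// mvalM// addr_ge0.
Qed.

Lemma posM c d : nneg r c -> pos r d -> pos r (c * d).
Proof.
have [->|c0] := eqVneq c 0; first by rewrite mul0r => _ _; exact: pos0.
have [->|d0] := eqVneq d 0; first by rewrite mulr0.
move=> /nnegE-/(_ c0) le1 /posE-/(_ d0) lt2.
by apply/posE; rewrite ?mulf_neq0// mvalM//; lra.
Qed.
Lemma posN c : pos r c -> pos r (- c).
Proof. by rewrite -mulN1r; apply: posM; have sV := nneg_subring; inring sV. Qed.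
Lemma posD c d : pos r c -> pos r d -> pos r (c + d).
Proof.
have [->|c0] := eqVneq c 0; first by rewrite add0r.
have [->|d0] := eqVneq d 0; first by rewrite addr0.
have [->|cd0] := eqVneq (c + d) 0; first by move=> _ _; exact: pos0.
move=> /posE-/(_ c0) lt1 /posE-/(_ d0) lt2; apply/posE => //.
suff : Num.min (w c) (w d) <= w (c + d) by apply: lt_le_trans; rewrite lt_min lt1.
by apply: mvalD_ge; rewrite // ge_min lexx ?orbT.
Qed.
Lemma posB c d : pos r c -> pos r d -> pos r (c - d).
Proof. by move=> pc pd; apply: posD => //; exact: posN. Qed.

Lemma nneg_valuation_ring : is_valuation_ring (nneg r).
Proof.
split=> [|z z0]; first exact: nneg_subring.
have [le|lt] := leP 0 (w z); [left|right]; apply/nnegE; rewrite ?invr_eq0//.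
by rewrite mvalV//; lra.
Qed.

Definition mval_ring : valRing K := ValRing nneg_valuation_ring.

Lemma pos_max_ideal z : pos r z <-> max_ideal_of mval_ring z.
Proof.
have [->|z0] := eqVneq z 0.
  by split=> _; [apply/max_idealE; left|exact: pos0].
split=> [/posE-/(_ z0) lt|/max_idealE[/eqP|]]; last 2 first.
- by rewrite (negbTE z0).
- move=> n; apply/posE => //; rewrite ltNge; apply/negP => le; apply: n.
  by apply/nnegE; rewrite ?invr_eq0// mvalV//; lra.
apply/max_idealE; right => /nnegE; rewrite invr_eq0 => /(_ z0).
by rewrite mvalV//; lra.
Qed.

Lemma pos_inv z : ~ nneg r z -> pos r z^-1.
Proof. by move=> n; apply/pos_max_ideal; exact: max_ideal_inv. Qed.
Lemma pos_inv_not z : z != 0 -> pos r z -> ~ nneg r z^-1.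
Proof. by move=> z0 /pos_max_ideal /max_idealE[/eqP|//]; rewrite (negbTE z0). Qed.

Lemma sub_nneg : D `<=` nneg r.
Proof.
move=> f Df; have [->|f0] := eqVneq f 0; first exact: nneg0.
by apply/nnegE => //; exact: mval_ge0.
Qed.

Lemma nonunit_pos c : D c -> ~ unit_of D c -> pos r c.
Proof.
move=> Dc nc; have /span2P[e [f [De Df ->]]] := nonunit_in_span hD Dc nc.
have px : pos r x.
  apply/posE; first exact: rlr_x_neq0 hD.
  have := mval_monomial (1, 0)%N; rewrite /mon /monomial mulr1 expr1 => ->.
  by rewrite /weight mul0r addr0.
have py : pos r y.
  apply/posE; first exact: rlr_y_neq0 hD.
  have := mval_monomial (0, 1)%N; rewrite /mon /monomial mul1r expr1 => ->.
  by rewrite /weight mul1r add0r.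
by apply: posD; apply: posM => //; exact: sub_nneg.
Qed.
Lemma unit_not_pos c : unit_of D c -> ~ pos r c.
Proof.
by move=> uc /posE; have [_ c0 _] := uc => /(_ c0); rewrite mval_unit// ltxx.
Qed.

End FixedWeight.
End Valuation.

(** * Variation of the weight *)

Section Filters.
Variable R : realType.
Implicit Types (r : R) (F : set_system R).

Definition near_right r : set_system R :=
  [set A | exists2 d : R, 0 < d & forall s, r < s < r + d -> A s].
Definition near_left r : set_system R :=
  [set A | exists2 d : R, 0 < d & forall s, r - d < s < r -> A s].
Definition near_at r : set_system R :=
  [set A | exists2 d : R, 0 < d & forall s, r - d < s < r + d -> A s].

Lemma near_right_filter r : ProperFilter (near_right r).
Proof.
apply: Build_ProperFilter_ex => [A [d d0 Ad]|].
  by exists (r + d / 2); apply: Ad; lra.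
split; first by exists 1.
- move=> A B [d d0 Ad] [e e0 Be]; exists (Num.min d e); first by rewrite lt_min d0.
  have [le1 le2] : Num.min d e <= d /\ Num.min d e <= e by rewrite !ge_min !lexx orbT.
  by move=> s /andP[l1 l2]; split; [apply: Ad|apply: Be]; lra.
- by move=> A B AB [d d0 Ad]; exists d => // s /Ad /AB.
Qed.
Lemma near_left_filter r : ProperFilter (near_left r).
Proof.
apply: Build_ProperFilter_ex => [A [d d0 Ad]|].
  by exists (r - d / 2); apply: Ad; lra.
split; first by exists 1.
- move=> A B [d d0 Ad] [e e0 Be]; exists (Num.min d e); first by rewrite lt_min d0.
  have [le1 le2] : Num.min d e <= d /\ Num.min d e <= e by rewrite !ge_min !lexx orbT.
  by move=> s /andP[l1 l2]; split; [apply: Ad|apply: Be]; lra.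
- by move=> A B AB [d d0 Ad]; exists d => // s /Ad /AB.
Qed.
Lemma near_at_filter r : ProperFilter (near_at r).
Proof.
apply: Build_ProperFilter_ex => [A [d d0 Ad]|].
  by exists r; apply: Ad; lra.
split; first by exists 1.
- move=> A B [d d0 Ad] [e e0 Be]; exists (Num.min d e); first by rewrite lt_min d0.
  have [le1 le2] : Num.min d e <= d /\ Num.min d e <= e by rewrite !ge_min !lexx orbT.
  by move=> s /andP[l1 l2]; split; [apply: Ad|apply: Be]; lra.
- by move=> A B AB [d d0 Ad]; exists d => // s /Ad /AB.
Qed.

Lemma near_at_right r : near_at r `<=` near_right r.
Proof. by move=> A [d d0 Ad]; exists d => // s /andP[??]; apply: Ad; lra. Qed.
Lemma near_at_left r : near_at r `<=` near_left r.
Proof. by move=> A [d d0 Ad]; exists d => // s /andP[??]; apply: Ad; lra. Qed.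

Lemma near_at_gt0 r : 0 < r -> near_at r [set s | 0 < s].
Proof. by move=> r0; exists r => // s /andP[+ _]; rewrite subrr. Qed.

Lemma near_at_weight r t t' : weight r t < weight r t' ->
  near_at r [set s | weight s t < weight s t'].
Proof.
move=> lt; set e := weight r t' - weight r t.
have n0 : 0 < t.2%:R + t'.2%:R + 1 :> R by rewrite ltr_wpDl ?addr_ge0.
exists (e / (t.2%:R + t'.2%:R + 1)).
  by rewrite divr_gt0// /e subr_gt0.
move=> s; set d := e / _; have ed : e = d * (t.2%:R + t'.2%:R + 1) by rewrite /d divfK// gt_eqF.
have d0 : 0 < d by rewrite /d divr_gt0// /e subr_gt0.
move: ed; rewrite /e /weight.
move: (ler0n R t.2) (ler0n R t'.2) => p q ed /andP[l1 l2].
rewrite /=.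
have h1 : 0 <= t'.2%:R * (s - r + d) by apply: mulr_ge0 => //; lra.
have h2 : 0 <= t.2%:R * (d - (s - r)) by apply: mulr_ge0 => //; lra.
move: (t.2%:R : R) (t'.2%:R : R) (t.1%:R : R) (t'.1%:R : R) h1 h2 ed => a b c c' *.
nra.
Qed.

(** Filters on the weights along which the monomials are strictly ordered. *)
Definition decides_weights F : Prop := forall t t', t != t' ->
  F [set s | weight s t < weight s t'] \/ F [set s | weight s t' < weight s t].

Lemma near_right_decides r : decides_weights (near_right r).
Proof.
move=> t t' tt'.
have [lt|lt|e] := ltgtP (weight r t) (weight r t').
- by left; apply: near_at_right; exact: near_at_weight.
- by right; apply: near_at_right; exact: near_at_weight.
have main (p q : nat * nat) : weight r p = weight r q -> (p.2 < q.2)%N ->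
    near_right r [set s | weight s p < weight s q].
  rewrite /weight => epq lt; exists 1 => // s /andP[rs _]; rewrite /=.
  have lt' : p.2%:R < q.2%:R :> R by rewrite ltr_nat.
  have : 0 < (q.2%:R - p.2%:R) * (s - r) by rewrite mulr_gt0// subr_gt0.
  by move: epq; lra.
case: (ltngtP t.2 t'.2) => [lt|lt|e2]; [left|right|]; [exact: main|exact: main|].
case: t t' e e2 tt' => [p q] [p' q'] /= + e2; rewrite /weight/= e2 => /addIr /eqP.
by rewrite eqr_nat => /eqP ->; rewrite eqxx.
Qed.
Lemma near_left_decides r : decides_weights (near_left r).
Proof.
move=> t t' tt'.
have [lt|lt|e] := ltgtP (weight r t) (weight r t').
- by left; apply: near_at_left; exact: near_at_weight.
- by right; apply: near_at_left; exact: near_at_weight.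
have main (p q : nat * nat) : weight r p = weight r q -> (p.2 < q.2)%N ->
    near_left r [set s | weight s q < weight s p].
  rewrite /weight => epq lt; exists 1 => // s /andP[_ rs]; rewrite /=.
  have lt' : p.2%:R < q.2%:R :> R by rewrite ltr_nat.
  have : 0 < (q.2%:R - p.2%:R) * (r - s) by rewrite mulr_gt0// subr_gt0.
  by move: epq; lra.
case: (ltngtP t.2 t'.2) => [lt|lt|e2]; [right|left|]; [exact: main|exact: main|].
case: t t' e e2 tt' => [p q] [p' q'] /= + e2; rewrite /weight/= e2 => /addIr /eqP.
by rewrite eqr_nat => /eqP ->; rewrite eqxx.
Qed.
Lemma near_at_decides r : (forall q : rat, ratr q != r) -> decides_weights (near_at r).
Proof.
move=> irr t t' tt'.
have [lt|lt|e] := ltgtP (weight r t) (weight r t').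
- by left; exact: near_at_weight.
- by right; exact: near_at_weight.
have n2 : t'.2%:R - t.2%:R != 0 :> R.
  rewrite subr_eq0; apply: contra tt' => e2.
  case: t t' e e2 => [p q] [p' q'] /= + /eqP e2; rewrite /weight/= e2 => /addIr /eqP.
  by move: e2 => /eqP; rewrite !eqr_nat => /eqP -> /eqP ->.
have /eqP := irr ((t.1%:R - t'.1%:R) / (t'.2%:R - t.2%:R)); case.
rewrite fmorph_div/= !rmorphB/= !ratr_nat.
by apply: (mulIf n2); rewrite divfK//; move: e; rewrite /weight; lra.
Qed.

Lemma near_seq F (T : eqType) (s : seq T) (P : T -> R -> Prop) : Filter F ->
  (forall t, t \in s -> F (P t)) -> F [set r | forall t, t \in s -> P t r].
Proof.
move=> FF; elim: s => [|a s IH] h; first by apply: filterS filterT.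
apply: filterS2 (h a _) (IH _); last 2 first.
- by rewrite mem_head.
- by move=> t ts; apply: h; rewrite inE ts orbT.
by move=> r Pa Ps t; rewrite inE => /orP[/eqP ->//|/Ps].
Qed.

End Filters.

Section Variation.
Variables (R : realType) (K : fieldType) (D : set K) (x y : K).
Hypothesis hD : regular_local_with_parameters D [:: x; y].
Hypothesis hK : quotient_field_of D.
Let sD := rlr_subring hD.
Let x0 := rlr_x_neq0 hD.
Let mon := monomial x y.
Let w := @mval R K D x y.
Let ps := @pos R K D x y.

Lemma mval_expansion f : D f -> f != 0 -> exists s u,
  [/\ expansion D s u, s != [::], f = \sum_(t <- s) u t * mon t &
    forall r, 0 < r -> exists2 t0, t0 \in s & w r f = weight r t0 /\
     forall t, t \in s -> w r f <= weight r t].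
Proof.
move=> Df f0; have [s [u [esu s0 fE h]]] := monomial_val_ringE R hD Df f0.
exists s, u; split=> // r r0; have [t0 t0s [mt hv _]] := h _ r0; exists t0 => //.
by rewrite /w (has_value_inj (has_value_mval hD r0 Df f0) hv).
Qed.

(** The value of g is the least weight of its monomials, at all weights. *)
Lemma mval_dominating_monomial r g : 0 < r -> D g -> g != 0 -> exists t,
  w r g = weight r t /\ forall s, 0 < s -> w s g <= weight s t.
Proof.
move=> r0 Dg g0; have [l [u [_ _ _ h]]] := mval_expansion Dg g0.
have [t ts [e _]] := h _ r0; exists t; split=> // s s0.
by have [_ _ [_]] := h _ s0; apply.
Qed.

Lemma pos_near r h : 0 < r -> ps r h -> near_at r [set s | 0 < s -> ps s h].
Proof.
have F := near_at_filter r.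
move=> r0; have [->|h0] := eqVneq h 0.
  by move=> _; apply: filterS filterT => s _ s0; exact: (pos0 hD).
have [f [g [Df Dg g0 hE]]] := hK h.
have f0 : f != 0 by apply: contra_neq h0 => f0; rewrite hE f0 mul0r.
move=> /(posE hD hK r0 h0); rewrite hE (mval_fracE hD r0)// subr_gt0 => lt.
have [t [gt ht]] := mval_dominating_monomial r0 Dg g0.
have [l [u [_ _ _ hl]]] := mval_expansion Df f0.
apply: filterS (near_seq (s := l) (P := fun t' s => weight s t < weight s t') F _).
  move=> s lts s0; have [t' /lts lt' [e _]] := hl _ s0.
  apply/(posE hD hK s0); first by rewrite -hE.
  by rewrite (mval_fracE hD s0)// subr_gt0 -/w e (le_lt_trans (ht _ s0)).
move=> t' t'l; apply: near_at_weight; rewrite -gt.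
by have [_ _ [_ /(_ _ t'l)]] := hl _ r0; exact: lt_le_trans.
Qed.

Lemma scaled_pos (a b : R) h : 0 < a -> exists n, forall s, a <= s <= b -> ps s (x ^+ n * h).
Proof.
move=> a0; have [->|h0] := eqVneq h 0.
  exists 0%N => s /andP[as_ _]; rewrite mulr0.
  by apply: (pos0 hD); exact: lt_le_trans as_.
have [f [g [Df Dg g0 hE]]] := hK h.
have f0 : f != 0 by apply: contra_neq h0 => f0; rewrite hE f0 mul0r.
have [t [_ ht]] := mval_dominating_monomial a0 Dg g0.
pose B := t.1%:R + t.2%:R * `|b| : R.
have B0 : 0 <= B by rewrite addr_ge0// mulr_ge0.
exists (Num.bound B) => s /andP[as_ sb].
have s0 : 0 < s by exact: lt_le_trans as_.
apply/(posE hD hK s0); first by rewrite mulf_neq0// expf_neq0.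
rewrite (mvalM hD hK s0)// ?expf_neq0// (mvalX hD hK s0)//.
have -> : mval D x y s x = 1.
  by have := mval_monomial hD s0 (1, 0)%N; rewrite /monomial mulr1 expr1 => ->; rewrite /weight mul0r addr0.
rewrite mulr1 hE (mval_fracE hD s0)//.
have := mval_ge0 hD s0 Df f0; have := ht _ s0; have := archi_boundP B0.
have : weight s t <= B.
  rewrite /weight /B lerD2l; apply: ler_wpM2l => //.
  exact: le_trans sb (ler_norm b).
by rewrite -/w; lra.
Qed.

Lemma mval_leading F f : ProperFilter F -> decides_weights F -> F [set s | 0 < s] ->
  D f -> f != 0 -> exists t u, unit_of D u /\
  F [set s | w s f = weight s t /\ weight_gt D x y s (weight s t) (f - u * mon t)].
Proof.
move=> FF dF F0 Df f0.
have [l [u [[ul anti uu] l0 fE hl]]] := mval_expansion Df f0.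
have [t0 [t0l Ft0]] : exists t0, t0 \in l /\
    F [set s | forall t, t \in l -> t != t0 -> weight s t0 < weight s t].
  elim: l l0 {fE hl ul anti uu} => // a l IH _.
  have [->|/IH[t0 [t0l Ft0]]] := eqVneq l [::].
    exists a; rewrite mem_head; split=> //; apply: filterS filterT => s _ t.
    by rewrite inE => /eqP ->; rewrite eqxx.
  have [at0|at0] := eqVneq a t0.
    exists t0; rewrite inE t0l orbT; split=> //; apply: filterS Ft0 => s h t.
    by rewrite inE at0 => /orP[/eqP ->|/h//]; rewrite eqxx.
  have [Fa|Fa] := dF _ _ at0.
    exists a; rewrite mem_head; split=> //; apply: filterS2 Ft0 Fa => s h lt t.
    rewrite inE => /orP[/eqP ->|tl ta]; first by rewrite eqxx.
    have [->//|tt0] := eqVneq t t0; exact: lt_trans (h _ tl tt0).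
  exists t0; rewrite inE t0l orbT; split=> //; apply: filterS2 Ft0 Fa => s h lt t.
  by rewrite inE => /orP[/eqP ->//|/h].
exists t0, (u t0); split; first exact: uu.
apply: filterS2 Ft0 F0 => s h s0; split.
  have [t1 t1l [e mt]] := hl _ s0; rewrite e.
  have [->//|/h] := eqVneq t1 t0.
  by move=> /(_ t1l); rewrite -e ltNge mt.
rewrite fE (bigD1_seq t0)//= addrC addrK; apply: mono_ideal_sum => t tl tt0.
by split; [case: (uu _ tl)|exact: h].
Qed.

(** Along a filter that orders the monomials, an element of K behaves like a
unit of D times a quotient of two monomials. *)
Lemma mval_trichotomy F h : ProperFilter F -> decides_weights F -> F [set s | 0 < s] ->
  h != 0 ->
  [\/ F [set s | ps s h], F [set s | ps s h^-1]
    | exists2 u, unit_of D u & F [set s | ps s (h - u)]].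
Proof.
move=> FF dF F0 h0; have [f [g [Df Dg g0 hE]]] := hK h.
have f0 : f != 0 by apply: contra_neq h0 => f0; rewrite hE f0 mul0r.
have [t [u [uu Ff]]] := mval_leading FF dF F0 Df f0.
have [t' [u' [uu' Fg]]] := mval_leading FF dF F0 Dg g0.
have [tt'|tt'] := eqVneq t t'; last first.
  have [lt|lt] := dF _ _ tt'; [apply: Or32|apply: Or31].
    apply: filterS (filterI (filterI Ff Fg) (filterI lt F0)) => s [[[ef _] [eg _]] [l s0]].
    apply/(posE hD hK s0); first by rewrite invr_eq0.
    by rewrite (mvalV hD hK s0)// hE (mval_fracE hD s0)// -/w ef eg; move: l => /=; lra.
  apply: filterS (filterI (filterI Ff Fg) (filterI lt F0)) => s [[[ef _] [eg _]] [l s0]].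
  apply/(posE hD hK s0) => //.
  by rewrite hE (mval_fracE hD s0)// -/w ef eg; move: l => /=; lra.
apply: Or33; exists (u / u'); first by apply: unit_ofM => //; exact: unit_ofV.
have [[Du u0 _] [Du' u'0 Dv']] := (uu, uu').
apply: filterS (filterI (filterI Ff Fg) F0) => s [[[ef hf] [eg hg]] s0].
pose z := u' * (f - u * mon t) - u * (g - u' * mon t').
have zE : h - u / u' = z / (u' * g) by rewrite hE /z tt'; field; rewrite u'0 g0.
have Dm := monomial_in hD t; have Dm' := monomial_in hD t'.
have hz : weight_gt D x y s (weight s t) z.
  apply: (mono_idealD); first exact: mono_idealZ.
  by apply: mono_idealN => //; apply: mono_idealZ => //; rewrite tt'.
rewrite /= zE; have [->|z0] := eqVneq z 0; first by rewrite mul0r; exact: (pos0 hD).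
apply/(posE hD hK s0); first by rewrite !mulf_neq0 ?invr_eq0 ?mulf_neq0.
have Dz : D z by exact: mono_ideal_in hz.
move: hz => /(weight_gt_mval hD s0 _ Dz z0) hz.
rewrite (mval_fracE hD s0) ?mulf_neq0//; last by inring sD.
rewrite (mvalM hD hK s0)// (mval_unit hD hK s0 uu') add0r -/w eg -tt'.
by rewrite subr_gt0.
Qed.

End Variation.

(** * Valuation overrings of an interval ring *)

Lemma pos_ratP (R : realType) (q : rat) : 0 < ratr q :> R -> exists i j : nat,
  [/\ (0 < i)%N, (0 < j)%N, coprime i j & ratr q = i%:R / j%:R :> R].
Proof.
rewrite ltr0q => q0; exists `|numq q|%N, `|denq q|%N.
rewrite !absz_gt0 denq_neq0 coprime_num_den numq_eq0 (gt_eqF q0); split=> //.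
rewrite /ratr; congr (_ / _).
  by rewrite -[LHS]/((numq q)%:~R) -{1}(@gez0_abs (numq q)) ?numq_ge0 ?ltW.
by rewrite -{1}(@gez0_abs (denq q)) ?denq_ge0.
Qed.

Lemma rat_between (R : realType) (a b : R) : 0 <= a -> a < b -> exists i j : nat,
  [/\ (0 < i)%N, (0 < j)%N, coprime i j & a < i%:R / j%:R < b].
Proof.
move=> a0 /rat_in_itvoo[q]; rewrite in_itv/= => /andP[aq qb].
have [|i [j [i0 j0 cij qE]]] := @pos_ratP R q; first exact: le_lt_trans aq.
by exists i, j; split=> //; rewrite -qE aq.
Qed.

Section Overrings.
Variables (R : realType) (K : fieldType) (D : set K) (x y : K).
Hypothesis hD : regular_local_with_parameters D [:: x; y].
Hypothesis hK : quotient_field_of D.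
Let sD := rlr_subring hD.
Let Dx := rlr_x hD.
Let Dy := rlr_y hD.
Let x0 := rlr_x_neq0 hD.
Let y0 := rlr_y_neq0 hD.
Let mon := monomial x y.
Let mon0 := monomial_neq0 hD.
Let w := @mval R K D x y.
Let ps := @pos R K D x y.
Let nneg := @monomial_val_set R K D x y.

Section Below.
Variables (r : R) (V : valRing K).
Hypothesis r0 : 0 < r.
Hypothesis Vr : carrier V `<=` nneg r.

Lemma pos_max z : ps r z -> max_ideal_of V z.
Proof.
move=> pz; apply/max_idealE; have [->|z0] := eqVneq z 0; [by left|right].
by move=> /Vr; exact: pos_inv_not pz.
Qed.

Lemma pos_in z : ps r z -> carrier V z.
Proof. by move/pos_max => []. Qed.

End Below.

Lemma monomialX t n : mon (n * t.1, n * t.2)%N = mon t ^+ n.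
Proof. by rewrite /mon /monomial /= exprMn -!exprM ![(n * _)%N]mulnC. Qed.

(** Only one of the rings V_r lies above a given valuation ring: a monomial
x^i / y^j with i / j between r and s is in the maximal ideal of V_r and not in
V_s. *)
Lemma below_unique r s (V : valRing K) : 0 < r -> 0 < s ->
  carrier V `<=` nneg r -> carrier V `<=` nneg s -> r = s.
Proof.
wlog lt : r s / r < s.
  move=> h r0 s0 Vr Vs; case: (ltgtP r s) => // lt; first exact: h.
  by symmetry; exact: h.
move=> r0 s0 Vr Vs; have [i [j [i0 j0 _ /andP[l1 l2]]]] := rat_between (ltW r0) lt.
have j0' : 0 < j%:R :> R by rewrite ltr0n.
rewrite ltr_pdivlMr// in l1; rewrite ltr_pdivrMr// in l2.
have ne : mon (i, 0)%N / mon (0, j)%N != 0 by rewrite mulf_neq0 ?invr_eq0.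
have val q : 0 < q -> w q (mon (i, 0)%N / mon (0, j)%N) = i%:R - q * j%:R.
  move=> q0; rewrite /w (mval_fracE hD q0) ?(mval_monomial hD q0)//; try exact: monomial_in.
  by rewrite /weight /=; ring.
have /(pos_in r0 Vr)/Vs/(nnegE hD hK s0 ne) : ps r (mon (i, 0)%N / mon (0, j)%N).
  by apply/(posE hD hK r0 ne); rewrite -/w val// subr_gt0.
by rewrite -/w val// subr_ge0 leNgt l2.
Qed.

Section Interval.
Variables a b : R.
Hypotheses (a0 : 0 < a) (ab : a <= b).
Let T := interval_ring D x y [set r : R | a <= r <= b].

Lemma interval_ring_pos z : (forall s, a <= s <= b -> ps s z) -> T z.
Proof.
move=> h V /= [r rI [_ Vr]]; apply: (pos_in _ Vr); last exact: h.
by apply: lt_le_trans a0 _; case/andP: rI.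
Qed.

Lemma interval_ring_sub : D `<=` T.
Proof. by move=> z Dz V /= [r _ [DV _]]; exact: DV. Qed.

Lemma interval_ring_subring : subring T.
Proof.
apply/subringE; split.
- by move=> V _; exact: sub1 (carrierP V).1.
- by move=> c d Tc Td V hV; apply: (subB (carrierP V).1); [exact: Tc|exact: Td].
- by move=> c d Tc Td V hV; apply: (subM (carrierP V).1); [exact: Tc|exact: Td].
Qed.

Lemma interval_ring_closed : integrally_closed T.
Proof.
move=> z [p [pm pT rz]] V hV; apply: val_integrally_closed.
by exists p; split=> // i; exact: pT hV.
Qed.

Section Overring.
Variable V : valRing K.
Hypothesis TV : T `<=` carrier V.
Let sV := (carrierP V).1.

Lemma overring_x : carrier V x^-1 -> carrier V = setT.
Proof.
move=> Vx; apply/seteqP; split=> // z _.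
have [n hn] := scaled_pos hD hK b z a0.
rewrite -(mulKf (expf_neq0 n x0) z) -exprVn; apply: (subM sV); first by inring sV.
by apply: TV; apply: interval_ring_pos.
Qed.

Hypothesis nVx : ~ carrier V x^-1.


(** The supremum of this cut is the weight r such that V lies below V_r. *)
Let cut : set R := [set p | exists i j : nat,
  [/\ (0 < j)%N, p = i%:R / j%:R & carrier V (y ^+ j / x ^+ i)]].

Let rho := sup cut.

Let mval_quot s i j : 0 < s -> w s (x ^+ i / y ^+ j) = i%:R - j%:R * s.
Proof.
move=> s0; have := mval_monomial hD s0 (i, 0)%N; have := mval_monomial hD s0 (0, j)%N.
rewrite /monomial !mulr1 !mul1r /weight /= add0r mul0r addr0 => e1 e2.
by rewrite /w (mval_fracE hD s0) ?expf_neq0 ?e1 ?e2//; inring sD.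
Qed.

Let interval_gt0 s : a <= s <= b -> 0 < s.
Proof. by case/andP => + _; exact: lt_le_trans. Qed.

Lemma cut_bound : ubound cut b.
Proof.
move=> _ [i [j [j0 -> Vij]]]; rewrite leNgt; apply/negP.
rewrite ltr_pdivlMr ?ltr0n// => lt; apply: nVx.
pose e := i%:R - b * j%:R; have e0 : 0 < e by rewrite subr_gt0.
pose n := Num.bound e^-1; have hn : 1 < n%:R * e.
  by rewrite -ltr_pdivrMr// div1r; apply: archi_boundP; rewrite invr_ge0 ltW.
have z0 : (x ^+ i / y ^+ j) ^+ n != 0 by rewrite expf_neq0// mulf_neq0 ?invr_eq0 ?expf_neq0.
have -> : x^-1 = (x ^+ i / y ^+ j) ^+ n / x * (y ^+ j / x ^+ i) ^+ n.
  rewrite mulrAC -exprMn mulf_div [y ^+ j * _]mulrC mulfV ?expr1n ?mul1r//.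
  by rewrite mulf_neq0 ?expf_neq0.
apply: (subM sV); last exact: subX.
apply: TV; apply: interval_ring_pos => s sI; have s0 := interval_gt0 sI.
apply/(posE hD hK s0); first by rewrite mulf_neq0 ?invr_eq0.
rewrite (mvalM hD hK s0) ?invr_eq0// (mvalX hD hK s0) ?mulf_neq0 ?invr_eq0 ?expf_neq0//.
rewrite (mvalV hD hK s0)// -/w mval_quot//.
have := mval_quot 1 0 s0; rewrite expr1 expr0 divr1 mul0r subr0 => ->.
have : e <= i%:R - j%:R * s.
  rewrite /e lerD2l lerN2 mulrC ler_wpM2r//; by case/andP: sI.
move=> /(ler_wpM2l (ler0n R n)); lra.
Qed.

Lemma cut_below i j : (0 < j)%N -> i%:R / j%:R < a -> cut (i%:R / j%:R).
Proof.
move=> j0; rewrite ltr_pdivrMr ?ltr0n// => lt; exists i, j; split=> //.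
apply: TV; apply: interval_ring_pos => s sI; have s0 := interval_gt0 sI.
have z0 : x ^+ i / y ^+ j != 0 by rewrite mulf_neq0 ?invr_eq0 ?expf_neq0.
apply/(posE hD hK s0); first by rewrite mulf_neq0 ?invr_eq0 ?expf_neq0.
have -> : y ^+ j / x ^+ i = (x ^+ i / y ^+ j)^-1 by rewrite invf_div.
rewrite (mvalV hD hK s0)// -/w mval_quot// opprB subr_gt0.
apply: lt_le_trans lt _; rewrite mulrC ler_wpM2l//; by case/andP: sI.
Qed.

Lemma cut_neq0 : cut !=set0.
Proof.
by exists (0%:R / 1%:R); apply: cut_below => //; rewrite mul0r.
Qed.

Lemma cut_has_sup : has_sup cut.
Proof. by split; [exact: cut_neq0|exists b; exact: cut_bound]. Qed.

Lemma rho_interval : a <= rho <= b.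
Proof.
apply/andP; split; last by apply: ge_sup; [exact: cut_neq0|exact: cut_bound].
rewrite leNgt; apply/negP => lt.
have rho0 : 0 <= rho.
  have /(sup_upper_bound cut_has_sup) : cut (0%:R / 1%:R).
    by apply: cut_below => //; rewrite mul0r.
  by rewrite mul0r.
have [i [j [_ j0 _ /andP[l1 l2]]]] := rat_between rho0 lt.
have /(sup_upper_bound cut_has_sup) := cut_below j0 l2.
by rewrite leNgt -/rho l1.
Qed.
Let rho0 : 0 < rho := interval_gt0 rho_interval.

Lemma cut_down i j i' j' : (0 < j)%N -> (0 < j')%N -> carrier V (y ^+ j / x ^+ i) ->
  i'%:R / j'%:R < i%:R / j%:R :> R -> carrier V (y ^+ j' / x ^+ i').
Proof.
move=> j0 j'0 Vij; rewrite ltr_pdivrMr ?ltr0n// mulrAC ltr_pdivlMr ?ltr0n//.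
rewrite -!natrM ltr_nat => lt; apply: (@val_pow _ _ _ j.-1); rewrite prednK//.
rewrite (_ : _ ^+ _ = (y ^+ j / x ^+ i) ^+ j' * x ^+ (i * j' - i' * j)).
  by have Vx := TV (interval_ring_sub Dx); inring sV.
have -> : (y ^+ j / x ^+ i) ^+ j' = y ^+ (j' * j) / (x ^+ (i' * j) * x ^+ (i * j' - i' * j)).
  by rewrite -exprD (subnKC (ltnW lt)) expr_div_n mulnC !exprM.
rewrite expr_div_n !exprM.
have X0 := expf_neq0 (i * j' - i' * j) x0; have Z0 := expf_neq0 j (expf_neq0 i' x0).
by rewrite invfM mulrA divfK.
Qed.

Lemma rho_monomial t t' : weight rho t' < weight rho t -> carrier V (mon t / mon t').
Proof.
have Vx := TV (interval_ring_sub Dx); have Vy := TV (interval_ring_sub Dy).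
case: t t' => [p q] [p' q']; rewrite /weight /mon /monomial /= => lt.
have [pp|pp] := leqP p' p; have [qq|qq] := leqP q' q.
- have -> : x ^+ p * y ^+ q / (x ^+ p' * y ^+ q') = x ^+ (p - p') * y ^+ (q - q').
    rewrite -{1}(subnKC pp) -{1}(subnKC qq) !exprD.
    by field; rewrite !expf_neq0.
  by inring sV.
- have -> : x ^+ p * y ^+ q / (x ^+ p' * y ^+ q') = x ^+ (p - p') / y ^+ (q' - q).
    rewrite -{1}(subnKC pp) -{1}(subnKC (ltnW qq)) !exprD.
    by field; rewrite !expf_neq0.
  apply: contrapT => /max_ideal_inv[]; rewrite invf_div => Vq _.
  have /(sup_upper_bound cut_has_sup) : cut ((p - p')%:R / (q' - q)%:R).
    by exists (p - p')%N, (q' - q)%N; split=> //; rewrite subn_gt0.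
  rewrite ler_pdivrMr ?ltr0n ?subn_gt0// !natrB ?(ltnW qq)// -/rho; lra.
- have -> : x ^+ p * y ^+ q / (x ^+ p' * y ^+ q') = y ^+ (q - q') / x ^+ (p' - p).
    rewrite -{1}(subnKC qq) -{1}(subnKC (ltnW pp)) !exprD.
    by field; rewrite !expf_neq0.
  move: qq; rewrite leq_eqVlt => /orP[/eqP qq|qq].
    have : p'%:R < p%:R :> R by move: lt; rewrite qq; lra.
    by rewrite ltr_nat ltnNge (ltnW pp).
  have lt' : (p' - p)%:R / (q - q')%:R < rho.
    by rewrite ltr_pdivrMr ?ltr0n ?subn_gt0// !natrB ?(ltnW qq) ?(ltnW pp)//; lra.
  have [_ [i [j [j0 -> Vij]]] lt2] := sup_gt cut_neq0 lt'.
  by apply: cut_down Vij lt2; rewrite ?subn_gt0.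
- exfalso; have : p%:R <= p'%:R :> R by rewrite ler_nat ltnW.
  have : q%:R * rho <= q'%:R * rho by rewrite ler_pM2r// ler_nat ltnW.
  by move: lt; lra.
Qed.

Lemma archi_scale (e : R) : 0 < e -> exists n, (0 < n)%N /\ 1 < n%:R * e.
Proof.
move=> e0; exists (Num.bound e^-1); have h : 1 < (Num.bound e^-1)%:R * e.
  by rewrite -ltr_pdivrMr// div1r; apply: archi_boundP; rewrite invr_ge0 ltW.
by split=> //; rewrite lt0n; apply: contraTneq h => ->; rewrite mul0r ltr10.
Qed.

(** Let z = f / g have positive value at rho, and let t be a monomial of g of
the same value. Then x t^n / g^n lies in the interval ring, because t has at
least the value of g at all weights, and (f / t)^n / x is in V for large n by
rho_monomial. *)
Lemma rho_pos_in z : ps rho z -> carrier V z.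
Proof.
have [->|z0] := eqVneq z 0; first by move=> _; inring sV.
have [f [g [Df Dg g0 zE]]] := hK z.
have f0 : f != 0 by apply: contra_neq z0 => f0; rewrite zE f0 mul0r.
move=> /(posE hD hK rho0 z0); rewrite zE (mval_fracE hD rho0)// subr_gt0 => lt.
have [t [gt ht]] := mval_dominating_monomial hD rho0 Dg g0.
have [l [u [[_ _ uu] _ fE hl]]] := mval_expansion R hD Df f0.
have e0 : 0 < w rho f - w rho g by rewrite subr_gt0.
have [n [n0 hn]] := archi_scale e0.
pose J := [set c | carrier V (c ^+ n / x)].
have V1 c : J c -> carrier V c.
  move=> Jc; apply: (@val_pow _ _ _ n.-1); rewrite prednK//.
  rewrite -(divfK x0 (c ^+ n)); apply: (subM sV) => //.
  exact: TV (interval_ring_sub Dx).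
have JM c d : carrier V c -> J d -> J (c * d).
  by move=> Vc Jd; rewrite /J /= exprMn -mulrA; apply: (subM sV) => //; inring sV.
have JD c d : J c -> J d -> J (c + d).
  wlog Vdc : c d / c != 0 /\ carrier V (d / c).
    move=> h Jc Jd; have [->|c0] := eqVneq c 0; first by rewrite add0r.
    have [->|d0] := eqVneq d 0; first by rewrite addr0.
    have [Vdc|Vcd] := val_total V (d / c); first exact: h.
    by rewrite addrC; apply: h => //; rewrite -invf_div.
  case: Vdc => c0 Vdc Jc _; rewrite (_ : c + d = (1 + d / c) * c).
    by apply: JM => //; inring sV.
  by rewrite mulrDl mul1r divfK.
have J0 : J 0 by rewrite /J /= expr0n (gtn_eqF n0) mul0r; inring sV.
have Jf : J (f / mon t).
  rewrite fE mulr_suml big_seq; apply: (big_ind J) => // s sl.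
  rewrite -mulrA; apply: JM; first by apply/TV/interval_ring_sub; case: (uu _ sl).
  rewrite /J /= expr_div_n -!monomialX -mulrA -invfM.
  have -> : mon (n * t.1, n * t.2)%N * x = mon (add_exp (n * t.1, n * t.2)%N (1, 0)%N).
    by rewrite /mon (monomialM x y) /monomial /= expr1 mulr1.
  apply: rho_monomial; rewrite weightD.
  have wn k : weight rho (n * k.1, n * k.2)%N = n%:R * weight rho k.
    by rewrite /weight /= !natrM; ring.
  rewrite !wn -gt /w /weight /= mul0r addr0.
  have [_ _ [_ /(_ _ sl)]] := hl _ rho0.
  move: hn => + /(ler_wpM2l (ler0n R n)); rewrite /w /weight; lra.
apply: (@val_pow _ _ _ n.-1); rewrite prednK//.
rewrite (_ : _ ^+ n = (f / mon t) ^+ n / x * (x * mon t ^+ n / g ^+ n)); last first.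
  by rewrite !expr_div_n; field; rewrite x0 !expf_neq0 ?mon0.
apply: (subM sV) => //; apply: TV; apply: interval_ring_pos => s sI.
have s0 := interval_gt0 sI; have mt0 := mon0 t.
apply/(posE hD hK s0); first by rewrite !mulf_neq0 ?invr_eq0 ?expf_neq0.
rewrite (mvalM hD hK s0) ?mulf_neq0 ?invr_eq0 ?expf_neq0//.
rewrite (mvalM hD hK s0) ?expf_neq0// (mvalV hD hK s0) ?expf_neq0// !(mvalX hD hK s0)//.
rewrite (mval_monomial hD s0); have := mval_quot 1 0 s0; rewrite expr1 expr0 divr1 mul0r subr0 /w => ->.
have := ler_wpM2l (ler0n R n) (ht _ s0); rewrite /w; lra.
Qed.

Lemma overring_below_rho : carrier V `<=` nneg rho.
Proof.
move=> z Vz; apply: contrapT => nz; apply: nVx.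
have z0 : z != 0 by apply/eqP => z0; apply: nz; rewrite z0; exact: (nneg0 hD rho0).
have lt : 0 < w rho z^-1.
  by apply/(posE hD hK rho0); [rewrite invr_eq0|exact: (pos_inv hD hK rho0)].
have [n [n0 hn]] := archi_scale lt.
rewrite (_ : x^-1 = z ^+ n * (z^-1 ^+ n / x)); last first.
  by rewrite mulrA -exprMn mulfV// expr1n mul1r.
apply: (subM sV); first exact: subX.
have zi0 : z^-1 != 0 by rewrite invr_eq0.
apply: rho_pos_in; apply/(posE hD hK rho0); first by rewrite mulf_neq0 ?invr_eq0// expf_neq0.
rewrite (mvalM hD hK rho0) ?expf_neq0 ?invr_eq0// (mvalX hD hK rho0)// (mvalV hD hK rho0 x0).
have := mval_quot 1 0 rho0; rewrite expr1 expr0 divr1 mul0r subr0 /w => ->.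
by move: hn; rewrite /w; lra.
Qed.

End Overring.

Lemma overring_below (V : valRing K) : T `<=` carrier V -> carrier V = setT \/
  exists2 r, a <= r <= b & carrier V `<=` nneg r.
Proof.
move=> TV; have [Vx|nVx] := pselect (carrier V x^-1); first by left; exact: overring_x.
by right; exists (sup [set p | exists i j : nat,
  [/\ (0 < j)%N, p = i%:R / j%:R & carrier V (y ^+ j / x ^+ i)]]);
  [exact: rho_interval|exact: overring_below_rho].
Qed.

End Interval.
End Overrings.

(** * Polynomials over a subring *)

Section OverRing.
Variables (K : fieldType) (A : set K).
Hypothesis sA : subring A.

Definition coefs_in (p : {poly K}) : Prop := forall i, A p`_i.

Lemma over_horner (W : set K) z p : subring W -> A `<=` W -> W z -> coefs_in p -> W p.[z].
Proof.
move=> sW AW Wz op; rewrite horner_coef; apply: (sub_sum sW) => i _.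
by have := AW _ (op i) => ?; inring sW.
Qed.
Lemma overC c : A c -> coefs_in c%:P.
Proof. by move=> Ac i; rewrite coefC; case: ifP => _ //; exact: sub0. Qed.
Lemma overX n : coefs_in 'X^n.
Proof. by move=> i; rewrite coefXn; case: (_ == _); inring sA. Qed.
Lemma overD p q : coefs_in p -> coefs_in q -> coefs_in (p + q).
Proof. by move=> op oq i; rewrite coefD; apply: subD. Qed.
Lemma overN p : coefs_in p -> coefs_in (- p).
Proof. by move=> op i; rewrite coefN; apply: subN. Qed.
Lemma overM p q : coefs_in p -> coefs_in q -> coefs_in (p * q).
Proof.
by move=> op oq i; rewrite coefM; apply: sub_sum => // j _; apply: subM.
Qed.
Lemma overZ c p : A c -> coefs_in p -> coefs_in (c *: p).
Proof. by move=> Ac op i; rewrite coefZ; apply: subM. Qed.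

Lemma over_division p q : coefs_in p -> coefs_in q -> q \is monic ->
  exists d e, [/\ coefs_in d, coefs_in e, p = d * q + e & (size e < size q)%N].
Proof.
move=> + oq mq; have q0 := monic_neq0 mq; have sq : (0 < size q)%N by rewrite size_poly_gt0.
have [n] := ubnP (size p); elim: n p => // n IH p; rewrite ltnS => pn op.
have [lt|le] := ltnP (size p) (size q).
  exists 0, p; split=> //; last by rewrite mul0r add0r.
  by rewrite -polyC0; apply: overC; exact: sub0.
pose k := (size p - size q)%N.
have oXk : coefs_in (lead_coef p *: 'X^k) by apply: overZ; [exact: op|exact: overX].
have op' : coefs_in (p - lead_coef p *: 'X^k * q) by apply/overD/overN/overM.
have sp : (0 < size p)%N by exact: leq_trans le.
have lt : (size (p - lead_coef p *: 'X^k * q)%R < size p)%N.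
  rewrite -(prednK sp) ltnS; apply/leq_sizeP => j jp.
  rewrite coefB -scalerAl coefZ coefXnM ifF; last by apply/negbTE; rewrite -leqNgt /k; lia.
  move: jp; rewrite leq_eqVlt => /orP[/eqP <-|jp].
    rewrite (_ : _ - k = (size q).-1)%N; last first.
      by rewrite /k; move: le sp sq; clear; move: (size p) (size q) => c d; lia.
    by rewrite -!lead_coefE (monicP mq) mulr1 subrr.
  rewrite nth_default; last by rewrite -(prednK sp).
  rewrite nth_default ?mulr0 ?subr0// /k; move: le sp sq jp; clear.
  by move: (size p) (size q) => c d; lia.
have [d [e [od oe pE se]]] := IH _ (leq_trans lt pn) op'.
exists (d + lead_coef p *: 'X^k), e; split=> //; first exact: overD.
by rewrite mulrDl addrAC -pE subrK.
Qed.

End OverRing.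

Lemma monic_const (K : fieldType) (p : {poly K}) :
  p \is monic -> (size p <= 1)%N -> p = 1.
Proof.
move=> + /size1_polyC e; rewrite e; move: p`_0 => c.
by rewrite monicE lead_coefC => /eqP ->.
Qed.

Lemma max_ideal_div (K : fieldType) (V : valRing K) z1 z2 c d :
  max_ideal_of V (z1 - c) -> max_ideal_of V (z2 - d) -> carrier V c ->
  unit_of (carrier V) d -> max_ideal_of V (z1 / z2 - c / d).
Proof.
have sV := (carrierP V).1; move=> m1 m2 Vc ud.
have [_ z20 Vz2i] : unit_of (carrier V) z2 by rewrite -(subrK d z2) addrC; exact: unitDmax.
have [Vd d0 Vdi] := ud.
rewrite (_ : _ - _ = (z2^-1 * d^-1) * (d * (z1 - c) - c * (z2 - d))).
  apply: max_idealM; first by inring sV.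
  by apply: max_idealB; exact: max_idealM.
by field; rewrite z20 d0.
Qed.

Lemma prime_ideal_pow (K : fieldType) (A P : set K) z n : subring A ->
  prime_ideal A P -> A z -> P (z ^+ n) -> P z.
Proof.
move=> sA [_ P1 Pp] Az; elim: n => [|n IH]; first by rewrite expr0 => /P1.
by rewrite exprS => /Pp[]//; inring sA.
Qed.

(** * Valuation rings below V_r for rational r *)

Section RationalWeight.
Variables (R : realType) (K : fieldType) (D : set K) (x y : K).
Hypothesis hD : regular_local_with_parameters D [:: x; y].
Hypothesis hK : quotient_field_of D.
Let sD := rlr_subring hD.
Let y0 := rlr_y_neq0 hD.
Let mon := monomial x y.
Let mon0 := monomial_neq0 hD.
Let w := @mval R K D x y.
Let ps := @pos R K D x y.
Let nneg := @monomial_val_set R K D x y.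

(** The exponents of the k-th term of a form of degree d in the two monomials
with exponents e1 and e2. *)
Definition comb_exp (e1 e2 : nat * nat) (d k : nat) : nat * nat :=
  (k * e1.1 + (d - k) * e2.1, k * e1.2 + (d - k) * e2.2)%N.

(** The quotient of the two monomials is a unit of V_r whose residue generates
the residue field of V_r over that of D. *)
Definition residue_parameter (r : R) (e1 e2 : nat * nat) : Prop :=
  [/\ weight r e1 = weight r e2,
    forall d k k', (k <= d)%N -> (k' <= d)%N -> k != k' ->
      ~~ le_exp (comb_exp e1 e2 d k) (comb_exp e1 e2 d k')
  & forall t t', weight r t = weight r t' -> exists n,
      mon t = mon t' * (mon e1 / mon e2) ^+ n \/ mon t' = mon t * (mon e1 / mon e2) ^+ n].

Lemma rational_residue_parameter (i j : nat) : (0 < i)%N -> (0 < j)%N -> coprime i j ->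
  residue_parameter (i%:R / j%:R) (i, 0)%N (0, j)%N.
Proof.
move=> i0 j0 cij; have jr0 : j%:R != 0 :> R by rewrite pnatr_eq0 -lt0n.
split.
- by rewrite /weight /= mul0r addr0 add0r mulrC divfK.
- move=> d k k' kd k'd kk'; rewrite /le_exp /comb_exp /= !muln0 !addn0 !add0n.
  rewrite !leq_pmul2r//; apply: contra kk' => /andP[l1 l2]; apply/eqP; lia.
- move=> t t' e.
  have {}e : (j * t.1 + t.2 * i = j * t'.1 + t'.2 * i)%N.
    apply/eqP; rewrite -(eqr_nat R) !natrD !natrM; apply/eqP.
    have h (c d : R) : j%:R * (c + d * (i%:R / j%:R)) = j%:R * c + d * i%:R by field.
    by rewrite -!h; congr (_ * _).
  have gen (p q : nat * nat) : (p.1 >= q.1)%N -> (j * p.1 + p.2 * i = j * q.1 + q.2 * i)%N ->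
      exists n, mon p = mon q * (mon (i, 0)%N / mon (0, j)%N) ^+ n.
    move=> le epq; have e2 : (j * (p.1 - q.1) = i * (q.2 - p.2))%N by nia.
    have /dvdnP[n en] : (i %| p.1 - q.1)%N.
      by rewrite -(@Gauss_dvdr i j)// e2 dvdn_mulr.
    have en2 : (q.2 = p.2 + n * j)%N.
      have : (i * (n * j) = i * (q.2 - p.2))%N by rewrite -e2 en; ring.
      move=> /eqP; rewrite eqn_pmul2l// => /eqP; nia.
    exists n; rewrite /mon /monomial /= !mulr1 !mul1r en2 -(subnKC le) en !exprD.
    by rewrite expr_div_n -!exprM ![(n * _)%N]mulnC; field; rewrite expf_neq0.
  have [le|/ltnW le] := leqP t'.1 t.1.
    by have [n] := gen _ _ le e; exists n; left.
  by have [n] := gen _ _ le (esym e); exists n; right.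
Qed.

Lemma residue_parameter_swap r e1 e2 :
  residue_parameter r e1 e2 -> residue_parameter r e2 e1.
Proof.
have ne1 := mon0 e1; have ne2 := mon0 e2.
move=> [we inc gen]; split=> //.
  move=> d k k' kd k'd kk'; have := inc d (d - k)%N (d - k')%N.
  rewrite /comb_exp !subKn// ![(k * _ + _)%N]addnC ![(k' * _ + _)%N]addnC.
  apply; rewrite ?leq_subr//; apply: contra kk' => /eqP e; apply/eqP; lia.
move=> t t' /gen[n e]; exists n.
have -> : (mon e2 / mon e1) ^+ n = ((mon e1 / mon e2) ^+ n)^-1.
  by rewrite -exprVn invf_div.
have h : (mon e1 / mon e2) ^+ n != 0 by rewrite expf_neq0// mulf_neq0 ?invr_eq0.
by case: e => ->; rewrite mulfK//; [right|left].
Qed.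

Section Residue.
Variables (r : R) (e1 e2 : nat * nat).
Hypothesis r0 : 0 < r.
Hypothesis rp : residue_parameter r e1 e2.
Let th := mon e1 / mon e2.
Let Vr := mval_ring hD hK r0.
Let sVr : subring (nneg r) := (carrierP Vr).1.

Let th0 : th != 0.
Proof. by rewrite mulf_neq0 ?invr_eq0 ?(mon0 _)//; exact: mon0. Qed.
Lemma th_mval : w r th = 0.
Proof.
have [we _ _] := rp.
by rewrite /w (mval_fracE hD r0)//; try exact: monomial_in; rewrite ?(mval_monomial hD r0)// we subrr.
Qed.
Lemma th_nneg : nneg r th.
Proof. by apply/(nnegE hD hK r0) => //; rewrite -/w th_mval. Qed.

Lemma over_nneg p : coefs_in D p -> nneg r p.[th].
Proof. by apply: over_horner => //; [exact: (sub_nneg hD hK r0)|exact: th_nneg]. Qed.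

Definition regular (p : {poly K}) : Prop := ~ ps r p.[th].

Lemma psM c d : nneg r c -> ps r d -> ps r (c * d). Proof. exact: (posM hD hK r0). Qed.
Lemma psD c d : ps r c -> ps r d -> ps r (c + d). Proof. exact: (posD hD hK r0). Qed.
Lemma ps0 : ps r 0. Proof. exact: (pos0 hD r0). Qed.

(** Multiplied by a power of the second monomial, p at theta becomes a sum of
multiples of monomials that are of the same weight and do not divide each
other. *)
Lemma unit_coef_regular p k : coefs_in D p -> unit_of D p`_k -> regular p.
Proof.
move=> op uk pp; have [we inc _] := rp.
have ks : (k < size p)%N.
  rewrite ltnNge; apply/negP => le; move: uk; rewrite nth_default//.
  by case=> _; rewrite eqxx.
pose d := size p; pose z := p.[th] * mon e2 ^+ d.
have wc i : (i <= d)%N -> weight r (comb_exp e1 e2 d i) = d%:R * weight r e2.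
  move=> id; rewrite /weight /comb_exp /= !natrD !natrM natrB//.
  by move: we; rewrite /weight; set a := _%:R; nra.
have zE : z = \sum_(i < d) p`_i * mon (comb_exp e1 e2 d i).
  rewrite /z horner_coef mulr_suml; apply: eq_bigr => -[i id] _ /=.
  rewrite -mulrA; congr (_ * _).
  have -> : mon (comb_exp e1 e2 d i) = mon e1 ^+ i * mon e2 ^+ (d - i).
    by rewrite -!monomialX /mon -monomialM.
  have -> : mon e2 ^+ d = mon e2 ^+ i * mon e2 ^+ (d - i) by rewrite -exprD subnKC// ltnW.
  by rewrite mulrA -exprMn divfK//; exact: mon0.
have zE' : z = p`_k * mon (comb_exp e1 e2 d k) +
    \sum_(i < d | i != Ordinal ks) p`_i * mon (comb_exp e1 e2 d i).
  by rewrite zE (bigD1 (Ordinal ks)).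
have := @leading_not_gt R K D x y hD r (comb_exp e1 e2 d k) p`_k
  (\sum_(i < d | i != Ordinal ks) p`_i * mon (comb_exp e1 e2 d i)) r0 uk.
rewrite -zE' wc; last exact: ltnW.
apply.
  apply: (big_ind (mono_ideal D x y _)) => [||[i id]]; first exact: mono_ideal0.
    by move=> ? ?; exact: mono_idealD.
  rewrite -val_eqE /= => ik; apply: mono_ideal1 => //.
  by apply: inc => //; exact: ltnW.
have [z0|z0] := eqVneq z 0; first by rewrite z0; exact: mono_ideal0.
have Dz : D z.
  rewrite zE; apply: (sub_sum sD) => i _; have Dm := monomial_in hD (comb_exp e1 e2 d i).
  by have := op i => ?; inring sD.
apply/(weight_gt_mval hD r0) => //.
have pt0 : p.[th] != 0 by apply: contra_neq z0 => e; rewrite /z e mul0r.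
have me0 := mon0 e2.
rewrite /z (mvalM hD hK r0) ?expf_neq0// (mvalX hD hK r0)// (mval_monomial hD r0).
by rewrite ltrDr; apply/(posE hD hK r0).
Qed.


Lemma monic_regular p : coefs_in D p -> p \is monic -> regular p.
Proof.
move=> op /monicP mp; apply: (unit_coef_regular (k := (size p).-1)) => //.
by rewrite -lead_coefE mp; exact: unit_of1.
Qed.

Lemma regular_unit p : coefs_in D p -> regular p -> unit_of (nneg r) p.[th].
Proof.
move=> op rp'; apply: (@val_unit _ Vr); first exact: over_nneg.
by move/(pos_max_ideal hD hK r0).
Qed.

Lemma residue_numerator t0 f : weight_ge D x y r (weight r t0) f ->
  exists n p, coefs_in D p /\ ps r (f / mon t0 * th ^+ n - p.[th]).
Proof.
have Vth := th_nneg; have me0 := mon0 t0.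
elim=> [|t c g le Dc _ [n [p [op pp]]]].
  exists 0%N, 0; split; first by rewrite -polyC0; apply: overC => //; inring sD.
  by rewrite mul0r mul0r horner0 subr0; exact: ps0.
have Vc : nneg r c by exact: (sub_nneg hD hK r0).
move: le; rewrite le_eqVlt => /orP[/eqP e|lt]; last first.
  exists n, p; split=> //; rewrite mulrDl mulrDl -addrA; apply: psD => //.
  rewrite mulrC -mulrA; apply: psM; first by inring sVr.
  have mt0 := mon0 t.
  apply: psM => //; apply/(posE hD hK r0); first by rewrite mulf_neq0 ?invr_eq0.
  rewrite (mval_fracE hD r0)//; try exact: monomial_in.
  by rewrite !(mval_monomial hD r0) subr_gt0.
have [_ _ gen] := rp; have [m] := gen _ _ e; rewrite -/th => -[em|em].
  (* t is t0 * theta ^- m: multiply the terms found so far by theta ^+ m as well *)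
  exists (n + m)%N, (p * 'X^m + c *: 'X^n); split.
    by apply: overD => //; [apply: overM => //; exact: overX|apply: overZ => //; exact: overX].
  have -> : (p * 'X^m + c *: 'X^n).[th] = p.[th] * th ^+ m + c * th ^+ n by rewrite !hornerE.
  rewrite (_ : _ - _ = th ^+ m * (g / mon t0 * th ^+ n - p.[th])).
    by apply: psM => //; inring sVr.
  have tm0 : th ^+ m != 0 by rewrite expf_neq0.
  by have mt0 := mon0 t; rewrite em exprD -/mon; field; rewrite mt0 tm0.
exists n, (p + c *: 'X^(m + n)); split.
  by apply: overD => //; apply: overZ => //; exact: overX.
have -> : (p + c *: 'X^(m + n)).[th] = p.[th] + c * th ^+ (m + n) by rewrite !hornerE.
by rewrite (_ : _ - _ = g / mon t0 * th ^+ n - p.[th])// -[monomial x y t]/(mon t) em exprD; field.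
Qed.

(** The residue field of V_r is generated by theta over that of D. *)
Lemma residue_fraction z : nneg r z -> ~ ps r z -> exists p q,
  [/\ coefs_in D p, coefs_in D q, regular p, regular q & ps r (z - p.[th] / q.[th])].
Proof.
move=> nz pz; have [f [g [Df Dg g0 zE]]] := hK z.
have z0 : z != 0 by apply/eqP => z0; apply: pz; rewrite z0; exact: ps0.
have f0 : f != 0 by apply: contra_neq z0 => f0; rewrite zE f0 mul0r.
have wfg : w r f = w r g.
  apply/eqP; rewrite -subr_eq0 -[w r f - _](mval_fracE hD r0)// -zE eq_le.
  by rewrite leNgt; apply/andP; split; [apply/negP => /(posE hD hK r0 z0)|apply/(nnegE hD hK r0 z0)].
have [t [gt _]] := mval_dominating_monomial hD r0 Dg g0.
have [|n [p [op pp]]] := @residue_numerator t f.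
  by apply/(weight_ge_mval hD r0); rewrite // -/w wfg -gt.
have [|m [q [oq pq]]] := @residue_numerator t g.
  by apply/(weight_ge_mval hD r0); rewrite // -gt.
have Vth := th_nneg.
have opm : coefs_in D (p * 'X^m) by apply: overM => //; exact: overX.
have oqn : coefs_in D (q * 'X^n) by apply: overM => //; exact: overX.
have mt0 := mon0 t.
have E1 : ps r (f / mon t * th ^+ (n + m) - (p * 'X^m).[th]).
  rewrite !hornerE (_ : _ - _ = th ^+ m * (f / mon t * th ^+ n - p.[th])).
    by apply: psM => //; inring sVr.
  by rewrite exprD; ring.
have E2 : ps r (g / mon t * th ^+ (n + m) - (q * 'X^n).[th]).
  rewrite !hornerE (_ : _ - _ = th ^+ n * (g / mon t * th ^+ m - q.[th])).
    by apply: psM => //; inring sVr.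
  by rewrite exprD; ring.
have reg h s : D h -> h != 0 -> w r h = weight r t -> coefs_in D s ->
    ps r (h / mon t * th ^+ (n + m) - s.[th]) -> regular s.
  move=> Dh h0 wh os ph ps'; have : ps r (h / mon t * th ^+ (n + m)).
    by rewrite -(subrK s.[th] (_ * _)); exact: psD.
  have tn0 : th ^+ (n + m) != 0 by rewrite expf_neq0.
  move/(posE hD hK r0); rewrite (mvalM hD hK r0) ?mulf_neq0 ?invr_eq0// (mvalX hD hK r0)// -/w th_mval.
  rewrite /w (mval_fracE hD r0)//; last exact: monomial_in.
  by rewrite (mval_monomial hD r0) -/w wh subrr mulr0 addr0 ltxx => /(_ isT).
exists (p * 'X^m), (q * 'X^n); split=> //.
- by apply: reg E1; rewrite ?wfg.
- exact: reg E2.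
have -> : z = (f / mon t * th ^+ (n + m)) / (g / mon t * th ^+ (n + m)).
  by rewrite zE; field; rewrite g0 mt0 expf_neq0.
apply/(pos_max_ideal hD hK r0); apply: max_ideal_div; [exact/(pos_max_ideal hD hK r0)|exact/(pos_max_ideal hD hK r0)|exact: over_nneg|].
by apply: regular_unit => //; exact: reg E2.
Qed.

(** Dropping the terms with non-unit leading coefficients does not change the
residue at theta. *)
Lemma regular_trim p : coefs_in D p -> regular p -> exists c q,
  [/\ unit_of D c, coefs_in D q, q \is monic, (size q <= size p)%N & ps r (p.[th] - c * q.[th])].
Proof.
have [n] := ubnP (size p); elim: n p => // n IH p; rewrite ltnS => pn op rp'.
have sp : (0 < size p)%N.
  rewrite lt0n; apply/eqP => /eqP; rewrite size_poly_eq0 => /eqP p0.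
  by apply: rp'; rewrite p0 horner0; exact: ps0.
have [uc|nc] := pselect (unit_of D (lead_coef p)).
  have [Dc c0 Dci] := uc; exists (lead_coef p), ((lead_coef p)^-1 *: p); split=> //.
  - exact: overZ.
  - by rewrite monicE lead_coefZ mulVf.
  - by rewrite size_scale ?invr_eq0.
  - by rewrite hornerZ mulVKf// subrr; exact: ps0.
pose p' := \poly_(i < (size p).-1) p`_i.
have op' : coefs_in D p'.
  by move=> i; rewrite coef_poly; case: ifP => _; [exact: op|inring sD].
have sp' : (size p' <= (size p).-1)%N by exact: size_poly.
have pE : p.[th] - p'.[th] = lead_coef p * th ^+ (size p).-1.
  rewrite (@horner_coef_wide _ (size p).-1.+1); last by rewrite prednK.
  rewrite horner_poly big_ord_recr /= addrC.
  by rewrite addrK lead_coefE.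
have ppE : ps r (p.[th] - p'.[th]).
  rewrite pE mulrC; apply: psM; first by have := th_nneg => ?; inring sVr.
  by apply: (nonunit_pos hD hK r0) => //; exact: op.
have rp2 : regular p'.
  by move=> pp'; apply: rp'; rewrite -(subrK p'.[th] p.[th]); exact: psD.
have [|c [q [uc oq mq sq pq]]] := IH p' _ op' rp2.
  by apply: leq_ltn_trans sp' _; rewrite prednK.
exists c, q; split=> //; first by apply: leq_trans sq (leq_trans sp' (leq_pred _)).
by rewrite -(subrK p'.[th] p.[th]) -addrA; exact: psD.
Qed.

(** W is a ring below V_r that contains theta, and its center on k[t] contains the
residue of q. *)
Definition lies_over (W : valRing K) (q : {poly K}) : Prop :=
  [/\ D `<=` carrier W, carrier W `<=` nneg r, carrier W th & max_ideal_of W q.[th]].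

(** A polynomial whose residue generates the prime ideal of k[t] that is the
center of V on the residue field k(t) of V_r, where t is the residue of theta. *)
Definition minimal_in (V : valRing K) (q : {poly K}) : Prop :=
  [/\ coefs_in D q, q \is monic, max_ideal_of V q.[th] &
    forall p, coefs_in D p -> regular p -> (size p < size q)%N -> unit_of (carrier V) p.[th]].

Lemma lies_over_horner W q p : lies_over W q -> coefs_in D p -> carrier W p.[th].
Proof. by move=> [DW _ Wth _]; apply: over_horner => //; exact: (carrierP W).1. Qed.

Lemma unit_in_over (W : valRing K) c : D `<=` carrier W -> unit_of D c -> unit_of (carrier W) c.
Proof. by move=> DW [Dc c0 Dci]; split=> //; exact: DW. Qed.

Lemma lies_over_pos W q z : lies_over W q -> ps r z -> max_ideal_of W z.
Proof. by move=> [_ Wr _ _]; exact: (pos_max hD hK r0 Wr). Qed.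

Lemma lies_over_congr W q z z' : lies_over W q -> unit_of (carrier W) z' ->
  ps r (z - z') -> unit_of (carrier W) z.
Proof.
move=> lW uz' pz; rewrite -(subrK z' z) addrC; apply: unitDmax => //.
exact: lies_over_pos lW pz.
Qed.

Lemma exists_minimal (V : valRing K) : D `<=` carrier V -> carrier V `<=` nneg r ->
  carrier V <> nneg r -> carrier V th -> exists2 q, minimal_in V q & lies_over V q.
Proof.
move=> DV Vr' nVr Vth; have sV := (carrierP V).1.
have Vh p : coefs_in D p -> carrier V p.[th] by exact: over_horner.
have Vpos z : ps r z -> max_ideal_of V z by exact: (pos_max hD hK r0 Vr').
have [z nz nVz] : exists2 z, nneg r z & ~ carrier V z.
  apply: contrapT => nz; apply: nVr; apply/seteqP; split=> // z nnz.
  by apply: contrapT => nVz; apply: nz; exists z.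
have [|p [q [op oq rp' rq pz]]] := residue_fraction nz.
  by move/Vpos => [].
have mq : max_ideal_of V q.[th].
  apply/max_idealE; right => Vq; apply: nVz; rewrite -(subrK (p.[th] / q.[th]) z).
  by have [Vz _] := Vpos _ pz; have := Vh _ op => ?; inring sV.
have ex : exists n, `[< exists q, [/\ coefs_in D q, regular q, max_ideal_of V q.[th] & size q = n] >].
  by exists (size q); apply/asboolP; exists q.
have [n /asboolP[q1 [oq1 rq1 mq1 sq1]] mn] := ex_minnP ex.
have [c [q2 [uc oq2 mq2 sq2 pq2]]] := regular_trim oq1 rq1.
have mq2' : max_ideal_of V q2.[th].
  have [Vc c0 Vci] := unit_in_over DV uc; rewrite -(mulKf c0 q2.[th]).
  apply: max_idealM => //; rewrite -(subrK q1.[th] (_ * _)); apply: max_idealD => //.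
  by rewrite -opprB; apply: max_idealN; exact: Vpos.
exists q2; last by split.
split=> // p' op' rp2 lt; apply: val_unit; first exact: Vh.
move=> mp'; have /mn : `[< exists q, [/\ coefs_in D q, regular q, max_ideal_of V q.[th] & size q = size p'] >].
  by apply/asboolP; exists p'.
by rewrite leqNgt -sq1 (leq_trans lt sq2).
Qed.

Section Minimal.
Variables (V : valRing K) (q : {poly K}).
Hypothesis mV : minimal_in V q.
Hypothesis lV : lies_over V q.

Let oq : coefs_in D q. Proof. by case: mV. Qed.
Let mq : q \is monic. Proof. by case: mV. Qed.
Let rq : regular q. Proof. exact: monic_regular. Qed.
Let q0 : q != 0. Proof. exact: monic_neq0. Qed.
Let qth0 : q.[th] != 0.
Proof. by apply/eqP => e; apply: rq; rewrite e; exact: ps0. Qed.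

Lemma minimal_size : (1 < size q)%N.
Proof.
rewrite ltnNge; apply/negP => /(monic_const mq) q1; have [_ _ m _] := mV.
by apply: (@max_ideal1 _ V); move: m; rewrite q1 -polyC1 hornerC.
Qed.

(** Modulo the maximal ideal of D, the nonzero polynomial p of smaller degree is
prime to q: this is the Euclidean algorithm for p and q. *)
Lemma small_unit W p : lies_over W q -> coefs_in D p -> regular p ->
  (size p < size q)%N -> unit_of (carrier W) p.[th].
Proof.
move=> lW; have [DW Wr Wth Wq] := lW; have sW := (carrierP W).1.
have [n] := ubnP (size p); elim: n p => // n IH p; rewrite ltnS => pn op rp' pq.
have [c [p1 [uc op1 mp1 sp1 pp1]]] := regular_trim op rp'.
apply: (lies_over_congr lW _ pp1); apply: unit_ofM => //; first exact: unit_in_over.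
have Wp1 := lies_over_horner lW op1.
have rp1 : regular p1 by exact: monic_regular.
have [d [e [od oe qE se]]] := over_division sD oq op1 mp1.
have Wd := lies_over_horner lW od.
have hE : q.[th] = d.[th] * p1.[th] + e.[th] by rewrite qE hornerD hornerM.
have [pe|re] := pselect (ps r e.[th]); last first.
  apply: (unit_of_mull sW (d := d.[th])) => //; rewrite mulrC.
  rewrite (_ : _ * _ = - e.[th] + q.[th]); last by rewrite hE; ring.
  apply: unitDmax => //; have [Ve e0 Vei] : unit_of (carrier W) e.[th].
    apply: IH => //; first exact: leq_trans se (leq_trans sp1 pn).
    exact: leq_trans se (leq_trans sp1 (ltnW pq)).
  by split; rewrite ?oppr_eq0 ?invrN//; inring sW.
have [s1|s1] := leqP (size p1) 1.
  by rewrite (monic_const mp1 s1) -polyC1 hornerC; exact: unit_of1.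
exfalso; have rd : regular d.
  move=> pd; apply: rq; rewrite hE; apply: psD => //; rewrite mulrC; apply: psM => //.
  exact: over_nneg.
have d0 : d != 0 by apply/eqP => d0; apply: rd; rewrite d0 horner0; exact: ps0.
have sd : (size d < size q)%N.
  have sM := size_Mmonic d0 mp1.
  have sd0 : (0 < size d)%N by rewrite size_poly_gt0.
  have -> : size q = (size d + size p1).-1.
    rewrite qE size_polyDl// sM; apply: leq_trans se _.
    by move: sd0; clear; move: (size d) (size p1) => i j; lia.
  by move: sd0 s1; clear; move: (size d) (size p1) => i j; lia.
have [_ _ mVq min] := mV.
have up1 := min _ op1 rp1 (leq_ltn_trans sp1 pq).
have ud := min _ od rd sd.
apply: (unit_not_max (unit_ofM (carrierP V).1 ud up1)).
rewrite (_ : _ * _ = q.[th] - e.[th]); last by rewrite hE addrK.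
by apply: max_idealB => //; exact: lies_over_pos lV pe.
Qed.

Lemma q_adic_value p : coefs_in D p -> regular p -> exists n, forall W, lies_over W q ->
  unit_of (carrier W) (p.[th] / q.[th] ^+ n).
Proof.
have [n] := ubnP (size p); elim: n p => // n IH p; rewrite ltnS => pn op rp'.
have [d [e [od oe pE se]]] := over_division sD op oq mq.
have hE : p.[th] = d.[th] * q.[th] + e.[th] by rewrite pE hornerD hornerM.
have [pe|re] := pselect (ps r e.[th]); last first.
  exists 0%N => W lW; rewrite expr0 divr1 hE addrC; have [_ _ _ Wq] := lW.
  apply: unitDmax; first exact: small_unit.
  by apply: max_idealM => //; exact: lies_over_horner lW od.
have rd : regular d.
  move=> pd; apply: rp'; rewrite hE; apply: psD => //; rewrite mulrC; apply: psM => //.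
  exact: over_nneg.
have d0 : d != 0 by apply/eqP => d0; apply: rd; rewrite d0 horner0; exact: ps0.
have sd : (size d < size p)%N.
  have sM := size_Mmonic d0 mq; have sq := minimal_size.
  have sd0 : (0 < size d)%N by rewrite size_poly_gt0.
  have -> : size p = (size d + size q).-1.
    rewrite pE size_polyDl// sM; apply: leq_trans se _.
    by move: sd0; clear; move: (size d) (size q) => i j; lia.
  by move: sd0 sq; clear; move: (size d) (size q) => i j; lia.
have [m hm] := IH _ (leq_trans sd pn) od rd.
exists m.+1 => W lW; apply: (lies_over_congr lW (hm _ lW)).
have -> : p.[th] / q.[th] ^+ m.+1 - d.[th] / q.[th] ^+ m = q.[th] ^- m.+1 * e.[th].
  by rewrite hE exprS; field; rewrite qth0 expf_neq0.
apply: psM => //; have [Vq _ Vqi] := regular_unit oq rq.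
by rewrite -exprVn; exact: (subX sVr).
Qed.

(** As n and m are the same for all rings W over q, it depends only on q whether z
is in W. *)
Lemma residue_structure z : nneg r z -> ~ ps r z -> exists n m, forall W, lies_over W q ->
  unit_of (carrier W) (z * q.[th] ^+ m / q.[th] ^+ n).
Proof.
move=> nz pz; have [p [s [op os rp' rs' pzs]]] := residue_fraction nz pz.
have [n hn] := q_adic_value op rp'; have [m hm] := q_adic_value os rs'.
exists n, m => W lW; have sW := (carrierP W).1.
have [[_ s0 _] [Vq _ Vqi]] := (regular_unit os rs', regular_unit oq rq).
have := unit_ofM sW (hn _ lW) (unit_ofV (hm _ lW)) => u.
apply: (lies_over_congr lW u).
have -> : z * q.[th] ^+ m / q.[th] ^+ n - p.[th] / q.[th] ^+ n / (s.[th] / q.[th] ^+ m) =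
    q.[th] ^+ m / q.[th] ^+ n * (z - p.[th] / s.[th]).
  by field; rewrite s0 !expf_neq0.
by apply: psM => //; rewrite -exprVn; inring sVr.
Qed.

Lemma lies_over_mem W z n m : lies_over W q ->
  unit_of (carrier W) (z * q.[th] ^+ m / q.[th] ^+ n) -> carrier W z <-> (m <= n)%N.
Proof.
move=> lW; have sW := (carrierP W).1; have [_ _ _ Wq] := lW.
set u := _ / _ => uu; have [Wu u0 Wui] := uu; have [Wq' _] := Wq.
have zE : z * q.[th] ^+ m = u * q.[th] ^+ n by rewrite /u divfK// expf_neq0.
split=> [Wz|le].
  rewrite leqNgt; apply/negP => lt; apply: (unit_not_max uu).
  have -> : u = z * q.[th] ^+ (m - n.+1).+1.
    apply: (mulIf (expf_neq0 n qth0)); rewrite -zE -mulrA -exprD; congr (_ * _ ^+ _).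
    by move: lt; clear; lia.
  by apply: max_idealM => //; exact: max_idealX.
have -> : z = u * q.[th] ^+ (n - m).
  by apply: (mulIf (expf_neq0 m qth0)); rewrite -mulrA -exprD subnK.
by inring sW.
Qed.

(** Membership of z in such a ring is the comparison of the exponents n and m of
residue_structure. *)
Lemma lies_over_unique W : lies_over W q -> W = V.
Proof.
move=> lW; apply: valRing_eq.
have [_ Wr _ _] := lW; have [_ Vr' _ _] := lV.
apply/seteqP; split=> z Wz.
  have [pz|pz] := pselect (ps r z); first by have [] := lies_over_pos lV pz.
  have [n [m h]] := residue_structure (Wr _ Wz) pz.
  by apply/(lies_over_mem lV (h _ lV)); apply/(lies_over_mem lW (h _ lW)).
have [pz|pz] := pselect (ps r z); first by have [] := lies_over_pos lW pz.
have [n [m h]] := residue_structure (Vr' _ Wz) pz.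
by apply/(lies_over_mem lW (h _ lW)); apply/(lies_over_mem lV (h _ lV)).
Qed.

Lemma max_q_power z : max_ideal_of V z -> ~ ps r z ->
  exists u n, unit_of (carrier V) u /\ z = u * q.[th] ^+ n.+1.
Proof.
move=> mz pz; have [Vz _] := mz; have [_ Vr' _ Vq] := lV.
have [n [m h]] := residue_structure (Vr' _ Vz) pz; have := h _ lV; set u := _ / _ => uu.
have zE : z * q.[th] ^+ m = u * q.[th] ^+ n by rewrite /u divfK// expf_neq0.
have mn : (m < n)%N.
  rewrite ltn_neqAle; apply/andP; split; last by apply/(lies_over_mem lV (h _ lV)).
  apply/eqP => mn; apply: (unit_not_max uu).
  by rewrite /u mn mulfK// expf_neq0.
exists u, (n - m.+1)%N; split=> //.
apply: (mulIf (expf_neq0 m qth0)); rewrite zE -[RHS]mulrA -exprD; congr (_ * _ ^+ _).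
by move: mn; clear; lia.
Qed.

End Minimal.

End Residue.
End RationalWeight.

(** * Rank two *)

Section RankTwo.
Variables (R : realType) (K : fieldType) (D : set K) (x y : K).
Hypothesis hD : regular_local_with_parameters D [:: x; y].
Hypothesis hK : quotient_field_of D.
Let sD := rlr_subring hD.
Let x0 := rlr_x_neq0 hD.
Let mon := monomial x y.
Let w := @mval R K D x y.
Let ps := @pos R K D x y.
Let nneg := @monomial_val_set R K D x y.
Variable r : R.
Hypothesis r0 : 0 < r.

Section Below.
Variable V : valRing K.
Hypothesis Vr : carrier V `<=` nneg r.
Let sV := (carrierP V).1.

(** V_r has rank one: a high power of z is a multiple of c. *)
Lemma prime_contains_pos P c z : prime_ideal (carrier V) P -> P c -> c != 0 ->
  ps r z -> P z.
Proof.
move=> pP Pc c0 pz; have [[PV P0 PD PM] _ _] := pP.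
have [->//|z0] := eqVneq z 0.
have lt : 0 < w r z by apply/(posE hD hK r0).
pose n := Num.bound (`|w r c| / w r z).
have hn : w r c < n%:R * w r z.
  rewrite (le_lt_trans (ler_norm _))// -ltr_pdivrMr//; apply: archi_boundP.
  by rewrite divr_ge0// ltW.
apply: (@prime_ideal_pow _ _ _ _ n sV pP); first exact: (pos_in hD hK r0 Vr).
rewrite -(divfK c0 (z ^+ n)); apply: PM => //; apply: (pos_in hD hK r0 Vr).
apply/(posE hD hK r0); first by rewrite mulf_neq0 ?invr_eq0 ?expf_neq0.
rewrite (mvalM hD hK r0) ?invr_eq0 ?expf_neq0// (mvalX hD hK r0)// (mvalV hD hK r0 c0).
by rewrite subr_gt0.
Qed.

Lemma proper_ideal_sub J z : ideal (carrier V) J -> ~ J 1 -> J z -> max_ideal_of V z.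
Proof.
move=> [JV _ _ JM] J1 Jz; split; first exact: JV.
by move=> [_ z0 Vz]; apply: J1; rewrite -(mulVf z0); exact: JM.
Qed.

Lemma rank2_neq : rank2 V -> carrier V <> nneg r.
Proof.
move=> [[P [Pp Plt]] _] e.
have pP1 := Pp 1%N isT; have [iP2 P21 _] := Pp 2%N isT.
have [[_ P00 _ _] _ _] := Pp 0%N isT.
have [_ n01] := Plt 0%N isT; have [_ n12] := Plt 1%N isT.
have [c Pc c0] : exists2 c, P 1%N c & c != 0.
  apply: contrapT => nc; apply: n01 => c Pc.
  by have [->//|c0] := eqVneq c 0; case: nc; exists c.
apply: n12 => z P2z; apply: prime_contains_pos pP1 Pc c0 _.
apply/(pos_max_ideal hD hK r0); have [Vz nz] := proper_ideal_sub iP2 P21 P2z.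
by rewrite /max_ideal_of /= /mval_ring /= -/(nneg r) -e.
Qed.

End Below.

Variables (e1 e2 : nat * nat).
Hypothesis rp : residue_parameter x y r e1 e2.
Let th := mon e1 / mon e2.
Let Vr := mval_ring hD hK r0.
Let sVr : subring (nneg r) := (carrierP Vr).1.
Let th0 : th != 0.
Proof. by rewrite mulf_neq0 ?invr_eq0 ?(monomial_neq0 hD _)//; exact: monomial_neq0. Qed.

(** The primes are 0, the maximal ideal of V_r and that of V: a prime that is larger
than the second one contains a power of q(theta), hence q(theta), hence all of
the third one. *)
Lemma rank2_below (V : valRing K) : D `<=` carrier V -> carrier V `<=` nneg r ->
  carrier V <> nneg r -> carrier V th -> rank2 V.
Proof.
move=> DV Vr' nVr Vth; have sV := (carrierP V).1.
have [q mq lq] := exists_minimal hD hK r0 rp DV Vr' nVr Vth.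
have [_ mo mqth _] := mq.
have npq : ~ ps r q.[th] by apply: monic_regular; case: mq.
have Vpos z : ps r z -> carrier V z by exact: (pos_in hD hK r0 Vr').
split.
  exists (fun i => if i is 0%N then [set 0] else if i is 1%N then ps r else max_ideal_of V); split.
    case=> [|[|i]] _ /=.
    - split=> [|/eqP|c d _ _ /eqP]; last by rewrite mulf_eq0 => /orP[]/eqP; [left|right].
        by split=> [_ ->||_ _ -> ->|e _ _ ->] //=; rewrite ?addr0 ?mulr0//; inring sV.
      by rewrite oner_eq0.
    - split; [|by apply: (unit_not_pos hD hK r0); exact: unit_of1|].
        split=> //; [exact: (pos0 hD r0)|by move=> c d; exact: (posD hD hK r0)|].
        by move=> e c /Vr' Ve; exact: (posM hD hK r0).
      move=> c d /Vr' Vc /Vr' Vd /(pos_max_ideal hD hK r0)/max_prime[]//.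
        by move/(pos_max_ideal hD hK r0); left.
      by move/(pos_max_ideal hD hK r0); right.
    - split; [exact: max_ideal_ideal|exact: max_ideal1|by move=> c d; exact: max_prime].
  case=> [|[|i]] //= _; split.
  - by move=> _ ->; exact: (pos0 hD r0).
  - have px : ps r x.
      apply: (nonunit_pos hD hK r0); first exact: rlr_x hD.
      by move=> /(unit_notin_span hD); apply; exact: span_x.
    by move=> /(_ _ px) /= /eqP; rewrite (negbTE x0).
  - by move=> z; exact: (pos_max hD hK r0 Vr').
  - by move=> /(_ _ mqth).
move=> [P [Pp Plt]].
have [[[_ P00 _ _] _ _] pP1 pP2] := And3 (Pp 0%N isT) (Pp 1%N isT) (Pp 2%N isT).
have [iP3 P31 _] := Pp 3%N isT; have [iP2 P21 _] := pP2.
have [s01 n01] := Plt 0%N isT; have [s12 n12] := Plt 1%N isT; have [s23 n23] := Plt 2%N isT.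
have [c Pc c0] : exists2 c, P 1%N c & c != 0.
  apply: contrapT => nc; apply: n01 => c Pc.
  by have [->//|c0] := eqVneq c 0; case: nc; exists c.
have pos1 z : ps r z -> P 1%N z by exact: (prime_contains_pos Vr' pP1 Pc c0).
have [d P2d P1d] : exists2 d, P 2%N d & ~ P 1%N d.
  by apply: contrapT => nd; apply: n12 => d P2d; apply: contrapT => P1d; apply: nd; exists d.
have [u [n [[Vu u0 Vui] dE]]] : exists u n, unit_of (carrier V) u /\ d = u * q.[th] ^+ n.+1.
  apply: (max_q_power hD hK r0 rp mq lq); first exact: proper_ideal_sub iP2 P21 P2d.
  by move=> pd; apply: P1d; exact: pos1.
have [_ _ _ P2M] := iP2; have [Vq _] := mqth.
have P2q : P 2%N q.[th].
  apply: (prime_ideal_pow (n := n.+1) sV pP2) => //.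
  by rewrite -(mulKf u0 (q.[th] ^+ _)) -dE; exact: P2M.
apply: n23 => z P3z; have mz := proper_ideal_sub iP3 P31 P3z.
have [pz|pz] := pselect (ps r z); first by apply: s12; exact: pos1.
have [u' [m [[Vu' _ _] ->]]] := max_q_power hD hK r0 rp mq lq mz pz.
by rewrite exprSr mulrA; apply: P2M => //; inring sV.
Qed.

(** Otherwise q could be divided by theta modulo the maximal ideal of D. *)
Lemma minimal_const_unit (V : valRing K) q : minimal_in D x y r e1 e2 V q ->
  lies_over D x y r e1 e2 V q -> carrier V th^-1 -> unit_of D q`_0.
Proof.
move=> mV lV Vthi; have [oq mq mqth min] := mV; have [DV Vr' Vth _] := lV.
apply: contrapT => nq0; have s1 := minimal_size mV.
pose p := \poly_(i < (size q).-1) q`_i.+1.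
have op : coefs_in D p by move=> i; rewrite coef_poly; case: ifP => _; [exact: oq|exact: sub0].
have sp : (size p < size q)%N.
  by rewrite (leq_ltn_trans (size_poly _ _))// prednK// ltnW.
have p1 : p`_(size q).-2 = 1.
  rewrite coef_poly; move/monicP: mq; rewrite lead_coefE.
  by case: (size q) s1 => [|[|n]] //= _; rewrite ltnS leqnn.
have rp' : ~ ps r p.[th].
  by apply: (unit_coef_regular hD hK r0 rp (k := (size q).-2)) => //; rewrite p1; exact: unit_of1.
have qE : q.[th] = q`_0 + th * p.[th].
  rewrite (@horner_coef_wide _ (size q).-1.+1); last by rewrite prednK// ltnW.
  rewrite horner_poly big_ord_recl /= expr0 mulr1; congr (_ + _).
  by rewrite mulr_sumr; apply: eq_bigr => i _; rewrite /bump /= add1n exprS; ring.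
apply: (unit_not_max (min _ op rp' sp)).
rewrite (_ : p.[th] = th^-1 * (q.[th] - q`_0)); last by rewrite qE addrC addKr mulKf.
apply: max_idealM => //; apply: max_idealB => //; apply: (pos_max hD hK r0 Vr').
by apply: (nonunit_pos hD hK r0) => //; exact: oq.
Qed.

Lemma minimal_X (V : valRing K) : D `<=` carrier V -> max_ideal_of V th ->
  minimal_in D x y r e1 e2 V 'X.
Proof.
move=> DV mth; split.
- by rewrite -['X]expr1; exact: overX.
- exact: monicX.
- by rewrite hornerX.
move=> p op rp'; rewrite size_polyX ltnS => /size1_polyC pE.
apply: (unit_in_over DV); rewrite pE hornerC; apply: contrapT => np; apply: rp'.
by rewrite pE hornerC; apply: (nonunit_pos hD hK r0) => //; exact: op.
Qed.

(** The elements of V_r whose residue in k(t) is regular at t = 1. *)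
Definition ring_at1 : set K := [set z | exists p q,
  [/\ coefs_in D p, coefs_in D q, unit_of D q.[1] & ps r (z - p.[th] / q.[th])]].

Let D1 : D 1. Proof. exact: sub1. Qed.

Lemma unit_at1_regular p : coefs_in D p -> unit_of D p.[1] -> ~ ps r p.[th].
Proof.
move=> op up pp; have [k uk] : exists k, unit_of D p`_k.
  apply: contrapT => nk; apply: (unit_not_pos hD hK r0 up).
  rewrite horner_coef; apply: (big_ind (ps r)) => [||i _]; first exact: (pos0 hD r0).
    by move=> c d; exact: (posD hD hK r0).
  rewrite expr1n mulr1; apply: (nonunit_pos hD hK r0) => // u; apply: nk; by exists i.
exact: (unit_coef_regular hD hK r0 rp op uk).
Qed.

(** A common zero of numerator and denominator at t = 1 cancels. *)
Lemma residue_regular_at1 p q : coefs_in D p -> coefs_in D q -> ~ ps r p.[th] -> ~ ps r q.[th] ->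
  exists p' q', [/\ coefs_in D p', coefs_in D q', unit_of D p'.[1] \/ unit_of D q'.[1],
    ~ ps r p'.[th] /\ ~ ps r q'.[th] & ps r (p.[th] / q.[th] - p'.[th] / q'.[th])].
Proof.
have Vth := th_nneg hD hK r0 rp.
have [n] := ubnP (size p); elim: n p q => // n IH p q; rewrite ltnS => pn op oq rp' rq.
have [u|nu] := pselect (unit_of D p.[1] \/ unit_of D q.[1]).
  by exists p, q; split=> //; rewrite subrr; exact: (pos0 hD r0).
move/not_orP: nu => [np nq].
have oX : coefs_in D ('X - 1%:P).
  by rewrite -['X]expr1; apply: overD => //; [exact: overX|apply: overN => //; exact: overC].
have mX : ('X - 1%:P : {poly K}) \is monic by exact: monicXsubC.
have h1 s : coefs_in D s -> D s.[1] by apply: over_horner.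
have div s : coefs_in D s -> ~ unit_of D s.[1] -> ~ ps r s.[th] -> exists d,
    [/\ coefs_in D d, ~ ps r d.[th], ps r (s.[th] - d.[th] * (th - 1)) & s = d * ('X - 1%:P) + (s.[1])%:P].
  move=> os ns rs; have [d [e [od oe sE se]]] := over_division sD os oX mX.
  move: se; rewrite size_XsubC ltnS => /size1_polyC eE.
  pose c := e`_0; have {}eE : e = c%:P by [].
  have s1 : s.[1] = c by rewrite sE eE !hornerE subrr mulr0 add0r.
  have hE : s.[th] - d.[th] * (th - 1) = c.
    by rewrite sE eE !hornerE addrAC subrr add0r.
  have pe : ps r (s.[th] - d.[th] * (th - 1)).
    by rewrite hE -s1; apply: (nonunit_pos hD hK r0) => //; exact: h1.
  exists d; split=> //; last by rewrite s1 -eE.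
  move=> pd; apply: rs; rewrite -(subrK (d.[th] * (th - 1)) s.[th]).
  apply: (posD hD hK r0) => //; rewrite mulrC; apply: (posM hD hK r0) => //; inring sVr.
have [d [od rd pd pE]] := div _ op np rp'.
have [e [oe re qe qE]] := div _ oq nq rq.
have d0 : d != 0 by apply/eqP => d0; apply: rd; rewrite d0 horner0; exact: (pos0 hD r0).
have sd : (size d < n)%N.
  apply: leq_trans pn; rewrite pE size_polyDl.
    rewrite size_Mmonic// size_XsubC addn2 /=; exact: leqnn.
  rewrite size_Mmonic// size_XsubC addn2 /= (leq_ltn_trans (size_polyC_leq1 _))// ltnS.
  by rewrite size_poly_gt0.
have [p' [q' [op' oq' u [rp2 rq2] pq]]] := IH _ _ sd od oe rd re.
exists p', q'; split=> //.
rewrite -(subrK (d.[th] / e.[th]) (p.[th] / q.[th])) -addrA; apply: (posD hD hK r0) => //.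
have u1 : unit_of (nneg r) (e.[th] * (th - 1)).
  apply: (@val_unit _ Vr); first by apply: (subM sVr); [exact: (over_nneg hD hK r0 rp)|inring sVr].
  move=> /(pos_max_ideal hD hK r0) pe; apply: rq.
  by rewrite -(subrK (e.[th] * (th - 1)) q.[th]); exact: (posD hD hK r0).
have [_ n0 _] := u1; move: n0; rewrite mulf_eq0 negb_or => /andP[e0 t10].
rewrite (_ : d.[th] / e.[th] = d.[th] * (th - 1) / (e.[th] * (th - 1))); last first.
  by field; rewrite e0 t10.
apply/(pos_max_ideal hD hK r0); apply: max_ideal_div => //.
- exact/(pos_max_ideal hD hK r0).
- exact/(pos_max_ideal hD hK r0).
- by apply: (subM sVr); [exact: (over_nneg hD hK r0 rp)|inring sVr].
Qed.

Lemma ring_at1_frac p q : coefs_in D p -> coefs_in D q -> unit_of D q.[1] -> ring_at1 (p.[th] / q.[th]).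
Proof. by move=> op oq uq; exists p, q; split=> //; rewrite subrr; exact: (pos0 hD r0). Qed.

Lemma ring_at1_nneg : ring_at1 `<=` nneg r.
Proof.
move=> z [p [q [op oq uq pz]]].
have [_ _ Vqi] := regular_unit hD hK r0 rp oq (unit_at1_regular oq uq).
have Vp := over_nneg hD hK r0 rp op.
rewrite -(subrK (p.[th] / q.[th]) z); apply: (subD sVr); first exact: pos_nneg.
exact: (subM sVr).
Qed.

Lemma ring_at1_valuation : is_valuation_ring ring_at1.
Proof.
split.
  apply/subringE; split.
  - rewrite -[1]divr1; have := @ring_at1_frac 1%:P 1%:P; rewrite !hornerC; apply.
    + exact: overC. + exact: overC. + exact: unit_of1.
  - move=> c d [p [q [op oq uq pc]]] [p' [q' [op' oq' uq' pd]]].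
    have [_ q0 _] := regular_unit hD hK r0 rp oq (unit_at1_regular oq uq).
    have [_ q'0 _] := regular_unit hD hK r0 rp oq' (unit_at1_regular oq' uq').
    exists (p * q' - p' * q), (q * q'); split.
    + by apply: overD => //; [exact: overM|apply: overN => //; exact: overM].
    + exact: overM.
    + by rewrite hornerM; exact: unit_ofM.
    + rewrite !(hornerD, hornerN, hornerM).
      rewrite (_ : _ - _ = (c - p.[th] / q.[th]) - (d - p'.[th] / q'.[th])).
        exact: (posB hD hK r0).
      by field; rewrite q0 q'0.
  - move=> c d; move=> [p [q [op oq uq pc]]] [p' [q' [op' oq' uq' pd]]].
    have [_ q0 Vqi] := regular_unit hD hK r0 rp oq (unit_at1_regular oq uq).
    have [_ q'0 Vqi'] := regular_unit hD hK r0 rp oq' (unit_at1_regular oq' uq').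
    have Vd : nneg r d by apply: ring_at1_nneg; exists p', q'.
    exists (p * p'), (q * q'); split; [exact: overM|exact: overM|by rewrite hornerM; exact: unit_ofM|].
    rewrite !hornerM (_ : _ - _ = d * (c - p.[th] / q.[th]) + p.[th] / q.[th] * (d - p'.[th] / q'.[th])).
      have Vp := over_nneg hD hK r0 rp op.
      apply: (posD hD hK r0); first exact: (posM hD hK r0).
      by apply: (posM hD hK r0) => //; exact: (subM sVr).
    by field; rewrite q0 q'0.
have in_pos z : ps r z -> ring_at1 z.
  move=> pz; exists 0%:P, 1%:P; split.
  - by apply: (overC sD); exact: sub0.
  - exact: overC.
  - by rewrite hornerC; exact: unit_of1.
  - by rewrite !hornerC mul0r subr0.
have main z : nneg r z -> ring_at1 z \/ ring_at1 z^-1.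
  move=> nz; have [pz|pz] := pselect (ps r z); first by left; exact: in_pos.
  have [p [q [op oq rp' rq pz1]]] := residue_fraction hD hK r0 rp nz pz.
  have [p' [q' [op' oq' u [rp2 rq2] pq]]] := residue_regular_at1 op oq rp' rq.
  have pz' : ps r (z - p'.[th] / q'.[th]).
    by rewrite -(subrK (p.[th] / q.[th]) z) -addrA; exact: (posD hD hK r0).
  case: u => u; last by left; exists p', q'.
  right; exists q', p'; split=> //.
  have up := regular_unit hD hK r0 rp op' rp2; have uq := regular_unit hD hK r0 rp oq' rq2.
  have := @max_ideal_div _ Vr 1 z 1 (p'.[th] / q'.[th]).
  rewrite !div1r invf_div => h; apply/(pos_max_ideal hD hK r0); apply: h.
  - by rewrite subrr; apply/(pos_max_ideal hD hK r0); exact: (pos0 hD r0).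
  - exact/(pos_max_ideal hD hK r0).
  - exact: sub1.
  - by apply: unit_ofM => //; exact: unit_ofV.
move=> z z0; have [/main//|/main] := val_total Vr z.
by rewrite invrK => -[]; [right|left].
Qed.

Definition val_at1 : valRing K := ValRing ring_at1_valuation.

Lemma val_at1P : [/\ D `<=` ring_at1, ring_at1 <> nneg r, ring_at1 th & ring_at1 th^-1].
Proof.
have oX : coefs_in D 'X by rewrite -['X]expr1; exact: overX.
have o1 : coefs_in D 1%:P by exact: overC.
have u1 : unit_of D 1 by exact: unit_of1.
have Vth := th_nneg hD hK r0 rp.
split.
- move=> c Dc; have := @ring_at1_frac c%:P 1%:P; rewrite !hornerC divr1; apply=> //.
  exact: overC.
- have oX1 : coefs_in D ('X - 1%:P) by apply: overD => //; exact: overN.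
  have mX : ('X - 1%:P : {poly K}) \is monic by exact: monicXsubC.
  have [_ t0 Vt] := regular_unit hD hK r0 rp oX1 (monic_regular hD hK r0 rp oX1 mX).
  move=> e; have [p [q [op oq uq pz]]] : ring_at1 ('X - 1%:P).[th]^-1 by rewrite e.
  have os : coefs_in D (q - p * ('X - 1%:P)).
    by apply: overD => //; apply: overN => //; exact: overM.
  apply: (unit_at1_regular os); first by rewrite !hornerE subrr mulr0 subr0.
  have [Vq q0 _] := regular_unit hD hK r0 rp oq (unit_at1_regular oq uq).
  rewrite !(hornerD, hornerN, hornerM) -hornerN -hornerD.
  rewrite (_ : _ - _ = q.[th] * ('X - 1%:P).[th] * (('X - 1%:P).[th]^-1 - p.[th] / q.[th])).
    apply: (posM hD hK r0) => //; apply: (subM sVr) => //.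
    by rewrite !hornerE; inring sVr.
  by field; rewrite t0 q0.
- by have := @ring_at1_frac 'X 1%:P; rewrite hornerX !hornerC divr1; apply.
- by have := @ring_at1_frac 1%:P 'X; rewrite !hornerX !hornerC div1r; apply.
Qed.

End RankTwo.

(** * Limits in the patch topology *)

Section Patch.
Variable K : fieldType.

Lemma patch_nbhs (V : valRing K) (U : set (valRing K)) : nbhs V U ->
  exists FG, patch_basic FG V /\ patch_basic FG `<=` U.
Proof.
rewrite nbhsE => -[B [oB BV] BU]; move: oB; case=> I _ BE.
move: BV; rewrite -BE => -[FG IFG FGV]; exists FG; split=> // W FGW.
by apply: BU; rewrite -BE; exists FG.
Qed.

Lemma patch_basic_nbhs (V : valRing K) FG : patch_basic FG V -> nbhs V (patch_basic FG).
Proof.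
move=> FGV; apply: open_nbhs_nbhs; split=> //.
by exists [set FG] => //; rewrite bigcup_set1.
Qed.

Lemma limit_point_contains (X : set (valRing K)) V z : limit_point X V ->
  (forall W, X W -> carrier W z) -> carrier V z.
Proof.
move=> lV Xz; apply: contrapT => nVz; have mz := max_ideal_inv nVz.
have z0 : z != 0 by apply/eqP => z0; apply: nVz; rewrite z0; exact: sub0 (carrierP V).1.
have [|W [_ XW [_ Wz]]] := lV (patch_basic (fset0, [fset z^-1]%fset)).
  apply: patch_basic_nbhs; split=> w /=; first by rewrite in_fset0.
  by rewrite in_fset1 => /eqP ->.
have : max_ideal_of W z^-1 by apply: Wz; rewrite /= in_fset1.
by move/max_idealE; rewrite invrK => -[/eqP|/(_ (Xz _ XW))//]; rewrite invr_eq0 (negbTE z0).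
Qed.

End Patch.

(** * Rings of elements of nonnegative value near a weight *)

Section NearRing.
Variables (R : realType) (K : fieldType) (D : set K) (x y : K).
Hypothesis hD : regular_local_with_parameters D [:: x; y].
Hypothesis hK : quotient_field_of D.
Let ps := @pos R K D x y.
Let nneg := @monomial_val_set R K D x y.

(** For near_right r and near_left r these are W_plus and W_minus. *)
Definition near_ring (F : set_system R) : set K :=
  [set h | F [set s | (0 <= monomial_val D x y s h)%E]].

Variable F : set_system R.
Hypotheses (FF : ProperFilter F) (dF : decides_weights F) (F0 : F [set s | 0 < s]).

Lemma near_ring_pos z : F [set s | ps s z] -> near_ring F z.
Proof. by apply: filterS => s; exact: pos_nneg. Qed.

Lemma near_ring_subring : subring (near_ring F).
Proof.
apply/subringE; split.
- by apply: filterS F0 => s s0; exact: sub1 (nneg_subring hD hK s0).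
- move=> c d Fc Fd; apply: filterS3 F0 Fc Fd => s s0; exact: (subB (nneg_subring hD hK s0)).
- move=> c d Fc Fd; apply: filterS3 F0 Fc Fd => s s0; exact: (subM (nneg_subring hD hK s0)).
Qed.

Lemma near_ring_sub : D `<=` near_ring F.
Proof. by move=> c Dc; apply: filterS F0 => s s0; exact: (sub_nneg hD hK s0). Qed.

Lemma near_ring_valuation : is_valuation_ring (near_ring F).
Proof.
split=> [|z z0]; first exact: near_ring_subring.
have [pz|pz|[u [Du _ _] pz]] := mval_trichotomy hD hK FF dF F0 z0.
- by left; exact: near_ring_pos.
- by right; exact: near_ring_pos.
left; rewrite -(subrK u z); apply: (subD near_ring_subring); first exact: near_ring_pos.
exact: near_ring_sub.
Qed.

Lemma near_ring_not_pos z : z != 0 -> near_ring F z -> ~ F [set s | ps s z^-1].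
Proof.
move=> z0 nz pz; have [s [[s0 nz'] pz']] := filter_ex (filterI (filterI F0 nz) pz).
have zi0 : z^-1 != 0 by rewrite invr_eq0.
by apply: (pos_inv_not hD hK s0 zi0 pz'); rewrite invrK.
Qed.

(** An element of the ring is in D up to an element of positive value near the
filter, so it lies in every valuation ring below a V_s with s close enough. *)
Lemma near_ring_below z : near_ring F z -> F [set s | forall W : valRing K,
  D `<=` carrier W -> carrier W `<=` nneg s -> carrier W z].
Proof.
have [->|z0] := eqVneq z 0.
  by move=> _; apply: filterS filterT => s _ W _ _; exact: sub0 (carrierP W).1.
move=> nz; have [pz|/(near_ring_not_pos z0 nz)//|[u [Du _ _] pz]] :=
  mval_trichotomy hD hK FF dF F0 z0.
  by apply: filterS2 F0 pz => s s0 pz W DW Ws; exact: (pos_in hD hK s0 Ws).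
apply: filterS2 F0 pz => s s0 pz W DW Ws; rewrite -(subrK u z).
apply: (subD (carrierP W).1); first exact: (pos_in hD hK s0 Ws).
exact: DW.
Qed.

Lemma near_ring_max z (V : valRing K) : carrier V = near_ring F ->
  max_ideal_of V z -> F [set s | forall W : valRing K,
    carrier W `<=` nneg s -> max_ideal_of W z].
Proof.
move=> VF; have [->|z0] := eqVneq z 0.
  by move=> _; apply: filterS filterT => s _ W _; apply/max_idealE; left.
move=> mz; have : F [set s | ps s z].
  have [//|pz|[u uu pz]] := mval_trichotomy hD hK FF dF F0 z0.
    have [Vz _] := mz; rewrite VF in Vz.
    by case: (near_ring_not_pos z0 Vz).
  have [Du u0 Dv] := uu; exfalso; apply: (unit_not_max (V := V) (z := u)).
    by split=> //; rewrite VF; exact: near_ring_sub.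
  rewrite -(subKr z u); apply: max_idealB => //.
  apply: contrapT => nm; have Vzu : carrier V (z - u) by rewrite VF; exact: near_ring_pos.
  have [_ zu0 Vi] := val_unit Vzu nm.
  rewrite VF in Vi; apply: near_ring_not_pos Vi _; first by rewrite invr_eq0.
  by rewrite invrK.
by apply: filterS2 F0 => s s0 pz W Ws; exact: (pos_max hD hK s0 Ws).
Qed.

Lemma near_ring_limit (X : set (valRing K)) (V : valRing K) : carrier V = near_ring F ->
  (forall A, F A -> exists s W, [/\ A s, X W, W != V, D `<=` carrier W & carrier W `<=` nneg s]) ->
  limit_point X V.
Proof.
move=> VF hX U /patch_nbhs[FG [[V1 V2] FGU]].
have F1 := near_seq (s := enum_fset FG.1) (P := fun z s => forall W : valRing K,
   D `<=` carrier W -> carrier W `<=` nneg s -> carrier W z) FF.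
have F2 := near_seq (s := enum_fset FG.2) (P := fun z s => forall W : valRing K,
   carrier W `<=` nneg s -> max_ideal_of W z) FF.
have [||s [W [[h1 h2] XW WV DW Ws]]] := hX _ (filterI (F1 _) (F2 _)).
- by move=> z zF; apply: near_ring_below; rewrite -VF; exact: V1.
- by move=> z zF; apply: (near_ring_max VF); exact: V2.
exists W; split=> //; apply: FGU; split=> z zF; [exact: h1|exact: h2].
Qed.

Lemma near_ring_sub_nneg r : 0 < r -> near_at r `<=` F -> near_ring F `<=` nneg r.
Proof.
move=> r0 nF z nz; apply: contrapT => npz.
have z0 : z != 0 by apply/eqP => z0; apply: npz; rewrite z0; exact: (nneg0 hD r0).
have := pos_near hD hK r0 (pos_inv hD hK r0 npz) => /nF pz.
by apply: (near_ring_not_pos z0 nz); apply: filterS2 F0 pz => s s0; apply.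
Qed.

Definition near_val : valRing K := ValRing near_ring_valuation.

Lemma near_ring_max_pos z : F [set s | ps s z] -> max_ideal_of near_val z.
Proof.
move=> pz; apply/max_idealE; have [->|z0] := eqVneq z 0; [by left|right].
have zi0 : z^-1 != 0 by rewrite invr_eq0.
by move=> nz; apply: (near_ring_not_pos zi0 nz); rewrite invrK.
Qed.

End NearRing.

(** * External valuation rings *)

Section External.
Variables (R : realType) (K : fieldType) (D : set K) (x y : K).
Hypothesis hD : regular_local_with_parameters D [:: x; y].
Hypothesis hK : quotient_field_of D.
Variables a b : R.
Hypotheses (a0 : 0 < a) (ab : a < b).
Let sD := rlr_subring hD.
Let mon := monomial x y.
Let mon0 := monomial_neq0 hD.
Let w := @mval R K D x y.
Let ps := @pos R K D x y.
Let nneg := @monomial_val_set R K D x y.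
Let T := interval_ring D x y [set r : R | a <= r <= b].
Let X := external_rank2 D x y a b.

Let interval_gt0 s : a <= s <= b -> 0 < s.
Proof. by case/andP => + _; exact: lt_le_trans. Qed.

Let right_gt0 (s : R) : 0 < s -> near_right s [set s | 0 < s].
Proof. by move=> s0; apply: near_at_right; exact: near_at_gt0. Qed.
Let left_gt0 (s : R) : 0 < s -> near_left s [set s | 0 < s].
Proof. by move=> s0; apply: near_at_left; exact: near_at_gt0. Qed.

Lemma internal_cases (V : valRing K) : internal_rank2 D x y a b V <->
  exists q : rat, let r := ratr q : R in
    (a <= r < b /\ carrier V = near_ring D x y (near_right r)) \/
    (a < r <= b /\ carrier V = near_ring D x y (near_left r)).
Proof.
split=> [[q [[/andP[aq qb] [VW|VW]]|[qa VW]|[qb VW]]]|[q /= [[/andP[]]|[/andP[]]]]].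
- by exists q; left; rewrite (ltW aq) qb.
- by exists q; right; rewrite aq (ltW qb).
- by exists q; left; rewrite qa lexx ab.
- by exists q; right; rewrite qb lexx ab.
- rewrite le_eqVlt => /orP[/eqP qa|aq] qb VW; exists q.
    by apply: Or32; rewrite qa.
  by apply: Or31; rewrite aq qb; split=> //; left.
- move=> aq; rewrite le_eqVlt => /orP[/eqP qb|qb] VW; exists q.
    by apply: Or33; rewrite -qb.
  by apply: Or31; rewrite aq qb; split=> //; right.
Qed.

Let par (i j : nat) : K := mon (i, 0)%N / mon (0, j)%N.

Lemma par_mval i j (s : R) : 0 < s -> w s (par i j) = i%:R - s * j%:R.
Proof.
move=> s0; rewrite /w /par (mval_fracE hD s0)//; try exact: monomial_in.
by rewrite !(mval_monomial hD s0) /weight /=; ring.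
Qed.
Lemma par_neq0 i j : par i j != 0.
Proof. by rewrite mulf_neq0 ?invr_eq0 ?(mon0 _). Qed.
Lemma par_pos i j (s : R) : 0 < s -> s * j%:R < i%:R -> ps s (par i j).
Proof.
by move=> s0 lt; apply/(posE hD hK s0); [exact: par_neq0|rewrite -/w par_mval// subr_gt0].
Qed.
Lemma par_inv_pos i j (s : R) : 0 < s -> i%:R < s * j%:R -> ps s (par i j)^-1.
Proof.
move=> s0 lt; apply/(posE hD hK s0); first by rewrite invr_eq0 par_neq0.
by rewrite (mvalV hD hK s0) ?par_neq0// -/w par_mval// opprB subr_gt0.
Qed.

(** For s = i / j, W_s^+ omits x^i / y^j and W_s^- omits its inverse, and no other
internal ring lies below V_s. *)
Lemma not_internal (V : valRing K) i j : (0 < j)%N -> a <= i%:R / j%:R <= b ->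
  carrier V `<=` nneg (i%:R / j%:R) -> carrier V (par i j) -> carrier V (par i j)^-1 ->
  ~ internal_rank2 D x y a b V.
Proof.
set s := _ / _ => j0 sI Vs Vp Vpi /internal_cases[q /= qV].
have s0 := interval_gt0 sI.
have jr0 : 0 < j%:R :> R by rewrite ltr0n.
have sj : s * j%:R = i%:R by rewrite /s divfK// gt_eqF.
have hp := par_neq0 i j; have hpi : (par i j)^-1 != 0 by rewrite invr_eq0.
have q0 : 0 < ratr q :> R.
  by case: qV => -[/andP[h1 h2] _]; [exact: lt_le_trans h1|exact: lt_trans h1].
case: qV => -[_ VF].
  have FF := near_right_filter (ratr q : R).
  have Vq : carrier V `<=` nneg (ratr q).
    rewrite VF; apply: (near_ring_sub_nneg hD hK FF (right_gt0 q0) q0).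
    exact: near_at_right.
  have qs := below_unique hD hK s0 q0 Vs Vq.
  rewrite VF in Vp; apply: (near_ring_not_pos hD hK FF (right_gt0 q0) hp Vp).
  rewrite -qs; exists 1 => // t /andP[st _]; apply: par_inv_pos; first exact: lt_trans st.
  by rewrite -sj ltr_pM2r.
have FF := near_left_filter (ratr q : R).
have Vq : carrier V `<=` nneg (ratr q).
  rewrite VF; apply: (near_ring_sub_nneg hD hK FF (left_gt0 q0) q0).
  exact: near_at_left.
have qs := below_unique hD hK s0 q0 Vs Vq.
rewrite VF in Vpi; apply: (near_ring_not_pos hD hK FF (left_gt0 q0) hpi Vpi).
rewrite invrK -qs; exists s => // t /andP[]; rewrite subrr => t0 ts.
by apply: par_pos => //; rewrite -sj ltr_pM2r.
Qed.

Lemma external_exists i j : (0 < i)%N -> (0 < j)%N -> coprime i j ->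
  a <= i%:R / j%:R <= b -> exists W, [/\ X W, D `<=` carrier W & carrier W `<=` nneg (i%:R / j%:R)].
Proof.
move=> i0 j0 cij sI; have s0 := interval_gt0 sI.
have rp := rational_residue_parameter R hD i0 j0 cij.
have [DW nW Wt Wti] := val_at1P hD hK s0 rp.
have Ws : carrier (val_at1 hD hK s0 rp) `<=` nneg (i%:R / j%:R) by exact: ring_at1_nneg.
exists (val_at1 hD hK s0 rp); split=> //; split.
- exact: (rank2_below hD hK s0 rp).
- by exists (i%:R / j%:R).
- exact: (not_internal j0 sI).
Qed.

Lemma external_between c d : a <= c -> c < d -> d <= b -> exists s W,
  [/\ c < s < d, X W, D `<=` carrier W & carrier W `<=` nneg s].
Proof.
move=> ac cd db; have c0 : 0 <= c by apply: ltW; exact: lt_le_trans ac.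
have [i [j [i0 j0 cij sI]]] := rat_between c0 cd; case/andP: (sI) => l1 l2.
have [|W [XW DW Ws]] := external_exists i0 j0 cij.
  by rewrite (le_trans ac (ltW l1)) (le_trans (ltW l2)).
by exists (i%:R / j%:R), W.
Qed.

Lemma internal_limit (V : valRing K) : internal_rank2 D x y a b V -> limit_point X V.
Proof.
move=> Vi; have neq W : X W -> W != V by move=> [_ _ nW]; apply/eqP => WV; apply: nW; rewrite WV.
have /internal_cases[q /= [[/andP[aq qb] VF]|[/andP[aq qb] VF]]] := Vi.
  have q0 : 0 < ratr q :> R by exact: lt_le_trans aq.
  apply: (near_ring_limit hD hK (near_right_filter _) (near_right_decides _) (right_gt0 q0) VF).
  move=> A [d d0 Ad]; have [|||s [W [/andP[l1 l2] XW DW Ws]]] := @external_between (ratr q) (Num.min (ratr q + d) b).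
  - exact: aq.
  - by rewrite lt_min qb andbT ltrDl.
  - by rewrite ge_min lexx orbT.
  exists s, W; split=> //; last exact: neq.
  by apply: Ad; rewrite l1; move: l2; rewrite lt_min => /andP[].
have q0 : 0 < ratr q :> R by exact: lt_trans aq.
apply: (near_ring_limit hD hK (near_left_filter _) (near_left_decides _) (left_gt0 q0) VF).
move=> A [d d0 Ad]; have [|||s [W [/andP[l1 l2] XW DW Ws]]] := @external_between (Num.max (ratr q - d) a) (ratr q).
- by rewrite le_max lexx orbT.
- by rewrite gt_max aq andbT gtrBl.
- exact: qb.
exists s, W; split=> //; last exact: neq.
by apply: Ad; rewrite l2 andbT; move: l1; rewrite gt_max => /andP[].
Qed.

Section Irrational.
Variables (r : R) (V : valRing K).
Hypotheses (rI : a <= r <= b) (irr : forall q : rat, ratr q != r).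
Hypotheses (DV : D `<=` carrier V) (Vr : carrier V `<=` nneg r).

Let r0 : 0 < r := interval_gt0 rI.
Let FF := near_at_filter r.

Lemma irrational_near_ring : nneg r = near_ring D x y (near_at r).
Proof.
apply/seteqP; split=> z; last first.
  by apply: (near_ring_sub_nneg hD hK FF (near_at_gt0 r0) r0).
move=> nz; have [->|z0] := eqVneq z 0; first exact: (sub0 (near_ring_subring hD hK FF (near_at_gt0 r0))).
have self A : near_at r A -> A r by move=> [d d0 h]; apply: h; lra.
have [pz|/self pz|[u [Du _ _] pz]] := mval_trichotomy hD hK FF (near_at_decides irr) (near_at_gt0 r0) z0.
- exact: near_ring_pos.
- exfalso; have zi0 : z^-1 != 0 by rewrite invr_eq0.
  by apply: (pos_inv_not hD hK r0 zi0 pz); rewrite invrK.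
rewrite -(subrK u z); apply: (subD (near_ring_subring hD hK FF (near_at_gt0 r0))).
  exact: near_ring_pos.
exact: (near_ring_sub hD hK FF (near_at_gt0 r0)).
Qed.

Lemma irrational_eq : carrier V = nneg r.
Proof.
apply/seteqP; split=> // z; rewrite irrational_near_ring => nz.
have [d d0 h] := near_ring_below hD hK FF (near_at_decides irr) (near_at_gt0 r0) nz.
have rd : r - d < r < r + d by lra.
exact: (h r rd V DV Vr).
Qed.

Lemma irrational_limit : limit_point X V.
Proof.
have VF : carrier V = near_ring D x y (near_at r) by rewrite irrational_eq irrational_near_ring.
apply: (near_ring_limit hD hK FF (near_at_decides irr) (near_at_gt0 r0) VF).
have neq W s : 0 < s -> s != r -> carrier W `<=` nneg s -> W != V.
  move=> s0 sr Ws; apply: contra sr => /eqP WV; apply/eqP.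
  by apply: (below_unique hD hK s0 r0 Ws); rewrite WV.
case/andP: rI => ar rb; move=> A [d d0 Ad].
have [lt|ge] := ltP r b.
  have [|||s [W [/andP[l1 l2] XW DW Ws]]] := @external_between r (Num.min (r + d) b) => //.
  - by rewrite lt_min lt andbT ltrDl.
  - by rewrite ge_min lexx orbT.
  exists s, W; split=> //.
    by apply: Ad; move: l2; rewrite lt_min => /andP[l2 _]; rewrite l2 andbT; lra.
  by apply: neq Ws; [exact: lt_trans l1|rewrite gt_eqF].
have [|||s [W [/andP[l1 l2] XW DW Ws]]] := @external_between (Num.max (r - d) a) r => //.
- by rewrite le_max lexx orbT.
- by rewrite gt_max gtrBl d0 (lt_le_trans ab ge).
move: l1; rewrite gt_max => /andP[l1 l3].
exists s, W; split=> //.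
  by apply: Ad; rewrite l1 /=; lra.
by apply: neq Ws; [exact: lt_trans l3|rewrite lt_eqF].
Qed.

End Irrational.

Lemma rational_case (r : R) : 0 < r -> ~ (forall q : rat, ratr q != r) -> exists i j : nat,
  [/\ (0 < i)%N, (0 < j)%N, coprime i j & r = i%:R / j%:R].
Proof.
move=> r0 nirr; have [q qr] : exists q : rat, ratr q = r.
  apply: contrapT => nq; apply: nirr => q; apply/eqP => qr; apply: nq; by exists q.
by have [|i [j [i0 j0 cij qE]]] := @pos_ratP R q; [rewrite qr|exists i, j; split=> //; rewrite -qr].
Qed.

(** Below a rational weight, V itself is external or internal unless V = V_r. *)
Lemma below_contains_external (V : valRing K) (r : R) : a <= r <= b ->
  D `<=` carrier V -> carrier V `<=` nneg r ->
  exists2 W, X W \/ limit_point X W & carrier W `<=` carrier V.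
Proof.
move=> rI DV Vr; have r0 := interval_gt0 rI.
have [irr|nirr] := pselect (forall q : rat, ratr q != r).
  by exists V => //; right; exact: irrational_limit rI irr DV Vr.
have [i [j [i0 j0 cij rE]]] := rational_case r0 nirr.
have [Ve|Vne] := pselect (carrier V = nneg r).
  have [|W [XW DW Wr]] := external_exists i0 j0 cij; first by rewrite -rE.
  by exists W; [left|rewrite Ve rE].
exists V => //; have [Vi|nVi] := pselect (internal_rank2 D x y a b V).
  by right; exact: internal_limit.
left; split=> //; last by exists r.
have rp : residue_parameter x y r (i, 0)%N (0, j)%N.
  by rewrite rE; exact: (rational_residue_parameter R hD).
have [Vp|Vp] := val_total V (par i j); first exact: (rank2_below hD hK r0 rp).
apply: (rank2_below hD hK r0 (residue_parameter_swap hD rp)) => //.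
by move: Vp; rewrite /par invf_div.
Qed.

Lemma overring_contains_external (V : valRing K) : T `<=` carrier V ->
  exists2 W, X W \/ limit_point X W & carrier W `<=` carrier V.
Proof.
move=> TV; have [VT|[r rI Vr]] := overring_below hD hK a0 TV.
  have [||| s [W [_ XW _ _]]] := @external_between a b => //.
  by exists W; [left|rewrite VT].
apply: below_contains_external rI _ Vr.
by apply: subset_trans TV; exact: interval_ring_sub.
Qed.

Lemma external_defining : defining_family T X.
Proof.
have XT V : X V -> T `<=` carrier V.
  by move=> [_ [r rI DVr] _] z Tz; apply: Tz; exists r.
split=> //; apply/seteqP; split=> z.
  by move=> Tz V XV; exact: XT.
move=> Xz V [r rI [DV Vr]].
have [W [XW|lW]] := below_contains_external rI DV Vr; apply; first exact: Xz.
by apply: limit_point_contains lW _ => U XU; exact: Xz.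
Qed.

(** As z is not in T, a member of the family omits z, and this member is V. *)
Lemma separated_in_defining (V : valRing K) z (Y : set (valRing K)) : X V -> ~ carrier V z ->
  (forall W, T `<=` carrier W -> ~ carrier W z -> W = V) -> defining_family T Y -> Y V.
Proof.
move=> XV nVz hz [YT TE]; have [XT _] := external_defining.
have nTz : ~ T z by move/(XT _ XV).
apply: contrapT => nYV; apply: nTz; rewrite TE => W YW; apply: contrapT => nWz.
by apply: nYV; rewrite -(hz W)//; exact: YT.
Qed.

(** At the weights other than r, positivity of z suffices. *)
Lemma separating (V : valRing K) r z : a <= r <= b ->
  (forall s, a <= s <= b -> s != r -> ps s z) ->
  (forall W : valRing K, D `<=` carrier W -> carrier W `<=` nneg r -> ~ carrier W z -> W = V) ->
  forall W, T `<=` carrier W -> ~ carrier W z -> W = V.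
Proof.
move=> rI hs hW W TW nWz.
have [WT|[s sI Ws]] := overring_below hD hK a0 TW.
  by case: nWz; rewrite WT.
have s0 := interval_gt0 sI.
have [sr|sr] := eqVneq s r; last by case: nWz; apply: (pos_in hD hK s0 Ws); exact: hs.
apply: hW => //; last by rewrite -sr.
by apply: subset_trans TW; exact: interval_ring_sub.
Qed.

Section Separation.
Variables (r : R) (e1 e2 : nat * nat) (V : valRing K).
Hypothesis rI : a <= r <= b.
Hypothesis rp : residue_parameter x y r e1 e2.
Hypotheses (DV : D `<=` carrier V) (Vr : carrier V `<=` nneg r).
Let r0 : 0 < r := interval_gt0 rI.
Let th := mon e1 / mon e2.
Let th0 : th != 0. Proof. by rewrite mulf_neq0 ?invr_eq0 ?(mon0 _). Qed.

Lemma max_theta_unique (W : valRing K) : max_ideal_of V th -> D `<=` carrier W ->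
  carrier W `<=` nneg r -> max_ideal_of W th -> W = V.
Proof.
move=> mV DW Wr mW; apply: (lies_over_unique hD hK r0 rp (minimal_X hD hK r0 DV mV)).
  by split=> //; [case: mV|rewrite hornerX].
by split=> //; [case: mW|rewrite hornerX].
Qed.

(** The ring of the filter and V both lie over the polynomial X. *)
Lemma max_theta_near F : ProperFilter F -> decides_weights F -> F [set s | 0 < s] ->
  near_at r `<=` F -> F [set s | ps s th] -> max_ideal_of V th -> carrier V = near_ring D x y F.
Proof.
move=> FF dF F0 rF Fth mV.
rewrite -(max_theta_unique mV (W := near_val hD hK FF dF F0))//.
- exact: near_ring_sub.
- exact: near_ring_sub_nneg.
- exact: near_ring_max_pos.
Qed.

Lemma separating_max : max_ideal_of V th -> (forall s, a <= s <= b -> s != r -> ps s th^-1) ->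
  ~ carrier V th^-1 /\ forall W, T `<=` carrier W -> ~ carrier W th^-1 -> W = V.
Proof.
move=> mV hs; split; first by move/max_idealE: mV => [/eqP|//]; rewrite (negbTE th0).
apply: (separating rI hs) => W DW Wr nW; apply: max_theta_unique => //.
by apply/max_idealE; right.
Qed.

(** The separating element is theta^d / q(theta)^2, with q the minimal polynomial
of V, of degree d. Its residue t^d / q(t)^2 has no pole at 0 and infinity, because
q(0) is a unit and q is monic. At the weights other than r, the first and the last
term of q(theta) have different values, and the value of q(theta) is at most
both of them. *)
Lemma separating_unit : carrier V <> nneg r -> carrier V th -> carrier V th^-1 ->
  (forall s, s != r -> weight s e1 != weight s e2) ->
  exists z, ~ carrier V z /\ forall W, T `<=` carrier W -> ~ carrier W z -> W = V.
Proof.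
move=> Vne Vth Vthi hw.
have [q mq lq] := exists_minimal hD hK r0 rp DV Vr Vne Vth.
have uq0 := minimal_const_unit hD hK r0 rp mq lq Vthi.
have [oq mo mqth _] := mq; have s1 := minimal_size mq.
pose d := (size q).-1; have sE : size q = d.+1 by rewrite /d prednK// ltnW.
have d0 : (0 < d)%N by rewrite -ltnS -sE.
have [_ qth0 _] := regular_unit hD hK r0 rp oq (monic_regular hD hK r0 rp oq mo).
pose z := th ^+ d / q.[th] ^+ 2.
have z0 : z != 0 by rewrite mulf_neq0 ?invr_eq0 ?expf_neq0.
have ziE : z^-1 = th^-1 ^+ d * q.[th] ^+ 2 by rewrite /z invf_div exprVn mulrC.
have sV := (carrierP V).1.
have nVz : ~ carrier V z.
  have mz : max_ideal_of V z^-1.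
    by rewrite ziE; apply: max_idealM; [inring sV|exact: max_idealX].
  by move/max_idealE: mz; rewrite invrK => -[/eqP|//]; rewrite invr_eq0 (negbTE z0).
exists z; split=> //; apply: (separating rI).
  move=> s sI sr; have s0 := interval_gt0 sI.
  pose f := \sum_(k < d.+1) q`_k * mon (comb_exp e1 e2 d k).
  have mE k : (k <= d)%N -> mon (comb_exp e1 e2 d k) = mon e1 ^+ k * mon e2 ^+ (d - k).
    by move=> _; rewrite -!monomialX /mon -monomialM.
  have fE : f = q.[th] * mon e2 ^+ d.
    rewrite (@horner_coef_wide _ d.+1) ?sE// mulr_suml; apply: eq_bigr => -[k kd] _ /=.
    rewrite mE // -mulrA; congr (_ * _).
    have -> : mon e2 ^+ d = mon e2 ^+ k * mon e2 ^+ (d - k) by rewrite -exprD subnKC.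
    by rewrite mulrA -exprMn divfK// (mon0 _).
  have Df : D f.
    apply: (sub_sum sD) => k _; have Dm := monomial_in hD (comb_exp e1 e2 d k).
    by have := oq k => ?; inring sD.
  have f0 : f != 0 by rewrite fE mulf_neq0 ?expf_neq0 ?(mon0 _).
  have [_ inc _] := rp.
  have fle k : (k <= d)%N -> unit_of D q`_k -> w s f <= weight s (comb_exp e1 e2 d k).
    rewrite -ltnS => kd uk; rewrite leNgt; apply/negP => /(weight_gt_mval hD s0 _ Df f0).
    rewrite /f (bigD1 (Ordinal kd))//=; apply: (leading_not_gt hD s0 uk).
    apply: (big_ind (mono_ideal D x y _)) => [||[k' k'd]]; first exact: mono_ideal0.
      by move=> ? ?; exact: mono_idealD.
    by rewrite -val_eqE /= => kk'; apply: mono_ideal1 => //; apply: inc.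
  have f1 : w s f <= d%:R * weight s e1.
    rewrite (le_trans (fle d _ _))//.
      by move/monicP: mo; rewrite lead_coefE => ->; exact: unit_of1.
    by rewrite /weight /comb_exp /= subnn !mul0n !addn0 !natrM; lra.
  have f2 : w s f <= d%:R * weight s e2.
    rewrite (le_trans (fle 0%N _ _))//.
    by rewrite /weight /comb_exp /= subn0 !mul0n !add0n !natrM; lra.
  have zE : z = (mon e1 ^+ d * mon e2 ^+ d) / f ^+ 2.
    rewrite /z fE /th expr_div_n; field.
    by rewrite qth0 !expf_neq0 ?(mon0 _).
  have m1 := mon0 e1; have m2 := mon0 e2.
  apply/(posE hD hK s0) => //; rewrite zE (mvalM hD hK s0) ?mulf_neq0 ?invr_eq0 ?expf_neq0//.
  rewrite (mvalV hD hK s0) ?expf_neq0// (mvalM hD hK s0) ?expf_neq0// !(mvalX hD hK s0)//.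
  rewrite !(mval_monomial hD s0) -/w.
  have : d%:R * weight s e1 != d%:R * weight s e2.
    by apply: contra (hw _ sr) => /eqP/mulfI; rewrite pnatr_eq0 -lt0n => /(_ d0) ->.
  by rewrite neq_lt => /orP[]; lra.
move=> W DW Wr nWz; have sW := (carrierP W).1.
apply: (lies_over_unique hD hK r0 rp mq lq).
have mz := max_ideal_inv nWz; rewrite ziE in mz.
have Wth : carrier W th.
  apply: contrapT => nth; have mth := max_ideal_inv nth; have [Wthi _] := mth.
  (* q(theta) / theta^d is 1 up to multiples of 1 / theta *)
  have uq : unit_of (carrier W) (q.[th] * th^-1 ^+ d).
    rewrite (@horner_coef_wide _ d.+1) ?sE// big_ord_recr /= mulrDl.
    have -> : q`_d = 1 by move/monicP: mo; rewrite lead_coefE.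
    rewrite mul1r -exprMn mulfV// expr1n addrC; apply: unitDmax; first exact: unit_of1.
    rewrite mulr_suml; apply: (big_ind (max_ideal_of W)) => [||[k kd] _ /=].
    - by apply/max_idealE; left.
    - exact: max_idealD.
    rewrite -mulrA; apply: max_idealM; first by apply: DW; exact: oq.
    have -> : th ^+ k * th^-1 ^+ d = th^-1 ^+ (d - k.+1).+1.
      rewrite -subSn// subSS -{1}(subnKC (ltnW kd)) exprD mulrA -exprMn mulfV//.
      by rewrite expr1n mul1r.
    exact: max_idealX.
  have [Wq _ _] := uq.
  apply: (unit_not_max (unit_ofM sW uq uq)).
  have -> : q.[th] * th^-1 ^+ d * (q.[th] * th^-1 ^+ d) = th^-1 ^+ d * (th^-1 ^+ d * q.[th] ^+ 2).
    by rewrite expr2; ring.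
  by apply: max_idealM => //; inring sW.
split=> //; apply: (@max_pow _ _ _ 2); first exact: over_horner sW DW Wth oq.
rewrite (_ : _ ^+ 2 = th ^+ d * (th^-1 ^+ d * q.[th] ^+ 2)).
  by apply: max_idealM => //; inring sW.
by rewrite mulrA -exprMn mulfV// expr1n mul1r.
Qed.

End Separation.

Lemma external_in_defining (Y : set (valRing K)) : defining_family T Y -> X `<=` Y.
Proof.
move=> dY V XV; have [rkV [r rI [DV Vr]] nV] := XV; have r0 := interval_gt0 rI.
have Vne := rank2_neq hD hK r0 Vr rkV.
suff [z [nVz hz]] : exists z, ~ carrier V z /\ forall W, T `<=` carrier W -> ~ carrier W z -> W = V.
  exact: separated_in_defining XV nVz hz dY.
have nirr : ~ forall q : rat, ratr q != r.
  by move=> irr; apply: Vne; exact: irrational_eq rI irr DV Vr.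
have [q qr] : exists q : rat, ratr q = r.
  apply: contrapT => nq; apply: nirr => q; apply/eqP => qr; apply: nq; by exists q.
have [i [j [i0 j0 cij rE]]] := rational_case r0 nirr.
have jr0 : 0 < j%:R :> R by rewrite ltr0n.
have rj : r * j%:R = i%:R by rewrite rE divfK// gt_eqF.
have rp : residue_parameter x y r (i, 0)%N (0, j)%N.
  by rewrite rE; exact: (rational_residue_parameter R hD).
have rp' := residue_parameter_swap hD rp.
have piE : mon (0, j)%N / mon (i, 0)%N = (par i j)^-1 by rewrite /par invf_div.
have [mp|nmp] := pselect (max_ideal_of V (par i j)).
  have ra : r = a.
    apply/eqP; rewrite eq_le; case/andP: (rI) => ar rb; rewrite ar andbT leNgt; apply/negP => lt.
    apply: nV; apply/internal_cases; exists q; right; rewrite /= qr lt rb; split=> //.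
    apply: (max_theta_near rI rp DV Vr (near_left_filter r) (near_left_decides r) (left_gt0 r0)) => //.
      exact: near_at_left.
    exists r => // s /andP[]; rewrite subrr => s0 sr; apply: par_pos => //.
    by rewrite -rj ltr_pM2r.
  exists (par i j)^-1; apply: (separating_max rI rp DV Vr) => // s /andP[as_ _] sr.
  apply: par_inv_pos; first exact: lt_le_trans as_.
  by rewrite -rj ltr_pM2r// lt_neqAle eq_sym sr ra.
have [mpi|nmpi] := pselect (max_ideal_of V (par i j)^-1).
  have rb : r = b.
    apply/eqP; rewrite eq_le; case/andP: (rI) => ar rb; rewrite rb /= leNgt; apply/negP => lt.
    apply: nV; apply/internal_cases; exists q; left; rewrite /= qr lt ar; split=> //.
    apply: (max_theta_near rI rp' DV Vr (near_right_filter r) (near_right_decides r) (right_gt0 r0)).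
    - exact: near_at_right.
    - exists 1 => // s /andP[rs _]; rewrite /= -/mon piE; apply: par_inv_pos; first exact: lt_trans rs.
      by rewrite -rj ltr_pM2r.
    - by rewrite -/mon piE.
  exists (mon (0, j)%N / mon (i, 0)%N)^-1; apply: (separating_max rI rp' DV Vr).
    by rewrite -/mon piE.
  move=> s /[dup] sI /andP[_ sb] sr; rewrite -/mon piE invrK; apply: par_pos.
    exact: interval_gt0 sI.
  by rewrite -rj ltr_pM2r// lt_neqAle sr rb.
have p0 := par_neq0 i j.
have Vp : carrier V (par i j).
  by apply: contrapT => nVp; apply: nmpi; exact: max_ideal_inv.
have Vpi : carrier V (par i j)^-1.
  by apply: contrapT => nVp; apply: nmp; apply/max_idealE; right.
apply: (separating_unit rI rp DV Vr Vne Vp Vpi) => s sr.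
apply: contra sr => /eqP; rewrite /weight /= mul0r addr0 add0r => e.
by apply/eqP; apply: (mulIf (lt0r_neq0 jr0)); rewrite rj e mulrC.
Qed.

End External.

Unset Implicit Arguments.

Theorem mainTheorem5 (R : realType) (K : fieldType) (D : set K) (x y : K)
  (hD : regular_local_with_parameters D [:: x; y])
  (hK : quotient_field_of D)
  (a b : R) (ha : 0 < a) (hab : a < b) :
  let T := interval_ring D x y [set r : R | a <= r <= b] in
  let X := external_rank2 D x y a b in
  [/\ defining_family T X,
      forall Y : set (valRing K), defining_family T Y -> X `<=` Y,
      forall Y : set (valRing K), minimal_defining_family T Y <-> Y = X
    & vacant T].
Proof.
move=> T X.
have dX := external_defining hD hK ha hab; have XY := @external_in_defining _ _ _ _ _ hD hK _ _ ha hab.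
split=> //.
  move=> Y; split=> [[dY minY]|->]; first by symmetry; apply: minY => //; exact: XY.
  by split=> // Z dZ ZX; apply/seteqP; split=> //; exact: XY.
split; [exact: interval_ring_subring|exact: interval_ring_closed|].
move=> Y dY V TV; have XsubY := XY _ dY.
have [W XW WV] := overring_contains_external hD hK ha hab TV.
apply: Or33; exists W => //; case: XW => [/XsubY|lW]; [by left|right].
by move=> U /lW[W' [W'W /XsubY YW' UW']]; exists W'.
Qed.
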